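(* Let $\boldsymbol{k}\in\mathbb{Z}_+^m$ be a partition of $n$ with $m\geq 2$, let $j\in\{1,\dots,m\}$ and $\lambda>-1$ be given. Let $a\in L^\infty(\mathbb{B}^n)$ be a $(\boldsymbol{k},j)$-quasi-radial quasi-homogeneous symbol, and let $g\in L^\infty(\tau(\mathbb{B}^m)\times S_+^{k_j-1}\times\mathbb{T}^{k_j})$ be the corresponding function, i.e. $g(r,s,\eta t)=g(r,s,t)$ for every $r\in\tau(\mathbb{B}^m)$, $s\in S_+^{k_j-1}$, $t\in\mathbb{T}^{k_j}$, $\eta\in\mathbb{T}$, and $a(z)=g(|z_{(1)}|,\dots,|z_{(m)}|,s_{(j)},t_{(j)})$ for almost every $z\in\mathbb{B}^n$. Then, for every $\boldsymbol{\kappa}\in\mathbb{N}^m$, the coefficients of the linear map $(T_a^{(\lambda)})_{\boldsymbol{\kappa},j}$ are given by \[ \begin{aligned} \langle T_a^{(\lambda)}(e_\alpha),e_\beta\rangle_\lambda = {}& \frac{2^{m-1}\,\Gamma(n+\lambda+|\boldsymbol{\kappa}|+1)}{\pi^{k_j}\,\Gamma(\lambda+1)\sqrt{\alpha_{(j)}!\,\beta_{(j)}!}\prod_{l\neq j}(k_l+\kappa_l-1)!} \\ &\times\int_{\tau(\mathbb{B}^m)\times S_+^{k_j-1}\times\mathbb{T}^{k_j}} g(r,s_{(j)},t_{(j)})\,{s_{(j)}}^{\alpha_{(j)}+\beta_{(j)}+1_{k_j}}\,{t_{(j)}}^{\alpha_{(j)}-\beta_{(j)}} \\ &\qquad\times(1-|r|^2)^\lambda\prod_{l=1}^m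 r_l^{2k_l+2\kappa_l-1}\,dr_l\,ds_{(j)}\,dt_{(j)} \end{aligned} \] for every $\alpha,\beta\in\mathbb{N}^n$ such that $|\alpha_{(l)}|=|\beta_{(l)}|=\kappa_l$ for all $l=1,\dots,m$ and that satisfy $\alpha_{\widehat{(j)}}=\beta_{\widehat{(j)}}$.
   Context: Here $\mathbb{N}=\{0,1,2,\dots\}$, $\mathbb{Z}_+$ is the set of positive integers, $\mathbb{R}_+=[0,\infty)$, $|\boldsymbol{\kappa}|=\kappa_1+\dots+\kappa_m$, and $\tau(\mathbb{B}^m)=\{r\in\mathbb{R}_+^m : |r|<1\}$ with $|r|$ the Euclidean norm. $\mathbb{B}^n$ is the open unit ball of $\mathbb{C}^n$ with Lebesgue measure $v$. For $\lambda>-1$, $dv_\lambda(z) = c_\lambda (1-|z|^2)^\lambda dv(z)$ with $c_\lambda = \frac{\Gamma(n+\lambda+1)}{\pi^n\Gamma(\lambda+1)}$, and $\mathcal{A}^2_\lambda(\mathbb{B}^n)$ is the closed subspace of holomorphic functions in $L^2(\mathbb{B}^n,v_\lambda)$, with inner product $\langle\cdot,\cdot\rangle_\lambda$ and orthogonal projection $B_\lambda$. For $a\in L^\infty(\mathbb{B}^n)$ the Toeplitz operator is $T_a^{(\lambda)}(f)=B_\lambda(af)$ on $\mathcal{A}^2_\lambda(\mathbb{B}^n)$. The canonical orthonormal monomial basis of $\mathcal{A}^2_\lambda(\mathbb{B}^n)$ is $e_\alpha(z)=\sqrt{\frac{\Gamma(n+\lambda+|\alpha|+1)}{\alpha!\,\Gamma(n+\lambda+1)}}\,z^\alpha$,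 $\alpha\in\mathbb{N}^n$. A partition of $n$ is $\boldsymbol{k}=(k_1,\dots,k_m)\in\mathbb{Z}_+^m$ with $k_1+\dots+k_m=n$. It gives $\mathbb{C}^n=\mathbb{C}^{k_1}\times\dots\times\mathbb{C}^{k_m}$, $z=(z_{(1)},\dots,z_{(m)})$ and, for multi-indices, $\alpha=(\alpha_{(1)},\dots,\alpha_{(m)})\in\mathbb{N}^n$ with $\alpha_{(l)}\in\mathbb{N}^{k_l}$. Write $z_{\widehat{(j)}}$, $\alpha_{\widehat{(j)}}$ for the tuples obtained from $z$, $\alpha$ by deleting the $j$-th block, and $1_{k_j}=(1,\dots,1)\in\mathbb{N}^{k_j}$. $S_+^{k_j-1}$ is the set of points of $\mathbb{R}_+^{k_j}$ in the unit sphere of $\mathbb{C}^{k_j}$; $ds_{(j)}$ is the measure on it coming from the Riemannian structure inherited from $\mathbb{R}^{k_j}$, and $dt_{(j)}$ is the Haar measure on $\mathbb{T}^{k_j}$ with total mass $(2\pi)^{k_j}$. One writes $z_{(j)}=|z_{(j)}|\,t_{(j)}\cdot s_{(j)}$ with $t_{(j)}\in\mathbb{T}^{k_j}$, $s_{(j)}\in S_+^{k_j-1}$, where $t\cdot s$ is the componentwise product. A symbol $a\in L^\infty(\mathbb{B}^n)$ is $(\boldsymbol{k},j)$-quasi-radial quasi-homogeneous if $a\circ A=a$ for all $A$ in the block diagonal subgroup $\mathrm{U}(\boldsymbol{k},j,\mathbb{T})=\mathrm{U}(k_1)\times\dots\times\mathrm{U}(k_{j-1})\times\mathbb{T}I_{(j)}\times\mathrm{U}(k_{j+1})\times\dots\times\mathrm{U}(k_m)$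 of $\mathrm{U}(n)$, $I_{(j)}$ being the identity of $\mathbb{C}^{k_j}$; this is equivalent to the existence of a function $g$ as in the claim. For such $a$ and $\boldsymbol{\kappa}\in\mathbb{N}^m$, $T_a^{(\lambda)}$ preserves each subspace ${z_{\widehat{(j)}}}^{\gamma}\mathcal{P}_{\kappa_j}(\mathbb{C}^{k_j})$ with $\gamma\in\mathbb{N}^{n-k_j}$, $|\gamma_{(l)}|=\kappa_l$ for $l\neq j$ (here $\mathcal{P}_{\kappa_j}(\mathbb{C}^{k_j})$ is the space of homogeneous polynomials of degree $\kappa_j$ in $z_{(j)}$), and under the natural identifications ${z_{\widehat{(j)}}}^{\gamma}p(z_{(j)})\leftrightarrow p$ it acts on all of them by one and the same linear map, denoted $(T_a^{(\lambda)})_{\boldsymbol{\kappa},j}\in\mathrm{End}(\mathcal{P}_{\kappa_j}(\mathbb{C}^{k_j}))$. Its coefficients are the numbers $\langle T_a^{(\lambda)}(e_\alpha),e_\beta\rangle_\lambda$ with $\alpha,\beta$ as in the claim (matrix entries of the restriction of $T_a^{(\lambda)}$ to ${z_{\widehat{(j)}}}^{\gamma}\mathcal{P}_{\kappa_j}(\mathbb{C}^{k_j})$, $\gamma=\alpha_{\widehat{(j)}}=\beta_{\widehat{(j)}}$, in the orthonormal basis of the $e_\alpha$). *)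

(* Defs.v *)
From HB Require Import structures.
From mathcomp Require Import all_boot all_order all_algebra.
From mathcomp Require Import complex.
From mathcomp Require Import all_classical all_reals all_analysis.
From mathcomp Require Import measurable_realfun.

Set Implicit Arguments.
Unset Strict Implicit.
Unset Printing Implicit Defensive.

Import Order.TTheory GRing.Theory Num.Theory numFieldNormedType.Exports.
Import ComplexField.

Local Open Scope classical_set_scope.
Local Open Scope complex_scope.
Local Open Scope ring_scope.

Section measurable_complex.
Variable R : realType.

HB.instance Definition _ := isPointed.Build R[i] 0.

(* sets generated by the real and imaginary parts: the Borel sets of C = R^2 *)
Let cmeas := g_sigma_preimageU (@complex.Re R) (@complex.Im R).

Let cmeas0 : cmeas set0. Proof. exact: sigma_algebra0. Qed.

Let cmeasC A : cmeas A -> cmeas (~` A).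
Proof. exact: sigma_algebraC. Qed.

Let cmeas_bigcup (F : (set R[i])^nat) :
  (forall i, cmeas (F i)) -> cmeas (\bigcup_i F i).
Proof. exact: sigma_algebra_bigcup. Qed.

HB.instance Definition _ := @isMeasurable.Build default_measure_display
  R[i] cmeas cmeas0 cmeasC cmeas_bigcup.

Lemma measurable_fun_complexP d (T : measurableType d) (f : T -> R[i]) :
  measurable_fun setT f <->
  measurable_fun setT (fun x => complex.Re (f x)) /\
  measurable_fun setT (fun x => complex.Im (f x)).
Proof.
split=> [mf|[mr mi]].
  split=> _ Y mY; rewrite setTI.
    rewrite (_ : _ @^-1` Y = f @^-1` (@complex.Re R @^-1` Y))//.
    rewrite -[X in measurable X]setTI; apply: mf => //.
    by apply: sub_sigma_algebra; left; exists Y => //; rewrite setTI.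
  rewrite (_ : _ @^-1` Y = f @^-1` (@complex.Im R @^-1` Y))//.
  rewrite -[X in measurable X]setTI; apply: mf => //.
  by apply: sub_sigma_algebra; right; exists Y => //; rewrite setTI.
apply: (@measurability _ _ _ _ setT f
  (preimage_set_system setT (@complex.Re R) measurable `|`
   preimage_set_system setT (@complex.Im R) measurable)) => //.
move=> _ [_ [[Y mY <-]|[Y mY <-]] <-]; rewrite !setTI.
  by rewrite -[X in measurable X]setTI; exact: (mr measurableT Y mY).
by rewrite -[X in measurable X]setTI; exact: (mi measurableT Y mY).
Qed.

End measurable_complex.

Section measurable_row.
Context d (T : measurableType d).
Variable n : nat.

Let coord (i : 'I_n) (v : 'rV[T]_n) : T := v ord0 i.

Let row0 : g_sigma_preimage coord set0. Proof. exact: sigma_algebra0. Qed.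

Let rowC A : g_sigma_preimage coord A -> g_sigma_preimage coord (~` A).
Proof. exact: sigma_algebraC. Qed.

Let row_bigcup (F : (set 'rV[T]_n)^nat) :
  (forall i, g_sigma_preimage coord (F i)) ->
  g_sigma_preimage coord (\bigcup_i F i).
Proof. exact: sigma_algebra_bigcup. Qed.

HB.instance Definition _ := @isMeasurable.Build (measure_tuple_display d)
  'rV[T]_n (g_sigma_preimage coord) row0 rowC row_bigcup.

Lemma measurable_coord (i : 'I_n) :
  measurable_fun setT (fun v : 'rV[T]_n => v ord0 i).
Proof.
move=> _ Y mY; rewrite setTI; apply: sub_sigma_algebra.
rewrite -bigcup_seq/=; exists i => /=; first by rewrite mem_index_enum.
by exists Y => //; rewrite setTI.
Qed.

Lemma measurable_fun_rowP d1 (T1 : measurableType d1) (f : T1 -> 'rV[T]_n) :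
  measurable_fun setT f <->
  forall i, measurable_fun setT (fun x => f x ord0 i).
Proof.
split=> [mf i|mf].
  exact: (measurableT_comp (measurable_coord i) mf).
apply: (@measurability _ _ _ _ setT f
  (\big[setU/set0]_(i < n) preimage_set_system setT (coord i) measurable)) => //.
move=> _ [B + <-]; rewrite -bigcup_seq/= => -[i _ [Y mY <-]].
by rewrite !setTI -[X in measurable X]setTI; exact: (mf i measurableT Y mY).
Qed.

End measurable_row.

Section pushforward_sigma_finite.
Context d1 d2 (T1 : measurableType d1) (T2 : measurableType d2) (R : realType).
Variables (mu : {sigma_finite_measure set T1 -> \bar R}).
Variables (f : T1 -> T2) (g : T2 -> T1).
Hypotheses (mf : measurable_fun setT f) (mg : measurable_fun setT g).
Hypothesis fK : cancel f g.

Let push_measure : {measure set T2 -> \bar R}.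
Proof. by refine (pushforward mu f : {measure set T2 -> \bar R}). Defined.

Definition push_fun : set T2 -> \bar R := pushforward mu f.

HB.instance Definition _ := isMeasure.Build _ _ _ push_fun
  (measure0 push_measure) (measure_ge0 push_measure)
  (@measure_semi_sigma_additive _ _ _ push_measure).

Let sigma_finite_push : sigma_finite setT push_fun.
Proof.
have [F FT Foo] := sigma_finiteT mu.
exists (fun k => g @^-1` F k); first by rewrite -preimage_bigcup -FT.
move=> k; have [mF Fk] := Foo k; split.
  by rewrite -[X in measurable X]setTI; exact: mg.
rewrite /push_fun /pushforward (_ : _ @^-1` _ = F k)//.
by apply/seteqP; split => x /=; rewrite fK.
Qed.

HB.instance Definition _ :=
  @Measure_isSigmaFinite.Build _ _ _ push_fun sigma_finite_push.

Definition spush : {sigma_finite_measure set T2 -> \bar R} := push_fun.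

Lemma spushE : spush = pushforward mu f :> (set T2 -> \bar R).
Proof. by []. Qed.

End pushforward_sigma_finite.

(* The canonical sigma-finite structure of the library on m1 \x m2 is         *)
(* shadowed by the one on products of subprobabilities; sprod restores it.    *)

Section product_sigma_finite.
Local Open Scope ereal_scope.
Context d1 d2 (T1 : measurableType d1) (T2 : measurableType d2) (R : realType).
Variable m1 : {sigma_finite_measure set T1 -> \bar R}.
Variable m2 : {sigma_finite_measure set T2 -> \bar R}.

Let prod_measure : {measure set (T1 * T2) -> \bar R} := m1 \x m2.

Definition prod_fun : set (T1 * T2) -> \bar R := m1 \x m2.

HB.instance Definition _ := isMeasure.Build _ _ _ prod_fun
  (measure0 prod_measure) (measure_ge0 prod_measure)
  (@measure_semi_sigma_additive _ _ _ prod_measure).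

Let prod_sigma_finite : sigma_finite setT prod_fun.
Proof.
have /sigma_finiteP[F [TF ndF Foo]] := sigma_finiteT m1.
have /sigma_finiteP[G [TG ndG Goo]] := sigma_finiteT m2.
exists (fun n => F n `*` G n).
  rewrite -setXTT TF TG predeqE => -[x y]; split.
    move=> [/= [n _ Fnx] [k _ Gky]]; exists (maxn n k) => //; split.
    - by move: x Fnx; exact/subsetPset/ndF/leq_maxl.
    - by move: y Gky; exact/subsetPset/ndG/leq_maxr.
  by move=> [n _ []/= ? ?]; split; exists n.
move=> k; have [? ?] := Foo k; have [? ?] := Goo k.
split; first exact: measurableX.
by rewrite /prod_fun product_measure1E// lte_mul_pinfty// ge0_fin_numE.
Qed.

HB.instance Definition _ :=
  @Measure_isSigmaFinite.Build _ _ _ prod_fun prod_sigma_finite.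

Definition sprod : {sigma_finite_measure set (T1 * T2)%type -> \bar R} :=
  prod_fun.

Lemma sprodE : sprod = m1 \x m2 :> (set (T1 * T2) -> \bar R).
Proof. by []. Qed.

End product_sigma_finite.

(* Lebesgue measure on R and on C.  The library puts its Lebesgue measure on  *)
(* measurableTypeR R, which has the same measurable sets as R but another     *)
(* measure_display; the pushforward by the identity only changes the display. *)

Section lebesgue_RC.
Variable R : realType.

Let midR : measurable_fun setT (idfun : measurableTypeR R -> R).
Proof. by move=> _ Y mY; rewrite setTI. Qed.

Let midR' : measurable_fun setT (idfun : R -> measurableTypeR R).
Proof. by move=> _ Y mY; rewrite setTI. Qed.

Definition lebR : {sigma_finite_measure set R -> \bar R} :=
  spush (@lebesgue_measure R) midR midR' (fun=> erefl).

Lemma lebRE (A : set R) : lebR A = lebesgue_measure A.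
Proof. by []. Qed.

Let complex_pair (p : R * R) : R[i] := p.1 +i* p.2.

Let pair_complex (z : R[i]) : R * R := (complex.Re z, complex.Im z).

Let mcomplex_pair : measurable_fun setT complex_pair.
Proof.
apply/measurable_fun_complexP; split => /=.
  exact: measurable_fst.
exact: measurable_snd.
Qed.

Let mpair_complex : measurable_fun setT pair_complex.
Proof.
have [] := (measurable_fun_complexP (@idfun R[i])).1 (@measurable_id _ _ _).
by move=> mr mi; exact: measurable_fun_pair.
Qed.

Let complex_pairK : cancel complex_pair pair_complex.
Proof. by case. Qed.

Definition lebC : {sigma_finite_measure set R[i] -> \bar R} :=
  spush (sprod lebR lebR) mcomplex_pair mpair_complex complex_pairK.

End lebesgue_RC.

Section measure_power.
Context d (T : measurableType d) (R : realType).
Variable mu : {sigma_finite_measure set T -> \bar R}.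

Definition row_cons n (p : T * 'rV[T]_n) : 'rV[T]_n.+1 :=
  \row_(i < n.+1) oapp (fun i' => p.2 ord0 i') p.1 (unlift ord0 i).

Definition row_uncons n (v : 'rV[T]_n.+1) : T * 'rV[T]_n :=
  (v ord0 ord0, \row_(i < n) v ord0 (lift ord0 i)).

Lemma row_consK n : cancel (@row_cons n) (@row_uncons n).
Proof.
case=> x v; rewrite /row_uncons mxE unlift_none/=; congr (_, _).
by apply/rowP => i; rewrite !mxE liftK.
Qed.

Lemma measurable_row_cons n : measurable_fun setT (@row_cons n).
Proof.
apply/measurable_fun_rowP => i.
have [j ->|->] := unliftP ord0 i.
  under eq_fun do rewrite mxE liftK/=.
  exact: (measurableT_comp (measurable_coord _) measurable_snd).
under eq_fun do rewrite mxE unlift_none/=.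
exact: measurable_fst.
Qed.

Lemma measurable_row_uncons n : measurable_fun setT (@row_uncons n).
Proof.
apply: measurable_fun_pair; first exact: measurable_coord.
apply/measurable_fun_rowP => i; under eq_fun do rewrite mxE.
exact: measurable_coord.
Qed.

Fixpoint powm n : {sigma_finite_measure set 'rV[T]_n -> \bar R} :=
  match n with
  | 0 => \d_(const_mx point)
  | n'.+1 => spush (sprod mu (powm n')) (@measurable_row_cons n')
               (@measurable_row_uncons n') (@row_consK n')
  end.

End measure_power.

(* The Haar measure of T^k of total mass (2 pi)^k is the k-th power of the arc *)
(* length of the unit circle; it is a measure on C^k carried by T^k.           *)

Section torus.
Variable R : realType.

Definition expi (x : R) : R[i] := cos x +i* sin x.

Lemma measurable_expi : measurable_fun setT expi.
Proof.
apply/measurable_fun_complexP; split => /=.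
  by apply: continuous_measurable_fun; exact: continuous_cos.
by apply: continuous_measurable_fun; exact: continuous_sin.
Qed.

Let mitv : measurable (`[0, 2 * pi[ : set R). Proof. exact: measurable_itv. Qed.

Let arc : {measure set R[i] -> \bar R}.
Proof.
refine (pushforward (mrestr (lebR R) mitv) expi : {measure set _ -> \bar R}).
exact: measurable_expi.
Defined.

Definition arc_fun : set R[i] -> \bar R :=
  fun A => lebR R ((expi @^-1` A) `&` `[0, 2 * pi[).

HB.instance Definition _ := isMeasure.Build _ _ _ arc_fun
  (measure0 arc) (measure_ge0 arc) (@measure_semi_sigma_additive _ _ _ arc).

Let arc_sigma_finite : sigma_finite setT arc_fun.
Proof.
exists (fun=> setT); first by rewrite bigcup_const.
move=> _; split => //; rewrite /arc_fun preimage_setT setTI lebRE.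
by rewrite lebesgue_measure_itv/=; case: ifP; rewrite ltry.
Qed.

HB.instance Definition _ :=
  @Measure_isSigmaFinite.Build _ _ _ arc_fun arc_sigma_finite.

Definition arc_length : {sigma_finite_measure set R[i] -> \bar R} := arc_fun.

Definition torus k : set 'rV[R[i]]_k :=
  [set t | forall i, Normc.normc (t ord0 i) = 1].

Definition haar_torus k : {sigma_finite_measure set 'rV[R[i]]_k -> \bar R} :=
  powm arc_length k.

End torus.

Section euclidean_norm.
Variable R : realType.

Definition enorm n (x : 'rV[R]_n) : R := Num.sqrt (\sum_i x ord0 i ^+ 2).

Definition cnorm n (z : 'rV[R[i]]_n) : R := enorm (map_mx (@Normc.normc R) z).

Lemma enorm_sqr n (x : 'rV[R]_n) : enorm x ^+ 2 = \sum_i x ord0 i ^+ 2.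
Proof. by rewrite sqr_sqrtr// sumr_ge0// => i _; exact: sqr_ge0. Qed.

Lemma measurable_sqrtr : measurable_fun setT (@Num.sqrt R).
Proof. by apply: continuous_measurable_fun; exact: sqrt_continuous. Qed.

Lemma measurable_enorm n : measurable_fun setT (@enorm n).
Proof.
apply: (measurableT_comp measurable_sqrtr).
apply: measurable_sum => i; apply: measurable_funX; exact: measurable_coord.
Qed.

End euclidean_norm.

Section sphere.
Variables (R : realType) (k : nat).

Definition sphere_plus : set 'rV[R]_k :=
  [set s : 'rV_k | (forall i, 0 <= s ord0 i) /\ enorm s = 1].

(* The graph chart x |-> (x, sqrt (1 - |x|^2)) over the open set where it is  *)
(* smooth.  Its image misses only the points of S_+^{k-1} whose last          *)
(* coordinate vanishes, a null set for the Riemannian measure.                *)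
Definition sphere_chart (x : 'rV[R]_k.-1) : 'rV[R]_k :=
  \row_(i < k) oapp (fun i' : 'I_k.-1 => x ord0 i')
    (Num.sqrt (1 - enorm x ^+ 2)) (insub (i : nat)).

Definition sphere_dom : set 'rV[R]_k.-1 :=
  [set x : 'rV_k.-1 | (forall i, 0 <= x ord0 i) /\ enorm x < 1].

(* the metric inherited from R^k, in this chart *)
Definition sphere_metric (x : 'rV[R]_k.-1) : 'M[R]_k.-1 :=
  \matrix_(i, j) \sum_(l < k)
    ('D_(delta_mx ord0 i) sphere_chart x) ord0 l *
    ('D_(delta_mx ord0 j) sphere_chart x) ord0 l.

Definition sphere_density (x : 'rV[R]_k.-1) : R :=
  Num.sqrt (\det (sphere_metric x)).

Let proj (s : 'rV[R]_k) : 'rV[R]_k.-1 :=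
  \row_(i < k.-1) s ord0 (widen_ord (leq_pred k) i).

Let sphere_chartK : cancel sphere_chart proj.
Proof.
move=> x; apply/rowP => i; rewrite !mxE.
by rewrite (_ : insub _ = Some i)// -[RHS]valK.
Qed.

Let mproj : measurable_fun setT proj.
Proof.
apply/measurable_fun_rowP => i; under eq_fun do rewrite mxE.
exact: measurable_coord.
Qed.

Let mchart : measurable_fun setT sphere_chart.
Proof.
apply/measurable_fun_rowP => i; under eq_fun do rewrite mxE.
case: insub => [j|] /=; first exact: measurable_coord.
apply: (measurableT_comp (@measurable_sqrtr R)); apply: measurable_funB => //.
by apply: measurable_funX; exact: measurable_enorm.
Qed.

Let mdom : measurable sphere_dom.
Proof.
rewrite (_ : sphere_dom = (\bigcap_(i in [set: 'I_k.-1])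
    ((fun x : 'rV[R]_k.-1 => x ord0 i) @^-1` `[0, +oo[)) `&`
    (@enorm R k.-1 @^-1` `]-oo, 1[)); last first.
  apply/seteqP; split => x /=.
    case=> x0 x1; split; last by rewrite in_itv.
    by move=> i _ /=; rewrite in_itv/= x0.
  case=> x0; rewrite in_itv/= => x1; split => // i.
  by have := x0 i I; rewrite /= in_itv/= andbT.
apply: measurableI.
  apply: fin_bigcap_measurable => // i _; rewrite -[X in measurable X]setTI.
  by apply: measurable_coord => //; exact: measurable_itv.
rewrite -[X in measurable X]setTI.
by apply: measurable_enorm => //; exact: measurable_itv.
Qed.

Let is_derive_line (V : normedModType R) (f : V -> R) (x v : V) (df : R) :
  is_derive (0 : R) 1 (fun h : R => f (h *: v + x)) df -> is_derive x v f df.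
Proof.
have E : (fun h : R => h^-1 *: (((fun h : R => f (h *: v + x)) \o shift 0)
            (h *: 1) - f (0 *: v + x)))
       = (fun h : R => h^-1 *: ((f \o shift x) (h *: v) - f x)).
  apply/funext => h /=; rewrite scale0r add0r addr0.
  by rewrite -[h *: 1]/(h * 1) mulr1.
move=> [d1 d2]; split.
  by rewrite /derivable -E.
by rewrite -d2 /derive E.
Qed.

Let is_derive_coord (n : nat) (x v : 'rV[R]_n) (l : 'I_n) :
  is_derive x v (fun y : 'rV[R]_n => y ord0 l) (v ord0 l).
Proof.
apply: is_derive_line.
rewrite (_ : (fun h : R => _) = (@id R * cst (v ord0 l) + cst (x ord0 l)));
  last by apply/funext => h; rewrite !mxE.
by apply: is_derive_eq; rewrite /= scaler0 add0r addr0 /GRing.scale /= mulr1.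
Qed.

Let is_derive_last (n : nat) (x v : 'rV[R]_n) : enorm x < 1 ->
  is_derive x v (fun y => Num.sqrt (1 - enorm y ^+ 2))
    (- (\sum_l x ord0 l * v ord0 l) / Num.sqrt (1 - enorm x ^+ 2)).
Proof.
move=> x1; apply: is_derive_line.
pose u := (fun h : R => 1 - enorm (h *: v + x) ^+ 2).
have u0 : u 0 = 1 - enorm x ^+ 2 by rewrite /u scale0r add0r.
have u_gt0 : 0 < u 0.
  by rewrite u0 subr_gt0 expr_lt1// sqrtr_ge0.
have du : is_derive (0 : R) 1 u (- (2 * \sum_l x ord0 l * v ord0 l)).
  have -> : u = cst 1 - \sum_(l < n) (@id R * cst (v ord0 l) + cst (x ord0 l)) ^+ 2.
    apply/funext => h; rewrite /u enorm_sqr !fctE /=; congr (_ - _).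
    rewrite fct_sumE; apply: eq_bigr => l _.
    by rewrite !mxE.
  apply: is_derive_eq; rewrite sub0r; congr (- _); rewrite mulr_sumr.
  apply: eq_bigr => l _; rewrite !fctE /= mul0r add0r expr1 scaler0 add0r addr0.
  by rewrite /GRing.scale /= mulr1 mulrA.
have := @is_derive1_comp R (@Num.sqrt R) u 0 _ _ (is_derive1_sqrt u_gt0) du.
rewrite u0 => /is_derive_eq; apply.
rewrite invfM mulNr mulrN; congr (- _).
by rewrite mulrACA mulVf ?pnatr_eq0// mul1r mulrC.
Qed.

Let chartE (x : 'rV[R]_k.-1) (l : 'I_k) : sphere_chart x ord0 l =
  oapp (fun i' : 'I_k.-1 => x ord0 i') (Num.sqrt (1 - enorm x ^+ 2))
    (insub (l : nat)).
Proof. by rewrite mxE. Qed.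

Lemma is_derive_sphere_chart (x v : 'rV[R]_k.-1) : enorm x < 1 ->
  is_derive x v sphere_chart (\row_(l < k) oapp (fun i' : 'I_k.-1 => v ord0 i')
    (- (\sum_l x ord0 l * v ord0 l) / Num.sqrt (1 - enorm x ^+ 2))
    (insub (l : nat))).
Proof.
move=> x1; have D (l : 'I_k) : is_derive x v (fun y => sphere_chart y ord0 l)
  (oapp (fun i' : 'I_k.-1 => v ord0 i')
    (- (\sum_l x ord0 l * v ord0 l) / Num.sqrt (1 - enorm x ^+ 2))
    (insub (l : nat))).
  under eq_fun do rewrite chartE.
  by case: insub => [i|] /=; [exact: is_derive_coord|exact: is_derive_last].
have dx : derivable sphere_chart x v.
  by apply/derivable_mxP => i l; rewrite ord1; have [] := D l.
split => //; rewrite derive_mx//; apply/rowP => l; rewrite !mxE.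
by have [] := D l.
Qed.

Let sum_insub n (F : option 'I_n.-1 -> R) : (0 < n)%N ->
  \sum_(l < n) F (insub (l : nat)) = \sum_(i < n.-1) F (Some i) + F None.
Proof.
case: n F => // n F _; rewrite big_ord_recr /= insubF ?ltnn//; congr (_ + _).
by apply: eq_bigr => i _; rewrite -[in RHS](valK i).
Qed.

Let sum_delta n (a : 'I_n -> R) (i : 'I_n) :
  \sum_(l < n) a l * (delta_mx ord0 i : 'rV[R]_n) ord0 l = a i.
Proof.
rewrite (bigD1 i)//= mxE !eqxx mulr1 big1 ?addr0// => l li.
by rewrite mxE eqxx (negbTE li) mulr0.
Qed.

Lemma sphere_metricE (x : 'rV[R]_k.-1) i j : enorm x < 1 ->
  sphere_metric x i j =
  (i == j)%:R + x ord0 i * x ord0 j / (1 - enorm x ^+ 2).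
Proof.
move=> x1; have k0 : (0 < k)%N by have := leq_ltn_trans (leq0n i) (ltn_ord i); case: (k).
have D v := @derive_val _ _ _ _ _ _ _ (@is_derive_sphere_chart x v x1).
rewrite mxE !D; under eq_bigr do rewrite !mxE !sum_delta.
rewrite (@sum_insub _ (fun o => oapp _ _ o * oapp _ _ o))//=; congr (_ + _).
  by rewrite sum_delta mxE eqxx eq_sym.
rewrite mulrACA mulrNN -invfM -expr2 sqr_sqrtr// subr_ge0.
by rewrite expr_le1// ?sqrtr_ge0// ltW.
Qed.

Lemma measurable_sphere_density : measurable_fun sphere_dom sphere_density.
Proof.
apply: (measurableT_comp (@measurable_sqrtr R)).
apply: (eq_measurable_fun (fun x : 'rV[R]_k.-1 => \det (\matrix_(i, j)
  ((i == j)%:R + x ord0 i * x ord0 j * (1 - enorm x ^+ 2) `^ (-1))))).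
  move=> x; rewrite inE => -[_ x1]; congr (\det _); apply/matrixP => i j.
  rewrite mxE sphere_metricE// powR_inv1// subr_ge0.
  by rewrite expr_le1// ?sqrtr_ge0// ltW.
apply: measurable_funTS; apply: measurable_sum => s.
apply: measurable_funM => //; apply: measurable_prod => i _.
under eq_fun do rewrite mxE; apply: measurable_funD => //.
apply: measurable_funM; first by apply: measurable_funM; exact: measurable_coord.
apply: (measurableT_comp (measurable_powR _)); apply: measurable_funB => //.
by apply: measurable_funX; exact: measurable_enorm.
Qed.

Definition sphere_vol (A : set 'rV[R]_k) : \bar R :=
  (\int[powm (lebR R) k.-1]_(x in sphere_dom `&` (sphere_chart @^-1` A))
     (sphere_density x)%:E)%E.

Let mpre (A : set 'rV[R]_k) :
  measurable A -> measurable (sphere_dom `&` (sphere_chart @^-1` A)).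
Proof.
move=> mA; apply: measurableI => //.
by rewrite -[X in measurable X]setTI; exact: mchart.
Qed.

Let mdens (B : set 'rV[R]_k.-1) : B `<=` sphere_dom ->
  measurable_fun B (EFin \o sphere_density).
Proof.
by move=> BD; apply/measurable_EFinP; apply: measurable_funS BD _ => //;
  exact: measurable_sphere_density.
Qed.

Let sph0 : sphere_vol set0 = 0%E.
Proof. by rewrite /sphere_vol preimage_set0 setI0 integral_set0. Qed.

Let sph_ge0 A : (0 <= sphere_vol A)%E.
Proof. by apply: integral_ge0 => x _; rewrite lee_fin sqrtr_ge0. Qed.

Let sph_sigma_additive : semi_sigma_additive sphere_vol.
Proof.
move=> F mF tF mUF.
have -> : sphere_vol (\bigcup_n F n) = (\sum_(n <oo) sphere_vol (F n))%E.
  rewrite /sphere_vol preimage_bigcup setI_bigcupr ge0_integral_bigcup//.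
  - by move=> n; exact: mpre.
  - by apply: mdens => x [n _ []].
  - by move=> x _; rewrite lee_fin sqrtr_ge0.
  - apply/trivIsetP => i j _ _ ij; rewrite setIACA -preimage_setI.
    by move/trivIsetP : tF => /(_ _ _ I I ij) ->; rewrite preimage_set0 setI0.
by apply: is_cvg_nneseries => n _ _; exact: sph_ge0.
Qed.

HB.instance Definition _ := isMeasure.Build _ _ _ sphere_vol
  sph0 sph_ge0 sph_sigma_additive.

Let sph_sigma_finite : sigma_finite setT sphere_vol.
Proof.
have /sigma_finiteP[F [FT ndF Foo]] := sigma_finiteT (powm (lebR R) k.-1).
pose G n := (sphere_dom `&` (sphere_density @^-1` `]-oo, n%:R]))
            `|` ~` sphere_dom.
have mG n : measurable (G n).
  apply: measurableU; last exact: measurableC.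
  by apply: measurable_sphere_density => //; exact: measurable_itv.
exists (fun n => proj @^-1` (F n `&` G n)).
  apply/esym; rewrite -subTset => s _.
  have [n _ Fn] : (\bigcup_n F n) (proj s) by rewrite -FT.
  exists (maxn n (Num.truncn (sphere_density (proj s))).+1) => //; split.
    by move: Fn; exact/subsetPset/ndF/leq_maxl.
  have [sd|] := pselect (sphere_dom (proj s)); last by right.
  left; split => //=; rewrite in_itv/=.
  rewrite (le_trans (ltW (truncnS_gt _)))// ler_nat; exact: leq_maxr.
move=> n; have [mF Fn] := Foo n.
have mFG : measurable (proj @^-1` (F n `&` G n)).
  by rewrite -[X in measurable X]setTI; apply: mproj => //; exact: measurableI.
split => //.
apply: (@le_lt_trans _ _ (n%:R%:E * powm (lebR R) k.-1 (F n))%E); last first.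
  by rewrite lte_mul_pinfty.
apply: (@le_trans _ _ (\int[powm (lebR R) k.-1]_(x in sphere_dom `&`
    (sphere_chart @^-1` (proj @^-1` (F n `&` G n)))) (n%:R%:E))%E).
  apply: ge0_le_integral => //; first exact: mpre.
  - by move=> x _; rewrite lee_fin sqrtr_ge0.
  - by apply: mdens => x [].
  - by move=> x [xd [_]]; rewrite sphere_chartK => -[[_]/=|//]; rewrite in_itv.
rewrite integral_cst; last exact: mpre.
apply: lee_wpmul2l => //; apply: le_measure; rewrite ?inE//; first exact: mpre.
by move=> x [_ [+ _]]; rewrite sphere_chartK.
Qed.

HB.instance Definition _ :=
  @Measure_isSigmaFinite.Build _ _ _ sphere_vol sph_sigma_finite.

(* Riemannian volume in this chart: the density is sqrt (det metric).  For     *)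
(* k = 1 this is the unit mass at the only point of S_+^0.                     *)
Definition sphere_measure : {sigma_finite_measure set 'rV[R]_k -> \bar R} :=
  sphere_vol.

Lemma sphere_measureE (A : set 'rV[R]_k) : (sphere_measure A =
  \int[powm (lebR R) k.-1]_(x in sphere_dom `&` (sphere_chart @^-1` A))
    (sphere_density x)%:E)%E.
Proof. by []. Qed.

End sphere.

Section function_spaces.
Variable R : realType.

Definition Cintegral d (T : measurableType d) (mu : {measure set T -> \bar R})
    (D : set T) (f : T -> R[i]) : R[i] :=
  (\int[mu]_(x in D) complex.Re (f x)) +i* (\int[mu]_(x in D) complex.Im (f x)).

(* f is a Borel representative of an element of L^oo(D, mu). *)
Definition Linfty d (T : measurableType d) (mu : {measure set T -> \bar R})
    (D : set T) (f : T -> R[i]) : Prop :=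
  measurable_fun D f /\
  exists M : R, {ae mu, forall x, D x -> Normc.normc (f x) <= M}.

Definition Gamma (x : R) : R :=
  \int[lebesgue_measure]_(t in `]0, +oo[) (t `^ (x - 1) * expR (- t)).

End function_spaces.

Section multi_index.

Definition mi_abs n (al : 'rV[nat]_n) : nat := (\sum_i al ord0 i)%N.

Definition mi_fact n (al : 'rV[nat]_n) : nat := (\prod_i (al ord0 i)`!)%N.

Definition monomial (A : comNzRingType) n (x : 'rV[A]_n) (al : 'rV[nat]_n) : A :=
  \prod_i x ord0 i ^+ al ord0 i.

Definition zmonomial (A : comUnitRingType) n (x : 'rV[A]_n) (p : 'rV[int]_n) : A :=
  \prod_i x ord0 i ^ p ord0 i.

End multi_index.

Section bergman.
Variables (R : realType) (n : nat) (lam : R).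
Local Notation C := R[i].

Definition cball : set 'rV[C]_n := [set z : 'rV[C]_n | cnorm z < 1].

Definition vol : {sigma_finite_measure set 'rV[C]_n -> \bar R} :=
  powm (lebC R) n.

Definition c_lam : R :=
  Gamma (n%:R + lam + 1) / (pi ^+ n * Gamma (lam + 1)).

(* dv_lam = weight dv *)
Definition weight (z : 'rV[C]_n) : R := c_lam * (1 - cnorm z ^+ 2) `^ lam.

Definition inner (f h : 'rV[C]_n -> C) : C :=
  Cintegral vol cball (fun z => f z * conjc (h z) * (weight z)%:C).

(* Functions are defined on the whole of C^n; only their values on the ball   *)
(* are relevant.                                                              *)
Definition L2_lam (f : 'rV[C]_n -> C) : Prop :=
  measurable_fun cball f /\
  (\int[vol]_(z in cball) (Normc.normc (f z) ^+ 2 * weight z)%:E < +oo)%E.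

(* The cast to numFieldType gives C its topology; C^o is C as a normed space  *)
(* over itself, so that differentiable means complex differentiable in n      *)
(* variables.                                                                 *)
Definition holomorphic (f : 'rV[C]_n -> C) : Prop :=
  let K : numFieldType := C in
  forall z : 'rV[K]_n, cball z -> differentiable (f : 'rV[K]_n -> K^o) z.

Definition bergman (f : 'rV[C]_n -> C) : Prop := L2_lam f /\ holomorphic f.

(* B acts on representatives; since B h is continuous on the ball, it is       *)
(* determined there by the class of h in L^2(v_lam).                           *)
Definition bergman_projection (B : ('rV[C]_n -> C) -> ('rV[C]_n -> C)) : Prop :=
  forall h, L2_lam h ->
    bergman (B h) /\ forall f, bergman f -> inner (fun z => h z - B h z) f = 0.

Definition toeplitz (B : ('rV[C]_n -> C) -> ('rV[C]_n -> C))
    (a f : 'rV[C]_n -> C) : 'rV[C]_n -> C := B (fun z => a z * f z).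

Definition ebasis (al : 'rV[nat]_n) (z : 'rV[C]_n) : C :=
  (Num.sqrt (Gamma (n%:R + lam + (mi_abs al)%:R + 1) /
             ((mi_fact al)%:R * Gamma (n%:R + lam + 1))))%:C * monomial z al.

End bergman.

Arguments cball {R n} _.
Arguments vol R n : clear implicits.

(* The blocks of z : C^(k_1 + ... + k_m) are the submxrow z l. *)
Section quasi_radial.
Variables (R : realType) (m : nat) (k : 'I_m -> nat) (j : 'I_m).
Local Notation C := R[i].
Local Notation n := (\sum_l k l)%N.

Definition U_kjT (A : 'M[C]_n) : Prop :=
  exists U : forall l, 'M[C]_(k l),
    [/\ A = \mxdiag_l U l,
        forall l, l != j -> U l \is unitarymx &
        exists2 eta : C, Normc.normc eta = 1 & U j = eta%:M].

(* Vectors are rows, so that A acts by z |-> z *m A^T. *)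
Definition quasi_radial_quasi_homogeneous (a : 'rV[C]_n -> C) : Prop :=
  forall A, U_kjT A ->
    {ae vol R n, forall z, cball z -> a (z *m A^T) = a z}.

Definition tau_ball : set 'rV[R]_m :=
  [set r : 'rV[R]_m | (forall l, 0 <= r ord0 l) /\ enorm r < 1].

Definition polar_dom : set ('rV[R]_m * ('rV[R]_(k j) * 'rV[C]_(k j))) :=
  tau_ball `*` (@sphere_plus R (k j) `*` @torus R (k j)).

Definition polar_measure :=
  sprod (powm (lebR R) m) (sprod (sphere_measure R (k j)) (haar_torus R (k j))).

Definition block_norms (z : 'rV[C]_n) : 'rV[R]_m :=
  \row_l cnorm (submxrow z l).

(* z_(j) = |z_(j)| t . s *)
Definition polar_block (z : 'rV[C]_n) (s : 'rV[R]_(k j)) (t : 'rV[C]_(k j)) :=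
  [/\ sphere_plus s, torus t &
      forall i, submxrow z j ord0 i =
        (cnorm (submxrow z j))%:C * (t ord0 i * (s ord0 i)%:C)].

Definition polar_symbol (a : 'rV[C]_n -> C)
    (g : 'rV[R]_m -> 'rV[R]_(k j) -> 'rV[C]_(k j) -> C) : Prop :=
  {ae vol R n, forall z, cball z ->
     forall s t, polar_block z s t -> a z = g (block_norms z) s t}.

End quasi_radial.

Arguments polar_dom R {m} k j _.
Arguments polar_measure R {m} k j.

(* Main.v *)
(* Since e_beta is holomorphic, <T_a e_alpha, e_beta> = <a e_alpha, e_beta>.
   In polar coordinates on each block, z_(l) = |z_(l)| t_(l) . s_(l), this
   integral splits.  For l != j the integrand depends on z_(l) only through
   |z_(l)| and |z_(l)^alpha_(l)|^2, because alpha_(l) = beta_(l), and the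
   integral over the directions of z_(l) is the constant
   2 pi^k_l alpha_(l)! / (k_l + |alpha_(l)| - 1)!, found by testing with a
   Gaussian.  For l = j the directions (s_(j), t_(j)) are kept.  Multiplying by
   the normalizations of e_alpha, e_beta and v_lambda gives the coefficient.

   The polar decomposition of C^n is derived from C = {rho e^(i phi)}, applied
   coordinatewise, followed by spherical coordinates of the moduli in the chart
   that defines the measure on S_+^(k-1).  For the product of the blocks it is an
   identity of measures on R^m x S_+^(k_j-1) x T^(k_j), checked on boxes. *)

Require Import Defs.
From HB Require Import structures.
From mathcomp Require Import all_boot all_order all_algebra.
From mathcomp Require Import complex.
From mathcomp Require Import all_classical all_reals all_analysis.
From mathcomp Require Import measurable_realfun ring lra zify.

Set Implicit Arguments.
Unset Strict Implicit.
Unset Printing Implicit Defensive.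

Import Order.TTheory GRing.Theory Num.Theory numFieldNormedType.Exports.
Import ComplexField.

Local Open Scope classical_set_scope.
Local Open Scope complex_scope.
Local Open Scope ring_scope.

(** * Image measures and powers of a measure *)

(** The changes of variables that are proved directly are all on the line, where an increasing
    bijection onto an interval is handled through the fundamental theorem of calculus. Every formula
    in higher dimension is assembled from these by Tonelli, so it is stated for nonnegative
    measurable functions, and domains enter as boolean factors such as [(0 < r)%:R] of an integrand
    on the whole space. Signs come back only at the end: positive and negative parts of the real and
    imaginary parts are transferred separately.

    Polar directions are ambiguous at points with a vanishing coordinate. These points are never
    removed: the Jacobian factors vanish there. Uniqueness of measures on boxes is what permits a
    symbol [g] that is not a product in r, s, t. The measures compared have infinite mass, so the
    space is exhausted by bounded boxes, whose finiteness comes from a Gaussian bound.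

    In the final constant, [c_lam] brings pi^-n and each block l != j gives back 2 pi^k_l, which
    leaves 2^(m-1) and pi^-k_j. *)

Section weighted_measure.
Context d (T : measurableType d) (R : realType).
Variables (mu : {measure set T -> \bar R}) (w : T -> R).
Hypotheses (w0 : forall x, 0 <= w x) (mw : measurable_fun setT w).
Local Open Scope ereal_scope.

Definition wmeasure (A : set T) : \bar R := \int[mu]_(x in A) (w x)%:E.

Let mwE (A : set T) : measurable_fun A (EFin \o w).
Proof. by apply/measurable_EFinP; exact: measurable_funTS. Qed.

Let wmeasure0 : wmeasure set0 = 0. Proof. exact: integral_set0. Qed.

Let wmeasure_ge0 A : 0 <= wmeasure A.
Proof. by apply: integral_ge0 => x _; rewrite lee_fin. Qed.

Let wmeasure_sigma_additive : semi_sigma_additive wmeasure.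
Proof.
move=> F mF tF mUF.
have -> : wmeasure (\bigcup_n F n) = \sum_(n <oo) wmeasure (F n).
  by rewrite /wmeasure ge0_integral_bigcup// => x _; rewrite lee_fin.
by apply: is_cvg_nneseries => n _ _; exact: wmeasure_ge0.
Qed.

HB.instance Definition _ := isMeasure.Build _ _ _ wmeasure
  wmeasure0 wmeasure_ge0 wmeasure_sigma_additive.

Import HBNNSimple.

(** Both sides pass to the limit along increasing simple functions, and on the indicator of a set
    the identity is the definition of [wmeasure]. *)
Lemma ge0_integral_wmeasure (f : T -> \bar R) : (forall x, 0 <= f x) ->
  measurable_fun setT f ->
  \int[wmeasure]_x f x = \int[mu]_x (f x * (w x)%:E).
Proof.
move=> f0 mf; pose h := nnsfun_approx measurableT mf.
have -> : \int[wmeasure]_x f x =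
    lim (\int[wmeasure]_x (EFin \o h n) x @[n --> \oo]).
  have fE x : f x = lim ((EFin \o h n) x @[n --> \oo]).
    by apply/esym/cvg_lim => //; exact: cvg_nnsfun_approx.
  under eq_integral do rewrite fE.
  apply: monotone_convergence => //.
  - by move=> n; apply/measurable_EFinP; exact/measurable_funP.
  - by move=> n x _; rewrite lee_fin.
  - by move=> x _ a b ab; rewrite lee_fin; exact/lefP/nd_nnsfun_approx.
have -> : \int[mu]_x (f x * (w x)%:E) =
    lim (\int[mu]_x ((EFin \o h n) x * (w x)%:E) @[n --> \oo]).
  have fE x : f x * (w x)%:E = lim ((EFin \o h n) x * (w x)%:E @[n --> \oo]).
    by apply/esym/cvg_lim => //; apply: cvgeZr => //; exact: cvg_nnsfun_approx.
  under eq_integral do rewrite fE.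
  apply: monotone_convergence => //.
  - by move=> n; apply: emeasurable_funM => //; apply/measurable_EFinP.
  - by move=> n x _; rewrite mule_ge0 ?lee_fin ?w0.
  - move=> x _ a b ab; rewrite lee_wpmul2r ?lee_fin ?w0//.
    exact/lefP/nd_nnsfun_approx.
suff suf n : \int[wmeasure]_x (EFin \o h n) x =
    \int[mu]_x ((EFin \o h n) x * (w x)%:E).
  by under eq_fun do rewrite suf.
have indich r : measurable_fun setT (fun x => (r * \1_(h n @^-1` [set r]) x)%:E).
  by apply: (measurable_comp measurableT) => //; exact: measurable_funM.
transitivity (\int[wmeasure]_x
   (\sum_(y \in range (h n)) (y * \1_(h n @^-1` [set y]) x)%:E)).
  by apply: eq_integral => t _; rewrite /= fimfunE -fsumEFin.
rewrite ge0_integral_fsum//; last by move=> m y _; exact: nnfun_muleindic_ge0.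
transitivity (\int[mu]_x (\sum_(y \in range (h n))
    (y * \1_(h n @^-1` [set y]) x)%:E * (w x)%:E)); last first.
  apply: eq_integral => x _.
  rewrite -ge0_mule_fsuml => [|y]; last exact: nnfun_muleindic_ge0.
  by rewrite fsumEFin // -(fimfunE _ x).
rewrite ge0_integral_fsum//; last 2 first.
  - by move=> y; apply: emeasurable_funM.
  - by move=> m y _; rewrite mule_ge0 ?lee_fin ?w0//; exact: nnfun_muleindic_ge0.
apply: eq_fsbigr => r rhn.
under eq_integral do rewrite EFinM.
rewrite integralZl_indic_nnsfun//.
under [RHS]eq_integral do rewrite EFinM -muleA.
rewrite ge0_integralZl//.
- rewrite integral_indic// setIT; congr (_ * _).
  rewrite -[LHS]/(\int[mu]_(x in _) (w x)%:E) [LHS]integral_mkcond.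
  apply: eq_integral => x _.
  by rewrite epatch_indic muleC.
- by apply: emeasurable_funM => //; exact/measurable_EFinP.
- by move=> t _; rewrite mule_ge0 ?lee_fin.
- by move: rhn; rewrite inE => -[t _ <-]; rewrite lee_fin.
Qed.

End weighted_measure.

(** [nu] is compared with the weighted image on measurable sets only. This lets one lemma serve for
    measures defined in another way, such as [arc_length] and [sphere_measure]. *)
Lemma ge0_integral_image d1 d2 (T1 : measurableType d1) (T2 : measurableType d2)
    (R : realType) (mu : {measure set T1 -> \bar R})
    (nu : {measure set T2 -> \bar R}) (w : T1 -> R) (f : T1 -> T2)
    (h : T2 -> \bar R) :
  (forall x, 0 <= w x) -> measurable_fun setT w -> measurable_fun setT f ->
  (forall A, measurable A -> nu A = (\int[mu]_(x in f @^-1` A) (w x)%:E)%E) ->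
  measurable_fun setT h -> (forall x, (0 <= h x)%E) ->
  (\int[nu]_y h y = \int[mu]_x (h (f x) * (w x)%:E))%E.
Proof.
move=> w0 mw mf nuE mh h0.
have [m mE] : exists m : {measure set T2 -> \bar R},
    m = pushforward (wmeasure mu w) f :> (set T2 -> \bar R).
  by unshelve eexists; [refine (pushforward (wmeasure mu w) f)|].
rewrite -(ge0_integral_wmeasure mu w0 mw)//; last exact: measurableT_comp.
rewrite -[RHS](ge0_integral_pushforward mf _ (D := setT) (f := h))// -mE.
by apply: eq_measure_integral => A mA _; rewrite mE; exact: nuE.
Qed.

Lemma integral_indic_image d1 d2 (T1 : measurableType d1) (T2 : measurableType d2)
    (R : realType) (mu : {measure set T1 -> \bar R}) (w : T1 -> R) (f : T1 -> T2)
    (A : set T2) :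
  (\int[mu]_(x in f @^-1` A) (w x)%:E = \int[mu]_x (\1_A (f x) * w x)%:E)%E.
Proof.
rewrite integral_mkcond; apply: eq_integral => x _; rewrite patchE indicE.
rewrite (_ : (x \in f @^-1` A) = (f x \in A)); last by apply/idP/idP; rewrite !inE.
by case: ifP; rewrite ?mul1r ?mul0r.
Qed.

(** Two such images are compared later by uniqueness on boxes, which requires them as bundled
    measures. *)
Lemma image_measure_exists d1 d2 (T1 : measurableType d1) (T2 : measurableType d2)
    (R : realType) (mu : {measure set T1 -> \bar R}) (w : T1 -> R) (f : T1 -> T2) :
  (forall x, 0 <= w x) -> measurable_fun setT w -> measurable_fun setT f ->
  exists nu : {measure set T2 -> \bar R},
    forall A, measurable A -> nu A = (\int[mu]_(x in f @^-1` A) (w x)%:E)%E.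
Proof.
move=> w0 mw mf; unshelve eexists; first refine (pushforward (wmeasure mu w) f).
all: rewrite //.
Qed.

Section product_integrals.
Local Open Scope ereal_scope.

Lemma ge0_integral_spush d1 d2 (T1 : measurableType d1) (T2 : measurableType d2)
    (R : realType) (mu : {sigma_finite_measure set T1 -> \bar R})
    (f : T1 -> T2) (g : T2 -> T1) (mf : measurable_fun setT f)
    (mg : measurable_fun setT g) (fK : cancel f g) (h : T2 -> \bar R) :
  measurable_fun setT h -> (forall x, 0 <= h x) ->
  \int[spush mu mf mg fK]_x h x = \int[mu]_x h (f x).
Proof.
move=> mh h0; rewrite [LHS](ge0_integral_pushforward mf mu measurableT mh)//.
Qed.

Context d1 d2 (T1 : measurableType d1) (T2 : measurableType d2) (R : realType).
Variables (m1 : {sigma_finite_measure set T1 -> \bar R}).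
Variables (m2 : {sigma_finite_measure set T2 -> \bar R}).

Lemma ge0_integral_sprod (h : T1 * T2 -> \bar R) :
  measurable_fun setT h -> (forall x, 0 <= h x) ->
  \int[sprod m1 m2]_x h x = \int[m1]_x \int[m2]_y h (x, y).
Proof. by move=> mh h0; exact: (@fubini_tonelli1 _ _ _ _ _ m1 m2 h). Qed.

Lemma ge0_integral_swap (h : T1 * T2 -> \bar R) :
  measurable_fun setT h -> (forall x, 0 <= h x) ->
  \int[m1]_x \int[m2]_y h (x, y) = \int[m2]_y \int[m1]_x h (x, y).
Proof. by move=> mh h0; exact: (@fubini_tonelli _ _ _ _ _ m1 m2 h). Qed.

Lemma measurable_integral1 (h : T1 * T2 -> \bar R) :
  measurable_fun setT h -> (forall x, 0 <= h x) ->
  measurable_fun setT (fun x => \int[m2]_y h (x, y)).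
Proof.
by move=> mh h0; exact: (@measurable_fun_fubini_tonelli_F _ _ _ _ _ m2 h).
Qed.

End product_integrals.

Section row_power.
Context d (T : measurableType d) (R : realType).
Variable mu : {sigma_finite_measure set T -> \bar R}.
Local Open Scope ereal_scope.

Lemma rowV0 (A : Type) (u v : 'rV[A]_0) : u = v.
Proof. by apply/rowP => -[]. Qed.

Lemma integral_powm0 (h : 'rV[T]_0 -> \bar R) : measurable_fun setT h ->
  \int[powm mu 0]_v h v = h (const_mx point).
Proof. by move=> mh; rewrite /= integral_dirac// diracT mul1e. Qed.

Lemma integral_powmS n (h : 'rV[T]_n.+1 -> \bar R) :
  measurable_fun setT h -> (forall x, 0 <= h x) ->
  \int[powm mu n.+1]_v h v = \int[mu]_x \int[powm mu n]_v h (row_cons (x, v)).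
Proof.
move=> mh h0; rewrite /powm -/(powm mu n) ge0_integral_spush// ge0_integral_sprod//.
by apply: measurableT_comp => //; exact: measurable_row_cons.
Qed.

Lemma row_cons0 n (x : T) (v : 'rV[T]_n) : row_cons (x, v) ord0 ord0 = x.
Proof. by rewrite mxE unlift_none. Qed.

Lemma row_consS n (x : T) (v : 'rV[T]_n) i :
  row_cons (x, v) ord0 (lift ord0 i) = v ord0 i.
Proof. by rewrite mxE liftK. Qed.

Lemma integral_powm_prod n (h : 'I_n -> T -> R) :
  (forall i, measurable_fun setT (h i)) -> (forall i x, (0 <= h i x)%R) ->
  \int[powm mu n]_v (\prod_i h i (v ord0 i))%:E =
  \prod_i \int[mu]_x (h i x)%:E.
Proof.
elim: n h => [|n IH] h mh h0.
  rewrite integral_powm0; first by rewrite !big_ord0.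
  by rewrite (_ : (fun _ => _) = cst 1%E)//; apply/funext => v; rewrite big_ord0.
have mp m (h' : 'I_m -> T -> R) : (forall i, measurable_fun setT (h' i)) ->
    measurable_fun setT (fun v : 'rV[T]_m => (\prod_i h' i (v ord0 i))%R%:E).
  move=> mh'; apply/measurable_EFinP; apply: measurable_prod => i _.
  by apply: measurableT_comp => //; exact: measurable_coord.
rewrite [LHS]integral_powmS; [|exact: mp|by move=> v; rewrite lee_fin prodr_ge0].
rewrite big_ord_recl -(IH (fun i => h (lift ord0 i)))//.
transitivity (\int[mu]_x ((h ord0 x)%:E *
    \int[powm mu n]_v (\prod_i h (lift ord0 i) (v ord0 i))%:E)).
  apply: eq_integral => x _; rewrite -ge0_integralZl//.
  - apply: eq_integral => v _; rewrite big_ord_recl EFinM row_cons0.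
    by congr (_ * _%:E)%E; apply: eq_bigr => i _; rewrite row_consS.
  - exact: (mp _ (fun i => h (lift ord0 i))).
  - by move=> v _; rewrite lee_fin prodr_ge0.
  - by rewrite lee_fin.
rewrite ge0_integralZr//.
- exact/measurable_EFinP.
- by move=> x _; rewrite lee_fin.
- by apply: integral_ge0 => v _; rewrite lee_fin prodr_ge0.
Qed.

End row_power.

Section row_integrals.
Context d (T : measurableType d) (R : realType).
Variable mu : {sigma_finite_measure set T -> \bar R}.
Local Open Scope ereal_scope.

Lemma measurable_fun_row_cons d1 (T1 : measurableType d1) n (f : T1 -> T)
    (g : T1 -> 'rV[T]_n) : measurable_fun setT f -> measurable_fun setT g ->
  measurable_fun setT (fun x => row_cons (f x, g x)).
Proof.
move=> mf mg; apply: (measurableT_comp (@measurable_row_cons _ T n)).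
exact: measurable_fun_pair.
Qed.

Lemma measurable_fun_row_mx d1 (T1 : measurableType d1) p q (f : T1 -> 'rV[T]_p)
    (g : T1 -> 'rV[T]_q) : measurable_fun setT f -> measurable_fun setT g ->
  measurable_fun setT (fun x => row_mx (f x) (g x)).
Proof.
move=> mf mg; apply/measurable_fun_rowP => i.
under eq_fun do rewrite mxE.
case: (fintype.split i) => k.
  exact: (measurableT_comp (measurable_coord k) mf).
exact: (measurableT_comp (measurable_coord k) mg).
Qed.

Lemma row_cons_row_mx p q (x : T) (v : 'rV[T]_p) (w : 'rV[T]_q) :
  row_cons (x, row_mx v w) = row_mx (row_cons (x, v)) w :> 'rV[T]_(p.+1 + q).
Proof.
apply/rowP => i; have [j ->|->] := unliftP ord0 i.
  rewrite row_consS !mxE; case: splitP => a ja; case: splitP => b jb;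
    rewrite /= /bump leq0n add1n in jb.
  - have -> : b = lift ord0 a by apply/val_inj => /=; rewrite /bump leq0n -ja -jb.
    by rewrite row_consS.
  - by have := ltn_ord a; rewrite -ja; move: jb; rewrite addSn => -[->];
      rewrite ltnNge leq_addr.
  - by have := ltn_ord b; rewrite -jb ja ltnS ltnNge leq_addr.
  - by congr (w _ _); apply/val_inj; move: jb; rewrite addSn ja => -[] /addnI.
rewrite row_cons0 mxE; case: splitP => // a a0.
by have -> : a = ord0; [exact/val_inj|rewrite row_cons0].
Qed.

Lemma integral_powmD p q (h : 'rV[T]_(p + q) -> \bar R) :
  measurable_fun setT h -> (forall x, 0 <= h x) ->
  \int[powm mu (p + q)]_v h v =
  \int[powm mu p]_x \int[powm mu q]_y h (row_mx x y).
Proof.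
elim: p h => [|p IH] h mh h0.
  rewrite [RHS]integral_powm0.
    apply: eq_integral => v _; congr h; apply/rowP => i; rewrite mxE.
    by case: splitP => -[]// k km ik; congr (v _ _); apply/val_inj.
  apply: (@measurable_integral1 _ _ _ _ _ (powm mu q)
    (fun p : 'rV[T]_0 * 'rV[T]_q => h (row_mx p.1 p.2))) => //.
  by apply: measurableT_comp => //; exact: measurable_fun_row_mx.
have mhr d1 (T1 : measurableType d1) (f : T1 -> 'rV[T]_p.+1) (g : T1 -> 'rV[T]_q) :
    measurable_fun setT f -> measurable_fun setT g ->
    measurable_fun setT (fun x => h (row_mx (f x) (g x))).
  by move=> mf mg; apply: measurableT_comp => //; exact: measurable_fun_row_mx.
rewrite [LHS](@integral_powmS _ _ _ _ (p + q))//.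
rewrite [RHS]integral_powmS; last 2 first.
- apply: (@measurable_integral1 _ _ _ _ _ (powm mu q)
    (fun z : 'rV[T]_p.+1 * 'rV[T]_q => h (row_mx z.1 z.2))) => //.
  exact: mhr.
- by move=> x; exact: integral_ge0.
apply: eq_integral => x _.
rewrite [LHS]IH; last by [].
  by do 2 (apply: eq_integral => ? _); rewrite row_cons_row_mx.
by apply: measurableT_comp => //; exact: measurable_fun_row_cons.
Qed.

(** The total dimension of m + 1 blocks equals that of the first block plus that of the others only
    up to a proof, whence the casts. *)
Lemma integral_powm_cast n n' (e : n = n') (h : 'rV[T]_n' -> \bar R) :
  \int[powm mu n']_v h v = \int[powm mu n]_v h (castmx (erefl, e) v).
Proof. by case: n' / e h => h; under [RHS]eq_integral do rewrite castmx_id. Qed.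

Lemma measurable_castmx n n' (e : n = n') :
  measurable_fun setT (fun v : 'rV[T]_n => castmx (erefl, e) v).
Proof.
case: n' / e; apply: eq_measurable_fun (@measurable_id _ _ _) => v _.
by rewrite castmx_id.
Qed.

(** Rebuilding [z] from its own blocks with [mxrow_recl] gives a second expression for it;
    injectivity of the cast and of [row_mx] then identifies the blocks. *)
Lemma submxrow_cast_row_mx m (k : 'I_m.+1 -> nat) (x : 'rV[T]_(k ord0))
    (y : 'rV[T]_(\sum_l k (lift ord0 l))) :
  let z := castmx (erefl, mxsize_recl) (row_mx x y) in
  submxrow z ord0 = x /\ forall l, submxrow z (lift ord0 l) = submxrow y l.
Proof.
move=> z; have : castmx (erefl, mxsize_recl) (row_mx x y) =
    castmx (erefl, mxsize_recl) (row_mx (submxrow z ord0) (\mxrow_l submxrow z (lift ord0 l))).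
  by rewrite -(@mxrow_recl _ _ k 1 (fun l => submxrow z l)) submxrowK.
move/(can_inj (castmxK _ _)) => /eq_row_mx[<- ->]; split => // l.
by rewrite mxrowK.
Qed.

Lemma measurable_submxrow m (k : 'I_m -> nat) l :
  measurable_fun setT (fun z : 'rV[T]_(\sum_l k l) => submxrow z l).
Proof.
apply/measurable_fun_rowP => i.
apply: eq_measurable_fun (measurable_coord (tagnat.Rank l i)) => z _.
by rewrite mxE.
Qed.

Lemma integral_powm_blocks m (k : 'I_m -> nat) (h : forall l, 'rV[T]_(k l) -> R) :
  (forall l, measurable_fun setT (h l)) -> (forall l x, (0 <= h l x)%R) ->
  \int[powm mu (\sum_l k l)]_z (\prod_l h l (submxrow z l))%:E =
  \prod_l \int[powm mu (k l)]_x (h l x)%:E.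
Proof.
elim: m k h => [|m IH] k h mh h0.
  have e : 0%N = (\sum_(l < 0) k l)%N by rewrite big_ord0.
  rewrite (integral_powm_cast e) [RHS]big_ord0 [LHS]integral_powm0.
    by rewrite [X in X%:E]big_ord0.
  apply: eq_measurable_fun (measurable_cst 1%E) => v _.
  by rewrite [X in _ = X%:E]big_ord0.
have mH m' (k' : 'I_m' -> nat) (h' : forall l, 'rV[T]_(k' l) -> R) :
    (forall l, measurable_fun setT (h' l)) -> measurable_fun setT
    (fun z : 'rV[T]_(\sum_l k' l) => (\prod_l h' l (submxrow z l))%R%:E).
  move=> mh'; apply/measurable_EFinP; apply: measurable_prod => l _.
  exact: (measurableT_comp (mh' l) (@measurable_submxrow _ k' l)).
have E (x : 'rV[T]_(k ord0)) (y : 'rV[T]_(\sum_l k (lift ord0 l))) :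
    (\prod_l h l (submxrow (castmx (erefl, mxsize_recl) (row_mx x y)) l) =
    h ord0 x * \prod_l h (lift ord0 l) (submxrow y l))%R.
  have [E0 E1] := submxrow_cast_row_mx x y.
  by rewrite [LHS]big_ord_recl E0; congr (_ * _)%R; apply: eq_bigr => l _; rewrite E1.
rewrite (integral_powm_cast (@mxsize_recl _ k)) [LHS]integral_powmD; last 2 first.
- exact: (measurableT_comp (mH _ _ _ mh) (measurable_castmx (@mxsize_recl _ k))).
- by move=> x; rewrite lee_fin prodr_ge0.
rewrite [RHS]big_ord_recl -(IH _ (fun l => h (lift ord0 l)))//.
transitivity (\int[powm mu (k ord0)]_x ((h ord0 x)%:E *
    \int[powm mu (\sum_l k (lift ord0 l))]_v
       (\prod_l h (lift ord0 l) (submxrow v l))%:E)).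
  apply: eq_integral => x _; rewrite -ge0_integralZl//.
  - by apply: eq_integral => v _; rewrite E EFinM.
  - exact: (mH _ _ (fun l => h (lift ord0 l))).
  - by move=> v _; rewrite lee_fin prodr_ge0.
  - by rewrite lee_fin.
rewrite ge0_integralZr//.
- by apply/measurable_EFinP; exact: mh.
- by move=> x _; rewrite lee_fin.
- by apply: integral_ge0 => v _; rewrite lee_fin prodr_ge0.
Qed.

(** [powm] adds coordinates in front, whereas [sphere_chart] solves for the last coordinate; in
    dimension n + 1 the chart is a [row_rcons] by definition. *)
Definition row_rcons n (v : 'rV[T]_n) (x : T) : 'rV[T]_n.+1 :=
  \row_(i < n.+1) oapp (fun i' : 'I_n => v ord0 i') x (insub (i : nat)).

Lemma measurable_fun_row_rcons d1 (T1 : measurableType d1) n (f : T1 -> 'rV[T]_n)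
    (g : T1 -> T) : measurable_fun setT f -> measurable_fun setT g ->
  measurable_fun setT (fun x => row_rcons (f x) (g x)).
Proof.
move=> mf mg; apply/measurable_fun_rowP => i.
under eq_fun do rewrite mxE.
case: insub => [k|]//=.
exact: (measurableT_comp (measurable_coord k) mf).
Qed.

Lemma row_cons_rcons n (x : T) (v : 'rV[T]_n) y :
  row_cons (x, row_rcons v y) = row_rcons (row_cons (x, v)) y.
Proof.
apply/rowP => i; have [j ->|->] := unliftP ord0 i.
  rewrite row_consS !mxE; case: insubP => [a _ /= aj|jn] /=.
    rewrite (_ : insub _ = Some (lift ord0 a))/= ?row_consS//.
    by rewrite -[RHS]valK /= aj.
  by rewrite insubF//=; rewrite /bump leq0n add1n ltnS; apply/negbTE.
rewrite row_cons0 mxE (_ : insub _ = Some ord0)/= ?row_cons0//.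
by rewrite -[RHS]valK.
Qed.

Lemma integral_powm_rcons n (h : 'rV[T]_n.+1 -> \bar R) :
  measurable_fun setT h -> (forall x, 0 <= h x) ->
  \int[powm mu n.+1]_v h v =
  \int[powm mu n]_v \int[mu]_x h (row_rcons v x).
Proof.
elim: n h => [|n IH] h mh h0.
  rewrite [RHS]integral_powm0.
    rewrite [LHS]integral_powmS//; apply: eq_integral => x _.
    rewrite [LHS]integral_powm0.
      congr h; apply/rowP => i; rewrite mxE (ord1 i) unlift_none mxE.
      by rewrite insubF.
    by apply: measurableT_comp => //; exact: measurable_fun_row_cons.
  apply: (@measurable_integral1 _ _ _ _ _ mu
    (fun p : 'rV[T]_0 * T => h (row_rcons p.1 p.2))) => //.
  by apply: measurableT_comp => //; exact: measurable_fun_row_rcons.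
rewrite [LHS]integral_powmS//.
rewrite [RHS]integral_powmS; last 2 first.
- apply: (@measurable_integral1 _ _ _ _ _ mu
    (fun z : 'rV[T]_n.+1 * T => h (row_rcons z.1 z.2))) => //.
  by apply: measurableT_comp => //; exact: measurable_fun_row_rcons.
- by move=> x; exact: integral_ge0.
apply: eq_integral => x _.
rewrite [LHS]IH; last by [].
  by do 2 (apply: eq_integral => ? _); rewrite row_cons_rcons.
by apply: measurableT_comp => //; exact: measurable_fun_row_cons.
Qed.

End row_integrals.

(** * Changes of variables on the line *)

Section one_variable.
Variable R : realType.
Local Open Scope ereal_scope.

Lemma measurable_natr d (T : measurableType d) (b : T -> bool) :
  measurable_fun setT b -> measurable_fun setT (fun x => (b x)%:R%R : R).
Proof.
move=> mb; apply: (eq_measurable_fun (fun x => if b x then 1%R else 0%R : R)).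
  by move=> x _; case: (b x).
exact: measurable_fun_ifT.
Qed.

Lemma lebR_itv (u v : R) : (u <= v)%R -> lebR R `]u, v]%classic = (v - u)%:E.
Proof.
move=> uv; rewrite -[LHS]/(lebesgue_measure `]u, v]%classic).
rewrite lebesgue_measure_itv/= lte_fin.
by case: ltP => // vu; rewrite (@le_anti _ _ u v) ?uv ?vu// subrr.
Qed.

(** The intervals ]u, v] are stable under intersection, generate the Borel sets and exhaust the line
    by sets of finite measure. *)
Lemma real_measure_unique (m1 m2 : {measure set R -> \bar R}) :
  (forall u v : R, (u <= v)%R -> m1 `]u, v]%classic < +oo) ->
  (forall u v : R, (u <= v)%R -> m1 `]u, v]%classic = m2 `]u, v]%classic) ->
  forall A, measurable A -> m1 A = m2 A.
Proof.
move=> mfin muv.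
apply: (measure_unique (@ocitv R) (fun n => `]- n%:R, n%:R]%classic)%R) => //.
- exact: ocitvI.
- by move=> n; exists (- n%:R, n%:R)%R.
- exact: bigcup_itvT.
- move=> _ [[u v] _ <-] /=; have [/muv//|vu] := leP u v.
  by rewrite set_itv_ge ?measure0// bnd_simp -leNgt ltW.
- by move=> n; apply: mfin; rewrite ge0_cp.
Qed.

Lemma integral_lebR_set (D : set R) (h : R -> \bar R) : measurable D ->
  measurable_fun D h -> {in D, forall x, 0 <= h x} ->
  \int[lebR R]_(x in D) h x = \int[lebesgue_measure]_(x in D) h x.
Proof.
move=> mD mh h0; have mid : measurable_fun setT (idfun : measurableTypeR R -> R).
  by move=> _ Y mY; rewrite setTI.
exact: (ge0_integral_pushforward mid (@lebesgue_measure R) mD mh h0).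
Qed.

Lemma integral_lebR (h : R -> \bar R) : measurable_fun setT h ->
  (forall x, 0 <= h x) -> \int[lebR R]_x h x = \int[lebesgue_measure]_x h x.
Proof. by move=> mh h0; exact: integral_lebR_set. Qed.

Lemma integral_lebR_FTC (F f : R -> R) (u v : R) : (u <= v)%R ->
  (forall x, is_derive x (1 : R)%R F (f x)) -> continuous f ->
  (forall x, (0 <= f x)%R) ->
  \int[lebR R]_(x in `]u, v]%classic) (f x)%:E = (F v - F u)%:E.
Proof.
rewrite le_eqVlt => /predU1P[<-|uv] dF cf f0.
  by rewrite set_itv_ge ?bnd_simp ?ltxx// integral_set0 subrr.
have mf : measurable_fun setT f by exact: continuous_measurable_fun.
have cF : continuous F.
  by move=> x; apply/differentiable_continuous/derivable1_diffP; exact: ex_derive.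
have mf' : measurable_fun `]u, v]%classic (EFin \o f).
  by apply/measurable_EFinP; exact: measurable_funTS.
rewrite integral_lebR_set//; last by move=> x _; rewrite lee_fin.
rewrite integral_itv_obnd_cbnd//.
rewrite (@continuous_FTC2 _ f F)//.
- exact: continuous_subspaceT.
- split; [by move=> x _; exact: ex_derive|apply: cvg_at_right_filter|
    apply: cvg_at_left_filter]; exact: cF.
- by move=> x _; rewrite derive1E derive_val.
Qed.

(** [F] is an increasing bijection from the line onto the interval [J], with inverse [G] there. The
    image under [G] of Lebesgue measure on [J] gives ]u, v] the mass F v - F u, by the intermediate
    value theorem, and so does the measure of density [f], by the fundamental theorem of
    calculus. *)
Lemma integral_lebR_subst (F f G : R -> R) (J : R -> bool) (h : R -> \bar R) :
  (forall x, is_derive x (1 : R)%R F (f x)) -> continuous f ->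
  (forall x, (0 < f x)%R) ->
  measurable_fun setT J -> measurable_fun setT G ->
  (forall x, J (F x)) -> (forall x, G (F x) = x) ->
  (forall y, J y -> F (G y) = y) ->
  measurable_fun setT h -> (forall x, 0 <= h x) ->
  \int[lebR R]_y (h y * (J y)%:R%:E) = \int[lebR R]_x (h (F x) * (f x)%:E).
Proof.
move=> dF cf f0 mJ mG JF GF FG mh h0.
have cF : continuous F.
  by move=> x; apply/differentiable_continuous/derivable1_diffP; exact: ex_derive.
have mf : measurable_fun setT f by exact: continuous_measurable_fun.
have mF : measurable_fun setT F by exact: continuous_measurable_fun.
have F_incr : {homo F : x y / (x < y)%R}.
  move=> x y xy; apply: (@gtr0_derive1_lt_cc _ F x y) => //.
  - by move=> z _; rewrite derive1E derive_val.
  - exact: continuous_subspaceT.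
  - by rewrite in_itv/= lexx ltW.
  - by rewrite in_itv/= lexx ltW.
have Fle := le_mono F_incr; have Flt := leW_mono Fle.
have J0 x : (0 <= (J x)%:R :> R)%R by exact: ler0n.
have mJ' := measurable_natr mJ.
pose nu := pushforward (wmeasure (lebR R) (fun x => (J x)%:R%R)) G.
have fge0 x : (0 <= f x)%R := ltW (f0 x).
have nuF (u v : R) : (u <= v)%R -> nu `]u, v]%classic = (F v - F u)%:E.
  move=> uv; rewrite -lebR_itv ?Fle//.
  rewrite /nu /pushforward /wmeasure integral_mkcond.
  rewrite -[X in lebR R X]setIT -integral_indic//.
  apply: eq_integral => y _; rewrite patchE indicE.
  have -> : (y \in (G @^-1` `]u, v]%classic)) = (u < G y <= v)%R.
    by apply/idP/idP; rewrite inE/= in_itv.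
  have -> : (y \in `]F u, F v]%classic) = J y && (u < G y <= v)%R.
    have [Jy|nJy] := boolP (J y).
      rewrite -(Flt u) -(Fle (G y)) FG//.
      by apply/idP/idP; rewrite inE/= in_itv.
    (* A point of ]F u, F v] is a value of [F], hence lies in [J]. *)
    apply/negbTE/negP; rewrite inE/= in_itv/= => /andP[Fuy yFv].
    have [|x _ Fx] := @IVT _ F u v y uv (continuous_subspaceT cF).
      by rewrite ge_min le_max (ltW Fuy) yFv orbT.
    by rewrite -Fx JF in nJy.
  by case: ifP; rewrite ?andbT ?andbF.
have nuE : forall A, measurable A -> nu A = wmeasure (lebR R) f A.
  apply: real_measure_unique => u v uv; first by rewrite [X in (X < _)%E]nuF// ltry.
  by rewrite [LHS]nuF// [RHS]integral_lebR_FTC.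
transitivity (\int[wmeasure (lebR R) (fun x => (J x)%:R%R)]_y h y).
  by rewrite ge0_integral_wmeasure.
(* F (G y) can differ from y only off [J], where the density is 0. *)
transitivity (\int[wmeasure (lebR R) (fun x => (J x)%:R%R)]_y h (F (G y))).
  rewrite !ge0_integral_wmeasure//; last first.
    by apply: measurableT_comp => //; exact: measurableT_comp.
  apply: eq_integral => y _; case: (boolP (J y)) => [/FG ->//|_].
  by rewrite !mule0.
transitivity (\int[nu]_x h (F x)).
  by rewrite ge0_integral_pushforward//; exact: measurableT_comp.
transitivity (\int[wmeasure (lebR R) f]_x h (F x)).
  by apply: eq_measure_integral => A mA _; exact: nuE.
by rewrite ge0_integral_wmeasure//; exact: measurableT_comp.
Qed.

End one_variable.

Section real_substitutions.
Variable R : realType.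
Local Open Scope ereal_scope.

Lemma integral_lebR_dilation (c : R) (h : R -> \bar R) : (0 < c)%R ->
  measurable_fun setT h -> (forall x, 0 <= h x) ->
  \int[lebR R]_x h x = \int[lebR R]_x (h (c * x)%R * c%:E).
Proof.
move=> c0 mh h0.
have := @integral_lebR_subst _ (fun x => c * x)%R (fun=> c) (fun x => x / c)%R
  (fun=> true) h.
under eq_integral do rewrite mule1.
apply => //.
- by move=> x; apply: is_derive_eq; rewrite /GRing.scale/= mulr1.
- by move=> x; exact: cvg_cst.
- exact: measurable_funM.
- by move=> x; rewrite mulrC mulrA mulVf ?mul1r// gt_eqF.
- by move=> y _; rewrite mulrCA divff ?mulr1// gt_eqF.
Qed.

Lemma integral_lebR_shift (c : R) (h : R -> \bar R) :
  measurable_fun setT h -> (forall x, 0 <= h x) ->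
  \int[lebR R]_x h x = \int[lebR R]_x h (x + c)%R.
Proof.
move=> mh h0.
have := @integral_lebR_subst _ (fun x => x + c)%R (fun=> 1%R) (fun x => x - c)%R
  (fun=> true) h.
under eq_integral do rewrite mule1.
under [X in _ = X]eq_integral do rewrite mule1.
apply => //.
- by move=> x; apply: is_derive_eq; rewrite addr0.
- by move=> x; exact: cvg_cst.
- exact: measurable_funB.
- by move=> x; rewrite addrK.
- by move=> y _; rewrite subrK.
Qed.

Lemma integral_lebRN (h : R -> \bar R) :
  measurable_fun setT h -> (forall x, 0 <= h x) ->
  \int[lebR R]_x h x = \int[lebR R]_x h (- x)%R.
Proof.
move=> mh h0; rewrite !integral_lebR//; last exact: measurableT_comp.
rewrite -[RHS](@ge0_integral_pushforward _ _ (measurableTypeR R) (measurableTypeR R)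
  _ (-%R) _ (@lebesgue_measure R) setT h)//.
by apply: eq_measure_integral => A mA _; exact/esym/lebesgue_measureN.
Qed.

Lemma integral_lebR_off2 (a b : R) (f g : R -> \bar R) :
  measurable_fun setT f -> (forall x, 0 <= f x) ->
  measurable_fun setT g -> (forall x, 0 <= g x) ->
  (forall x, x != a -> x != b -> f x = g x) ->
  \int[lebR R]_x f x = \int[lebR R]_x g x.
Proof.
move=> mf f0 mg g0 fg; rewrite !integral_lebR//.
apply: ge0_ae_eq_integral => //.
exists ([set a] `|` [set b]); split.
- exact: measurableU.
- apply/eqP; rewrite eq_le measure_ge0 andbT.
  rewrite (le_trans (measureU2 _ _ _))//.
  by rewrite [X in X + _]lebesgue_measure_set1 [X in _ + X]lebesgue_measure_set1 adde0.
- move=> x /=; apply: contra_notP => /not_orP[xa xb] _.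
  by apply: fg; apply/eqP.
Qed.

Lemma measurable_mul_nat (b : R -> bool) (f : R -> \bar R) :
  measurable_fun setT b -> measurable_fun setT f ->
  measurable_fun setT (fun x => f x * (b x)%:R%:E).
Proof.
by move=> mb mf; apply: emeasurable_funM => //; apply/measurable_EFinP; exact: measurable_natr.
Qed.

(** Folding the line at 0 lets the polar coordinates of the plane be proved on the right half plane,
    where the slope y / x is a coordinate. *)
Lemma integral_lebR_half (h : R -> \bar R) :
  measurable_fun setT h -> (forall x, 0 <= h x) ->
  \int[lebR R]_x h x = \int[lebR R]_x ((h x + h (- x)%R) * (0 < x)%R%:R%:E).
Proof.
move=> mh h0.
have mN : measurable_fun setT (fun x : R => h (- x)%R) by exact: measurableT_comp.
have n0 (b : bool) : 0 <= (b%:R : R)%:E by rewrite lee_fin ler0n.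
have mpos : measurable_fun setT (fun x : R => (0 < x)%R) by exact: measurable_fun_ltr.
have mneg : measurable_fun setT (fun x : R => (x < 0)%R) by exact: measurable_fun_ltr.
transitivity (\int[lebR R]_x (h x * (0 < x)%R%:R%:E + h x * (x < 0)%R%:R%:E)).
  apply: (@integral_lebR_off2 0%R 0%R) => //.
  - by apply: emeasurable_funD; exact: measurable_mul_nat.
  - by move=> x; rewrite adde_ge0// mule_ge0.
  - by move=> x + _; case: ltgtP => //= _ _; rewrite mule1 mule0 ?add0e ?adde0.
rewrite ge0_integralD//; [|by move=> x _; rewrite mule_ge0|exact: measurable_mul_nat|
  by move=> x _; rewrite mule_ge0|exact: measurable_mul_nat].
rewrite [X in _ + X]integral_lebRN; [|exact: measurable_mul_nat|by move=> x; rewrite mule_ge0].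
rewrite -ge0_integralD//; last 4 first.
- by move=> x _; rewrite mule_ge0.
- exact: measurable_mul_nat.
- by move=> x _; rewrite mule_ge0.
- by under eq_fun do rewrite oppr_lt0; exact: measurable_mul_nat.
by apply: eq_integral => x _; rewrite oppr_lt0 ge0_muleDl.
Qed.

Lemma integral_powm_dilation n (c : R) (h : 'rV[R]_n -> \bar R) : (0 < c)%R ->
  measurable_fun setT h -> (forall x, 0 <= h x) ->
  \int[powm (lebR R) n]_v h v = \int[powm (lebR R) n]_v (h (c *: v) * (c ^+ n)%:E).
Proof.
move=> c0; have ms m : measurable_fun setT (fun v : 'rV[R]_m => c *: v).
  apply/measurable_fun_rowP => i; under eq_fun do rewrite mxE.
  by apply: measurable_funM => //; exact: measurable_coord.
elim: n h => [|n IH] h mh h0.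
  by apply: eq_integral => v _; rewrite expr0 mule1; congr h; exact: rowV0.
have mhs : measurable_fun setT (fun v : 'rV[R]_n.+1 => h (c *: v)).
  exact: (measurableT_comp mh (ms _)).
rewrite [RHS]integral_powmS; last 2 first.
- exact: emeasurable_funM.
- by move=> v; rewrite mule_ge0// lee_fin exprn_ge0// ltW.
have mh' : measurable_fun setT (fun p : R * 'rV[R]_n => h (row_cons (p.1, c *: p.2))).
  apply: measurableT_comp => //; apply: measurable_fun_row_cons => //.
  exact: (measurableT_comp (ms n) measurable_snd).
rewrite [LHS]integral_powmS; [|by []|by []].
transitivity (\int[lebR R]_x \int[powm (lebR R) n]_v
    (h (row_cons (x, c *: v)) * (c ^+ n)%:E)).
  apply: eq_integral => x _; rewrite [LHS]IH//.
  by apply: measurableT_comp => //; exact: measurable_fun_row_cons.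
rewrite (integral_lebR_dilation c0); last 2 first.
- apply: (@measurable_integral1 _ _ _ _ _ _ (fun p : R * 'rV[R]_n =>
    h (row_cons (p.1, c *: p.2)) * (c ^+ n)%:E)).
    exact: emeasurable_funM.
  by move=> p; rewrite mule_ge0// lee_fin exprn_ge0// ltW.
- by move=> x; apply: integral_ge0 => v _; rewrite mule_ge0// lee_fin exprn_ge0// ltW.
apply: eq_integral => x _; rewrite -ge0_integralZr//.
- apply: eq_integral => v _; rewrite -muleA -EFinM exprSr; congr (h _ * _).
  by apply/rowP => i; have [j ->|->] := unliftP ord0 i;
    rewrite [RHS]mxE ?row_consS ?row_cons0 ?mxE.
- apply: emeasurable_funM => //.
  by apply: measurableT_comp => //; apply: measurable_fun_row_cons => //; exact: ms.
- by move=> v _; rewrite mule_ge0// lee_fin exprn_ge0// ltW.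
- by rewrite lee_fin ltW.
Qed.

End real_substitutions.

(** * Polar coordinates in C *)

Section complex_measurability.
Context d (T : measurableType d) (R : realType).
Implicit Types f g : T -> R[i].

Lemma measurable_Re f : measurable_fun setT f ->
  measurable_fun setT (fun x => complex.Re (f x)).
Proof. by case/measurable_fun_complexP. Qed.

Lemma measurable_Im f : measurable_fun setT f ->
  measurable_fun setT (fun x => complex.Im (f x)).
Proof. by case/measurable_fun_complexP. Qed.

Lemma complex_mulE (z w : R[i]) : z * w =
  (complex.Re z * complex.Re w - complex.Im z * complex.Im w) +i*
  (complex.Re z * complex.Im w + complex.Im z * complex.Re w).
Proof. by case: z w => a b [c e]. Qed.

Lemma measurable_complexM f g : measurable_fun setT f -> measurable_fun setT g ->
  measurable_fun setT (fun x => f x * g x).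
Proof.
move=> mf mg; have := (measurable_Re mf, measurable_Im mf, measurable_Re mg, measurable_Im mg).
case=> -[[fr fi] gr] gi; apply/measurable_fun_complexP; split;
  under eq_fun do rewrite complex_mulE /=.
  by apply: measurable_funB; exact: measurable_funM.
by apply: measurable_funD; exact: measurable_funM.
Qed.

Lemma measurable_complexN f : measurable_fun setT f ->
  measurable_fun setT (fun x => - f x).
Proof.
move=> mf; apply/measurable_fun_complexP; split.
  apply: (eq_measurable_fun (fun x => - complex.Re (f x))) => [x _|].
    by case: (f x).
  by apply: measurableT_comp => //; exact: measurable_Re.
apply: (eq_measurable_fun (fun x => - complex.Im (f x))) => [x _|].
  by case: (f x).
by apply: measurableT_comp => //; exact: measurable_Im.
Qed.

Lemma measurable_conjc f : measurable_fun setT f ->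
  measurable_fun setT (fun x => conjc (f x)).
Proof.
move=> mf; apply/measurable_fun_complexP; split.
  apply: (eq_measurable_fun (fun x => complex.Re (f x))) => [x _|].
    by case: (f x).
  exact: measurable_Re.
apply: (eq_measurable_fun (fun x => - complex.Im (f x))) => [x _|].
  by case: (f x).
by apply: measurableT_comp => //; exact: measurable_Im.
Qed.

Lemma measurable_real_complex (f : T -> R) : measurable_fun setT f ->
  measurable_fun setT (fun x => (f x)%:C).
Proof. by move=> mf; apply/measurable_fun_complexP; split. Qed.

Lemma measurable_normc f : measurable_fun setT f ->
  measurable_fun setT (fun x => Normc.normc (f x)).
Proof.
move=> mf; apply: (eq_measurable_fun
  (fun x => Num.sqrt (complex.Re (f x) ^+ 2 + complex.Im (f x) ^+ 2))) => [x _|].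
  by case: (f x).
apply: (measurableT_comp (@measurable_sqrtr R)); apply: measurable_funD.
  exact/measurable_funX/measurable_Re.
exact/measurable_funX/measurable_Im.
Qed.

Lemma measurable_complex_prod I (s : seq I) (f : I -> T -> R[i]) :
  (forall i, measurable_fun setT (f i)) ->
  measurable_fun setT (fun x => \prod_(i <- s) f i x).
Proof.
move=> mf; elim: s => [|i s IH].
  by under eq_fun do rewrite big_nil; exact: measurable_cst.
by under eq_fun do rewrite big_cons; exact: measurable_complexM.
Qed.

Lemma measurable_complexX f n : measurable_fun setT f ->
  measurable_fun setT (fun x => f x ^+ n).
Proof.
move=> mf; elim: n => [|n IH]; first by under eq_fun do rewrite expr0; exact: measurable_cst.
by under eq_fun do rewrite exprS; exact: measurable_complexM.
Qed.

End complex_measurability.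

Section polar_complex.
Variable R : realType.
Local Open Scope ereal_scope.

Lemma integral_arc (g : R[i] -> \bar R) :
  measurable_fun setT g -> (forall x, 0 <= g x) ->
  \int[arc_length R]_t g t =
  \int[lebR R]_x (g (expi x) * (0 <= x < 2 * pi)%R%:R%:E).
Proof.
move=> mg g0.
have mb : measurable_fun setT (fun x : R => (0 <= x < 2 * pi)%R).
  by apply: measurable_and; [exact: measurable_fun_ler|exact: measurable_fun_ltr].
have mge : measurable_fun setT (fun x => g (expi x)).
  exact: (measurableT_comp mg (@measurable_expi R)).
apply: ge0_integral_image => [x|||A mA||]//.
- exact: measurable_natr.
- exact: measurable_expi.
have mE : measurable (@expi R @^-1` A).
  by rewrite -[X in measurable X]setTI; exact: measurable_expi.
rewrite -[LHS]/(lebR R ((@expi R @^-1` A) `&` `[0%R, (2 * pi)%R[)).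
rewrite setIC -integral_indic//.
by apply: eq_integral => x _; rewrite indicE mem_setE in_itv.
Qed.

Lemma integral_lebC (h : R[i] -> \bar R) :
  measurable_fun setT h -> (forall x, 0 <= h x) ->
  \int[lebC R]_z h z = \int[lebR R]_x \int[lebR R]_y h (x +i* y).
Proof.
move=> mh h0; rewrite [LHS]ge0_integral_spush// ge0_integral_sprod//.
apply: measurableT_comp => //; apply/measurable_fun_complexP; split.
  exact: measurable_fst.
exact: measurable_snd.
Qed.

Lemma measurable_mkcomplex d (T : measurableType d) (f g : T -> R) :
  measurable_fun setT f -> measurable_fun setT g ->
  measurable_fun setT (fun x => f x +i* g x).
Proof. by move=> mf mg; apply/measurable_fun_complexP; split. Qed.

Lemma measurable_polar d (T : measurableType d) (k : R[i] -> \bar R)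
    (f : T -> R) (g : T -> R[i]) :
  measurable_fun setT k -> measurable_fun setT f -> measurable_fun setT g ->
  measurable_fun setT (fun x => k ((f x)%:C * g x)%R * (f x * (0 < f x)%R%:R)%:E).
Proof.
move=> mk mf mg; apply: emeasurable_funM.
  apply: (measurableT_comp mk); apply: measurable_complexM => //.
  exact: measurable_real_complex.
apply/measurable_EFinP; apply: measurable_funM => //.
by apply: measurable_natr; exact: measurable_fun_ltr.
Qed.

Lemma polar_weight_ge0 (r : R) : (0 <= r * (0 < r)%R%:R)%R.
Proof. by case: ltP => [/ltW|]; rewrite ?mulr1 ?mulr0. Qed.

(* Both sides are reduced to lines through the origin: y = c x with c = tan p. *)
Lemma half_plane_polar (k : R[i] -> \bar R) :
  measurable_fun setT k -> (forall x, 0 <= k x) ->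
  \int[lebR R]_x (\int[lebR R]_y k (x +i* y) * (0 < x)%R%:R%:E) =
  \int[lebR R]_p ((\int[lebR R]_r (k (r%:C * expi p)%R * (r * (0 < r)%R%:R)%:E)) *
     (- (pi / 2) < p < pi / 2)%R%:R%:E).
Proof.
move=> mk k0; pose w (r : R) := (r * (0 < r)%R%:R)%R.
have w0 r : 0 <= (w r)%:E by rewrite lee_fin; exact: polar_weight_ge0.
(* For the angle p = atan c this is cos p; its square 1 / (1 + c^2) is also the derivative of atan
   at c. *)
pose q (c : R) : R := cos (atan c).
have q0 c : (0 < q c)%R by rewrite /q cos_atan invr_gt0 sqrtr_gt0 ltr_wpDr// sqr_ge0.
have sinq c : sin (atan c) = (q c * c)%R.
  by rewrite -[X in _ = (_ * X)%R](atanK c) /tan -/(q c) mulrCA divff ?mulr1// gt_eqF.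
have q2 c : (q c ^+ 2 = (1 + c ^+ 2)^-1)%R.
  by rewrite /q cos_atan exprVn sqr_sqrtr// addr_ge0// sqr_ge0.
pose K p := \int[lebR R]_r (k (r%:C * expi p)%R * (w r)%:E).
have K0 p : 0 <= K p by apply: integral_ge0 => r _; rewrite mule_ge0.
have mK : measurable_fun setT K.
  apply: (@measurable_integral1 _ _ _ _ _ (lebR R)
    (fun z : R * R => k (z.2%:C * expi z.1)%R * (w z.2)%:E)).
    apply: measurable_polar => //.
    exact: (measurableT_comp (@measurable_expi R)).
  by move=> z; rewrite mule_ge0.
transitivity (\int[lebR R]_x \int[lebR R]_c (k (x +i* (x * c)%R) * (w x)%:E)).
  apply: eq_integral => x _; rewrite /w; case: ltP => [x0|_]; last first.
    by rewrite mulr0 mule0; under [RHS]eq_integral do rewrite mule0; rewrite integral0.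
  rewrite mulr1 mule1 (integral_lebR_dilation x0)//.
  by apply: measurableT_comp => //; exact: measurable_mkcomplex.
rewrite (@ge0_integral_swap _ _ _ _ _ (lebR R) (lebR R)
  (fun z : R * R => k (z.1 +i* (z.1 * z.2)%R) * (w z.1)%:E)); last 2 first.
- apply: emeasurable_funM.
    apply: (measurableT_comp mk); apply: measurable_mkcomplex => //.
    exact: measurable_funM.
  apply/measurable_EFinP; apply: measurable_funM => //.
  by apply: measurable_natr; exact: measurable_fun_ltr.
- by move=> z; rewrite mule_ge0.
transitivity (\int[lebR R]_c (K (atan c) * ((1 + c ^+ 2)^-1)%:E)).
  apply: eq_integral => c _ /=.
  have mc : measurable_fun setT (fun x : R => k (x +i* (x * c)%R) * (w x)%:E).
    apply: emeasurable_funM.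
      apply: (measurableT_comp mk); apply: measurable_mkcomplex => //.
      exact: measurable_funM.
    apply/measurable_EFinP; apply: measurable_funM => //.
    by apply: measurable_natr; exact: measurable_fun_ltr.
  (* On the line of slope c the abscissa is x = r cos p, so x dx = q^2 r dr: the r stays as polar
     weight and q^2 is the Jacobian of p = atan c. *)
  rewrite (integral_lebR_dilation (q0 c))//; last by move=> x; rewrite mule_ge0.
  rewrite -ge0_integralZr//; last 3 first.
  - by apply: measurable_polar => //; exact: measurable_cst.
  - by move=> r _; rewrite mule_ge0.
  - by rewrite lee_fin -q2 sqr_ge0.
  apply: eq_integral => r _; rewrite -!muleA -!EFinM; congr (k _ * _%:E).
    rewrite complex_mulE/= /expi/= sinq -/(q c); congr (_ +i* _); ring.
  by rewrite /w pmulr_rgt0// -q2; ring.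
rewrite -(@integral_lebR_subst _ (@atan R) (fun c => (1 + c ^+ 2)^-1)%R
  ((@tan R) \_ `](- (pi / 2))%R, (pi / 2)%R[)
  (fun p => - (pi / 2) < p < pi / 2)%R K)//.
- move=> c; apply: cvgV; first by rewrite gt_eqF// ltr_wpDr// sqr_ge0.
  by apply: cvgD; [exact: cvg_cst|exact: exprn_continuous].
- by move=> c; rewrite -q2 exprn_gt0.
- by apply: measurable_and; exact: measurable_fun_ltr.
- apply/(measurable_restrictT _ _).1 => //.
  apply: open_continuous_measurable_fun => //.
  move=> c; rewrite inE/= in_itv/= => cpi.
  by apply: continuous_tan; rewrite gt_eqF// cos_gt0_pihalf.
- by move=> c; rewrite atan_gtNpi2 atan_ltpi2.
- move=> c; rewrite patchE mem_set ?atanK//=.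
  by rewrite in_itv/= atan_gtNpi2 atan_ltpi2.
- by move=> p pI; rewrite patchE mem_set /= ?in_itv//= tanK// in_itv.
Qed.

Lemma integral_interval_split (L : R -> \bar R) (b b1 b2 : R -> bool) (u v : R) :
  measurable_fun setT L -> (forall x, 0 <= L x) ->
  measurable_fun setT b -> measurable_fun setT b1 -> measurable_fun setT b2 ->
  (forall p, p != u -> p != v -> (b p : nat) = (b1 p + b2 p)%N) ->
  \int[lebR R]_p (L p * (b p)%:R%:E) =
  \int[lebR R]_p (L p * (b1 p)%:R%:E) + \int[lebR R]_p (L p * (b2 p)%:R%:E).
Proof.
move=> mL L0 mb mb1 mb2 bE.
have Lb (c : bool) p : 0 <= L p * (c%:R : R)%:E by rewrite mule_ge0// lee_fin.
rewrite -ge0_integralD//; [|exact: measurable_mul_nat|exact: measurable_mul_nat].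
apply: (@integral_lebR_off2 _ u v) => [|p||p|p pu pv].
- exact: measurable_mul_nat.
- exact: Lb.
- by apply: emeasurable_funD; exact: measurable_mul_nat.
- exact: adde_ge0.
- by rewrite bE// natrD EFinD ge0_muleDr// lee_fin.
Qed.

(** The two half turns centred at 0 and at pi fill one period: the quarter from -pi/2 to 0 is moved
    to the one from 3 pi/2 to 2 pi by periodicity, and the junction points are null. *)
Lemma integral_period (L : R -> \bar R) :
  measurable_fun setT L -> (forall x, 0 <= L x) ->
  (forall p, L (p + 2 * pi)%R = L p) ->
  \int[lebR R]_p ((L p + L (p + pi)%R) * (- (pi / 2) < p < pi / 2)%R%:R%:E) =
  \int[lebR R]_p (L p * (0 <= p < 2 * pi)%R%:R%:E).
Proof.
move=> mL L0 Lper; have pi0 := pi_gt0 R.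
have Lb (c : bool) p : 0 <= L p * (c%:R : R)%:E by rewrite mule_ge0// lee_fin.
have mlt (u v : R) : measurable_fun setT (fun p : R => (u < p < v)%R).
  by apply: measurable_and; exact: measurable_fun_ltr.
have mle (u v : R) : measurable_fun setT (fun p : R => (u <= p < v)%R).
  by apply: measurable_and; [exact: measurable_fun_ler|exact: measurable_fun_ltr].
have shiftL (c u v : R) :
    \int[lebR R]_p (L p * (u + c < p < v + c)%R%:R%:E) =
    \int[lebR R]_p (L (p + c)%R * (u < p < v)%R%:R%:E).
  rewrite (integral_lebR_shift c)//.
    by apply: eq_integral => p _; rewrite !ltrD2r.
  exact: measurable_mul_nat.
have mLs (c : R) : measurable_fun setT (fun p : R => L (p + c)%R).
  by apply: (measurableT_comp mL); exact: measurable_funD.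
under eq_integral do rewrite ge0_muleDl//.
rewrite ge0_integralD//; [|exact: measurable_mul_nat|exact: measurable_mul_nat].
rewrite -(shiftL pi).
rewrite [X in X + _](@integral_interval_split L (fun p => - (pi / 2) < p < pi / 2)%R
  (fun p => - (pi / 2) < p < 0)%R
  (fun p => 0 <= p < pi / 2)%R 0%R 0%R)//; last first.
  move=> p p0 _; case: (ltgtP p 0%R) p0 => // p0 _;
    by do ?[case: ltP => ? //=|case: leP => ? //=]; exfalso; lra.
under [X in X + _ + _]eq_integral do rewrite -Lper.
rewrite -shiftL.
rewrite [RHS](@integral_interval_split L _ (fun p => 0 <= p < 3 * pi / 2)%R
  (fun p => 3 * pi / 2 < p < 2 * pi)%R (3 * pi / 2)%R (3 * pi / 2)%R)//; last first.
  move=> p p0 _; case: (ltgtP p (3 * pi / 2)%R) p0 => // p0 _;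
    by do ?[case: ltP => ? //=|case: leP => ? //=]; exfalso; lra.
rewrite [X in _ = X + _](@integral_interval_split L _ (fun p => 0 <= p < pi / 2)%R
  (fun p => pi / 2 < p < 3 * pi / 2)%R (pi / 2)%R (pi / 2)%R)//; last first.
  move=> p p0 _; case: (ltgtP p (pi / 2)%R) p0 => // p0 _;
    by do ?[case: ltP => ? //=|case: leP => ? //=]; exfalso; lra.
rewrite -addeA addeC; congr (_ + _ + _); apply: eq_integral => p _;
  congr (_ * (nat_of_bool (_ && _))%:R%:E); apply/idP/idP => ?; lra.
Qed.

(** The left half plane is reached from the right one by z -> -z, and -expi p = expi (p + pi), so
    the two halves make a full turn. *)
Lemma integral_lebC_polar (h : R[i] -> \bar R) :
  measurable_fun setT h -> (forall x, 0 <= h x) ->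
  \int[lebC R]_z h z =
  \int[arc_length R]_t \int[lebR R]_r (h (r%:C * t)%R * (r * (0 < r)%R%:R)%:E).
Proof.
move=> mh h0.
have w0 r : 0 <= ((r * (0 < r)%R%:R)%R : R)%:E.
  by rewrite lee_fin polar_weight_ge0.
have mN : measurable_fun setT (fun z : R[i] => h (- z)%R).
  by apply: (measurableT_comp mh); exact: measurable_complexN.
pose M t := \int[lebR R]_r (h (r%:C * t)%R * (r * (0 < r)%R%:R)%:E).
have M0 t : 0 <= M t by apply: integral_ge0 => r _; rewrite mule_ge0.
have mM : measurable_fun setT M.
  apply: (@measurable_integral1 _ _ _ _ _ (lebR R)
    (fun z : R[i] * R => h (z.2%:C * z.1)%R * (z.2 * (0 < z.2)%R%:R)%:E)).
    exact: measurable_polar.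
  by move=> z; rewrite mule_ge0.
have mH (k : R[i] -> \bar R) : measurable_fun setT k -> (forall z, 0 <= k z) ->
    measurable_fun setT (fun x => \int[lebR R]_y k (x +i* y)).
  move=> mk k0; apply: (@measurable_integral1 _ _ _ _ _ (lebR R)
    (fun z : R * R => k (z.1 +i* z.2)))=> //.
  by apply: (measurableT_comp mk); exact: measurable_mkcomplex.
have mx (k : R[i] -> \bar R) x : measurable_fun setT k ->
    measurable_fun setT (fun y => k (x +i* y)).
  by move=> mk; apply: (measurableT_comp mk); exact: measurable_mkcomplex.
rewrite integral_lebC// integral_lebR_half; [|exact: mH|by move=> x; exact: integral_ge0].
transitivity (\int[lebR R]_x (\int[lebR R]_y (h (x +i* y) + h (- (x +i* y))%R) *
    (0 < x)%R%:R%:E)).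
  apply: eq_integral => x _; congr (_ * _).
  rewrite ge0_integralD//; [|exact: mx|exact: (mx (fun z => h (- z)%R))].
  congr (_ + _); rewrite integral_lebRN//; exact: mx.
rewrite (half_plane_polar (k := fun z => h z + h (- z)%R)); last 2 first.
- exact: emeasurable_funD.
- by move=> z; exact: adde_ge0.
rewrite integral_arc; [|by []|by []].
rewrite -(@integral_period (fun p => M (expi p)))//; last 2 first.
- exact: (measurableT_comp mM (@measurable_expi R)).
- by move=> p; congr M; rewrite /expi mulrC mulr_natr cosD2pi sinD2pi.
apply: eq_integral => p _; congr (_ * _).
rewrite -ge0_integralD//; last 4 first.
- by move=> r _; rewrite mule_ge0.
- by apply: measurable_polar => //; exact: measurable_cst.
- by move=> r _; rewrite mule_ge0.
- by apply: measurable_polar => //; exact: measurable_cst.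
apply: eq_integral => r _; rewrite ge0_muleDl//; congr (_ + h _ * _).
by rewrite /expi cosDpi sinDpi -mulrN.
Qed.

End polar_complex.

(** * Moduli and angles of all coordinates of C^n *)

Section torus_coordinates.
Variable R : realType.
Local Open Scope ereal_scope.

Definition torus_scale n (x : 'rV[R]_n) (t : 'rV[R[i]]_n) : 'rV[R[i]]_n :=
  \row_i (t ord0 i * (x ord0 i)%:C)%R.

Lemma measurable_torus_scale d (T : measurableType d) n (f : T -> 'rV[R]_n)
    (g : T -> 'rV[R[i]]_n) : measurable_fun setT f -> measurable_fun setT g ->
  measurable_fun setT (fun x => torus_scale (f x) (g x)).
Proof.
move=> mf mg; apply/measurable_fun_rowP => i; under eq_fun do rewrite mxE.
apply: measurable_complexM.
  exact: (measurableT_comp (measurable_coord i) mg).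
apply: measurable_real_complex.
exact: (measurableT_comp (measurable_coord i) mf).
Qed.

(** The Jacobian of [torus_scale], cut off to the open positive orthant. *)
Definition pos_prod n (x : 'rV[R]_n) : R :=
  (\prod_i (x ord0 i * (0 < x ord0 i)%R%:R))%R.

Lemma pos_prod_ge0 n (x : 'rV[R]_n) : (0 <= pos_prod x)%R.
Proof. by apply: prodr_ge0 => i _; exact: polar_weight_ge0. Qed.

Lemma measurable_pos_prod n : measurable_fun setT (@pos_prod n).
Proof.
apply: measurable_prod => i _; apply: measurable_funM; first exact: measurable_coord.
by apply: measurable_natr; apply: measurable_fun_ltr => //; exact: measurable_coord.
Qed.

(** Induction on the dimension, with [integral_lebC_polar] for the first coordinate. The rest is
    Tonelli: the new radius has to come outside the new angle, and this angle inside the remaining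
    moduli. *)
Lemma integral_powC_torus n (h : 'rV[R[i]]_n -> \bar R) :
  measurable_fun setT h -> (forall z, 0 <= h z) ->
  \int[powm (lebC R) n]_z h z = \int[powm (lebR R) n]_x
    ((\int[haar_torus R n]_t h (torus_scale x t)) * (pos_prod x)%:E).
Proof.
elim: n h => [|n IH] h mh h0.
  rewrite integral_powm0// [RHS]integral_powm0//; last first.
    apply: emeasurable_funM; last by apply/measurable_EFinP; exact: measurable_pos_prod.
    apply: (@measurable_integral1 _ _ _ _ _ (haar_torus R 0)
      (fun z => h (torus_scale z.1 z.2))) => //.
    by apply: (measurableT_comp mh); exact: measurable_torus_scale.
  rewrite /haar_torus [X in _ = X * _]integral_powm0; last first.
    by apply: (measurableT_comp mh); apply: measurable_torus_scale => //; exact: measurable_cst.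
  by rewrite /pos_prod big_ord0 mule1; congr h; exact: rowV0.
have W0 m (x : 'rV[R]_m) : 0 <= (pos_prod x)%:E by rewrite lee_fin pos_prod_ge0.
have w0 (r : R) : 0 <= (r * (0 < r)%R%:R)%:E by rewrite lee_fin polar_weight_ge0.
have mw : measurable_fun setT (fun r : R => (r * (0 < r)%R%:R)%:E).
  apply/measurable_EFinP; apply: measurable_funM => //.
  by apply: measurable_natr; exact: measurable_fun_ltr.
have mW m : measurable_fun setT (fun x : 'rV[R]_m => (pos_prod x)%:E).
  by apply/measurable_EFinP; exact: measurable_pos_prod.
have mcs d (T : measurableType d) (f : T -> R[i]) (g : T -> 'rV[R]_n)
    (k : T -> 'rV[R[i]]_n) : measurable_fun setT f -> measurable_fun setT g ->
    measurable_fun setT k ->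
    measurable_fun setT (fun z => h (row_cons (f z, torus_scale (g z) (k z)))).
  move=> mf mg mk; apply: (measurableT_comp mh).
  by apply: measurable_fun_row_cons => //; exact: measurable_torus_scale.
pose Q z x := \int[haar_torus R n]_t h (row_cons (z, torus_scale x t)).
have Q0 z x : 0 <= Q z x by exact: integral_ge0.
have mQ d (T : measurableType d) (f : T -> R[i]) (g : T -> 'rV[R]_n) :
    measurable_fun setT f -> measurable_fun setT g ->
    measurable_fun setT (fun z => Q (f z) (g z)).
  move=> mf mg; apply: (@measurable_integral1 _ _ _ _ _ (haar_torus R n)
    (fun p => h (row_cons (f p.1, torus_scale (g p.1) p.2)))) => //.
  apply: mcs => //; [exact: (measurableT_comp mf)|exact: (measurableT_comp mg)].
transitivity (\int[lebC R]_z \int[powm (lebR R) n]_x (Q z x * (pos_prod x)%:E)).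
  rewrite [LHS]integral_powmS//; apply: eq_integral => z _.
  rewrite IH//; apply: (measurableT_comp mh).
  by apply: measurable_fun_row_cons => //; exact: measurable_cst.
have mQW d (T : measurableType d) (f : T -> R[i]) (g : T -> 'rV[R]_n) :
    measurable_fun setT f -> measurable_fun setT g ->
    measurable_fun setT (fun z => Q (f z) (g z) * (pos_prod (g z))%:E).
  move=> mf mg; apply: emeasurable_funM; first exact: mQ.
  exact: (measurableT_comp (mW n)).
have mH : measurable_fun setT
    (fun z => \int[powm (lebR R) n]_x (Q z x * (pos_prod x)%:E)).
  apply: (@measurable_integral1 _ _ _ _ _ (powm (lebR R) n)
    (fun p => Q p.1 p.2 * (pos_prod p.2)%:E)); first exact: mQW.
  by move=> p; rewrite mule_ge0.
have H0 z : 0 <= \int[powm (lebR R) n]_x (Q z x * (pos_prod x)%:E).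
  by apply: integral_ge0 => x _; rewrite mule_ge0.
rewrite integral_lebC_polar//.
rewrite (@ge0_integral_swap _ _ _ _ _ (arc_length R) (lebR R)
  (fun p => \int[powm (lebR R) n]_x (Q (p.2%:C * p.1)%R x * (pos_prod x)%:E) *
     (p.2 * (0 < p.2)%R%:R)%:E)); last 2 first.
- exact: (measurable_polar mH).
- by move=> p; rewrite mule_ge0.
rewrite [RHS]integral_powmS; last 2 first.
- apply: emeasurable_funM; last exact: mW.
  apply: (@measurable_integral1 _ _ _ _ _ (haar_torus R n.+1)
    (fun z => h (torus_scale z.1 z.2))) => //.
  by apply: (measurableT_comp mh); exact: measurable_torus_scale.
- by move=> x; rewrite mule_ge0//; exact: integral_ge0.
apply: eq_integral => r _ /=.
have mrt : measurable_fun setT (fun t : R[i] => r%:C * t)%R.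
  by apply: measurable_complexM => //; exact: measurable_cst.
transitivity (\int[powm (lebR R) n]_x \int[arc_length R]_t
    (Q (r%:C * t)%R x * (pos_prod x)%:E * (r * (0 < r)%R%:R)%:E)).
  rewrite -(@ge0_integral_swap _ _ _ _ _ (arc_length R) (powm (lebR R) n)
    (fun p => Q (r%:C * p.1)%R p.2 * (pos_prod p.2)%:E * (r * (0 < r)%R%:R)%:E)).
  - apply: eq_integral => t _; rewrite -ge0_integralZr//.
    + apply: mQW => //; exact: measurable_cst.
    + by move=> x _; rewrite mule_ge0.
  - apply: emeasurable_funM => //; apply: mQW => //.
    exact: (measurableT_comp mrt).
  - by move=> p; rewrite !mule_ge0.
apply: eq_integral => x _.
have -> : pos_prod (row_cons (r, x)) = (pos_prod x * (r * (0 < r)%R%:R))%R.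
  rewrite /pos_prod big_ord_recl row_cons0 mulrC; congr (_ * _)%R.
  by apply: eq_bigr => i _; rewrite row_consS.
rewrite /haar_torus integral_powmS; last 2 first.
- apply: (measurableT_comp mh).
  by apply: measurable_torus_scale; [exact: measurable_cst|exact: measurable_id].
- by [].
rewrite EFinM -ge0_integralZr//.
- apply: eq_integral => t _; rewrite -muleA; congr (_ * _).
  apply: eq_integral => u _; congr h; apply/rowP => i.
  have [j ->|->] := unliftP ord0 i; rewrite ?row_consS ?row_cons0 !mxE.
    by rewrite !liftK.
  by rewrite !unlift_none /= mulrC.
- apply: (@measurable_integral1 _ _ _ _ _ (powm (arc_length R) n)
    (fun p => h (torus_scale (row_cons (r, x)) (row_cons (p.1, p.2))))) => //.
  apply: (measurableT_comp mh); apply: measurable_torus_scale; first exact: measurable_cst.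
  exact: measurable_fun_row_cons.
- by move=> t _; exact: integral_ge0.
- by rewrite lee_fin mulr_ge0 ?pos_prod_ge0 ?polar_weight_ge0.
Qed.

End torus_coordinates.

(** * Spherical coordinates *)

Section sphere_integrals.
Variable R : realType.

(* The two block factorizations of [[1, -x], [c x^T, 1]] (Schur complements). *)
Lemma det_rank_one_update (n : nat) (c : R) (x : 'rV[R]_n) :
  \det (1%:M + c *: (x^T *m x)) = 1 + c * \sum_i x ord0 i ^+ 2.
Proof.
pose M := block_mx (1%:M : 'M[R]_1) (- x) (c *: x^T) (1%:M : 'M[R]_n).
transitivity (\det M).
  have -> : M = block_mx 1%:M 0 (c *: x^T) 1%:M *m
      block_mx 1%:M (- x) 0 (1%:M + c *: (x^T *m x)).
    rewrite mulmx_block !(mul1mx, mulmx1, mul0mx, mulmx0, addr0, add0r).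
    by rewrite mulmxN -scalemxAl addrCA addNr addr0.
  by rewrite det_mulmx det_lblock det_ublock !det1 !mul1r.
have -> : M = block_mx 1%:M (- x) 0 1%:M *m
    block_mx (1%:M + c *: (x *m x^T)) 0 (c *: x^T) 1%:M.
  rewrite mulmx_block !(mul1mx, mulmx1, mul0mx, mulmx0, addr0, add0r).
  by rewrite mulNmx -scalemxAr addrK.
rewrite det_mulmx det_ublock det_lblock !det1 !mul1r mulr1 det_mx11 !mxE eqxx.
by congr (1 + c * _); apply: eq_bigr => i _; rewrite !mxE.
Qed.

(** The metric is I + x^T x / (1 - |x|^2), whose determinant is 1 + |x|^2 / (1 - |x|^2) = 1 / (1 -
    |x|^2). *)
Lemma sphere_densityE n (x : 'rV[R]_n) : enorm x < 1 ->
  sphere_density (k := n.+1) x = (Num.sqrt (1 - enorm x ^+ 2))^-1.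
Proof.
move=> x1; have x0 : 0 < 1 - enorm x ^+ 2.
  by rewrite subr_gt0 expr_lt1// sqrtr_ge0.
rewrite /sphere_density; set M := sphere_metric _.
have -> : M = 1%:M + (1 - enorm x ^+ 2)^-1 *: (x^T *m x).
  apply/matrixP => i j; rewrite sphere_metricE// !mxE big_ord1 !mxE.
  by rewrite [_^-1 * _]mulrC.
rewrite det_rank_one_update -enorm_sqr -sqrtrV ?ltW//; congr Num.sqrt.
by field; rewrite gt_eqF.
Qed.

Local Open Scope ereal_scope.

Lemma measurable_fun_forall_ord d (T : measurableType d) n (P : 'I_n -> T -> bool) :
  (forall i, measurable_fun setT (P i)) ->
  measurable_fun setT (fun x => [forall i, P i x]).
Proof.
move=> mP; apply: (measurable_fun_bool true).
rewrite setTI (_ : _ @^-1` _ = \bigcap_(i in [set: 'I_n]) (P i @^-1` [set true])).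
  apply: fin_bigcap_measurable => // i _.
  by rewrite -[X in measurable X]setTI; exact: mP.
apply/seteqP; split => x /=; first by move/forallP => Px i _; exact: Px.
by move=> Px; apply/forallP => i; exact: Px.
Qed.

Definition nonneg_row n (x : 'rV[R]_n) := [forall i, (0 <= x ord0 i)%R].

Lemma nonneg_rowP n (x : 'rV[R]_n) : reflect (forall i, (0 <= x ord0 i)%R) (nonneg_row x).
Proof. exact: forallP. Qed.

(** The density of the chart extended by 0, so that integrals over the sphere become integrals over
    all of R^n. *)
Definition sphere_weight n (x : 'rV[R]_n) : R :=
  ((nonneg_row x && (enorm x < 1))%R%:R / Num.sqrt (1 - enorm x ^+ 2))%R.

Lemma sphere_weight_ge0 n (x : 'rV[R]_n) : (0 <= sphere_weight x)%R.
Proof. by rewrite divr_ge0// sqrtr_ge0. Qed.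

(** Inversion is not continuous at 0. Writing x^-1 = x (x^2)^-1 reduces it to [powR], and the
    identity persists at 0 because 0^-1 = 0. *)
Lemma measurable_invr : measurable_fun setT (fun x : R => x^-1)%R.
Proof.
apply: (eq_measurable_fun (fun x : R => x * (x ^+ 2) `^ (-1))%R) => [x _|].
  rewrite powR_inv1 ?sqr_ge0//; have [->|x0] := eqVneq x 0%R; first by rewrite mul0r invr0.
  by rewrite expr2 invfM mulrA divff// mul1r.
apply: measurable_funM => //.
by apply: (measurableT_comp (measurable_powR _)); exact: measurable_funX.
Qed.

Lemma measurable_sphere_weight n : measurable_fun setT (@sphere_weight n).
Proof.
apply: measurable_funM.
  apply: measurable_natr; apply: measurable_and.
    apply: measurable_fun_forall_ord => i; apply: measurable_fun_ler => //.
    exact: measurable_coord.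
  by apply: measurable_fun_ltr => //; exact: measurable_enorm.
apply: (measurableT_comp measurable_invr).
apply: (measurableT_comp (@measurable_sqrtr R)); apply: measurable_funB => //.
by apply: measurable_funX; exact: measurable_enorm.
Qed.

Lemma sphere_chartE n (x : 'rV[R]_n) : sphere_chart (k := n.+1) x =
  row_rcons x (Num.sqrt (1 - enorm x ^+ 2)).
Proof. by []. Qed.

Lemma measurable_sphere_chart n : measurable_fun setT (@sphere_chart R n.+1).
Proof.
apply: measurable_fun_row_rcons => //.
apply: (measurableT_comp (@measurable_sqrtr R)); apply: measurable_funB => //.
by apply: measurable_funX; exact: measurable_enorm.
Qed.

Lemma integral_sphere n (h : 'rV[R]_n.+1 -> \bar R) :
  measurable_fun setT h -> (forall s, 0 <= h s) ->
  \int[sphere_measure R n.+1]_s h s =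
  \int[powm (lebR R) n]_x (h (sphere_chart (k := n.+1) x) * (sphere_weight x)%:E).
Proof.
move=> mh h0; apply: ge0_integral_image => // [x|||A mA].
- exact: sphere_weight_ge0.
- exact: measurable_sphere_weight.
- exact: measurable_sphere_chart.
rewrite [LHS]integral_mkcond [RHS]integral_mkcond.
apply: eq_integral => x _; rewrite !patchE.
have [xA|xA] := boolP (x \in (@sphere_chart R n.+1) @^-1` A); last first.
  by rewrite ifF//; apply/negbTE; move: xA; rewrite !notin_setE => + [_].
have [xD|xD] := pselect (@sphere_dom R n.+1 x); last first.
  rewrite ifF; last by apply/negbTE; rewrite notin_setE => -[].
  rewrite /sphere_weight (_ : _ && _ = false) ?mul0r//.
  by apply/negbTE/negP => /andP[/nonneg_rowP ? ?]; apply: xD.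
rewrite mem_set; last by split => //; rewrite inE in xA.
have [x0 x1] := xD; rewrite sphere_densityE// /sphere_weight x1 andbT.
by rewrite (_ : nonneg_row x) ?mul1r//; exact/nonneg_rowP.
Qed.

Lemma integral_half_line_exp (phi : R -> \bar R) :
  measurable_fun setT phi -> (forall x, 0 <= phi x) ->
  \int[lebR R]_x (phi x * (0 < x)%R%:R%:E) =
  \int[lebR R]_v (phi (expR v) * (expR v)%:E).
Proof.
move=> mphi phi0.
apply: (@integral_lebR_subst _ (@expR R) (@expR R) (@ln R)) => //.
- exact: continuous_expR.
- exact: expR_gt0.
- exact: measurable_fun_ltr.
- exact: expR_gt0.
- exact: expRK.
- by move=> y y0; rewrite lnK// posrE.
Qed.

(* r = sqrt (c^2 + x^2); the substitution lemma needs a map defined on all of R,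
   whence the detour through x = e^v. *)
Lemma half_line_to_radius (c : R) (phi : R -> \bar R) : (0 <= c)%R ->
  measurable_fun setT phi -> (forall x, 0 <= phi x) ->
  \int[lebR R]_x (phi x * (0 < x)%R%:R%:E) =
  \int[lebR R]_r (phi (Num.sqrt (r ^+ 2 - c ^+ 2))%R *
    (r / Num.sqrt (r ^+ 2 - c ^+ 2) * (c < r)%R%:R)%:E).
Proof.
move=> c0 mphi phi0; rewrite integral_half_line_exp//.
pose u (v : R) : R := (c ^+ 2 + expR v ^+ 2)%R.
have u0 v : (0 < u v)%R by rewrite ltr_wpDl ?sqr_ge0// exprn_gt0// expR_gt0.
pose F v := Num.sqrt (u v).
have F2 v : (F v ^+ 2 - c ^+ 2 = expR v ^+ 2)%R.
  by rewrite sqr_sqrtr ?ltW// /u addrC addKr.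
have F0 v : (0 < F v)%R by rewrite sqrtr_gt0.
have sqF v : Num.sqrt (F v ^+ 2 - c ^+ 2) = expR v.
  by rewrite F2 sqrtr_sqr gtr0_norm ?expR_gt0.
have cF v : (c < F v)%R.
  rewrite -(@ltr_pXn2r _ 2)// ?nnegrE// ?ltW//.
  by rewrite -subr_gt0 F2 exprn_gt0// expR_gt0.
pose f v : R := (expR v ^+ 2 / F v)%R.
(* The absolute value makes [psi] nonnegative on the whole line; for c < r it is r, since 0 <= c. *)
pose psi (r : R) : \bar R := phi (Num.sqrt (r ^+ 2 - c ^+ 2))%R *
  (`|r| / Num.sqrt (r ^+ 2 - c ^+ 2))%:E.
have mpsi : measurable_fun setT psi.
  have ms : measurable_fun setT (fun r : R => Num.sqrt (r ^+ 2 - c ^+ 2)).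
    apply: (measurableT_comp (@measurable_sqrtr R)); exact: measurable_funB.
  apply: emeasurable_funM; first exact: (measurableT_comp mphi).
  apply/measurable_EFinP; apply: measurable_funM.
    exact: normr_measurable.
  exact: (measurableT_comp measurable_invr).
have psi0 r : 0 <= psi r by rewrite mule_ge0// lee_fin divr_ge0 ?sqrtr_ge0.
transitivity (\int[lebR R]_v (psi (F v) * (f v)%:E)).
  apply: eq_integral => v _; rewrite /psi sqF -muleA -EFinM /f.
  rewrite gtr0_norm//; congr (_ * _%:E).
  by field; rewrite !gt_eqF// expR_gt0.
have dF v : is_derive v (1 : R)%R F (f v).
  rewrite /f.
  have du : is_derive v (1 : R)%R u (2 * expR v ^+ 2)%R.
    by apply: is_derive_eq; rewrite add0r /GRing.scale/=; ring.
  have := @is_derive1_comp R (@Num.sqrt R) u v _ _ (is_derive1_sqrt (u0 v)) du.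
  move=> /is_derive_eq; apply.
  by rewrite -/(F v); field; rewrite gt_eqF.
rewrite -(@integral_lebR_subst _ F f (fun r => ln (r ^+ 2 - c ^+ 2) / 2)%R
  (fun r => c < r)%R psi)//.
- apply: eq_integral => r _; rewrite /psi -muleA -EFinM; congr (_ * _%:E).
  have [cr|_] := ltP c r; last by rewrite !mulr0.
  by rewrite ger0_norm//; exact: le_trans c0 (ltW cr).
- have cu : continuous u.
    move=> v; apply: cvgD; first exact: cvg_cst.
    exact: (continuous_comp (@continuous_expR R v) (@exprn_continuous R 2 _)).
  move=> v; apply: cvgM.
    exact: (continuous_comp (@continuous_expR R v) (@exprn_continuous R 2 _)).
  apply: cvgV; first by rewrite gt_eqF.
  exact: (continuous_comp (cu v) (@sqrt_continuous R _)).
- by move=> v; rewrite divr_gt0// exprn_gt0// expR_gt0.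
- exact: measurable_fun_ltr.
- apply: measurable_funM => //; apply: (measurableT_comp (@measurable_ln R)).
  exact: measurable_funB.
- by move=> v; rewrite F2 lnXn ?expR_gt0// expRK mulr2n; lra.
- move=> r cr; have r0 := le_lt_trans c0 cr.
  have rc : (0 < r ^+ 2 - c ^+ 2)%R by rewrite subr_gt0 ltr_pXn2r// nnegrE ltW.
  rewrite /F /u -expRM_natl mulrCA divff// mulr1 lnK ?posrE//.
  by rewrite addrC subrK sqrtr_sqr gtr0_norm.
Qed.

End sphere_integrals.

Section spherical_coordinates.
Variable R : realType.
Local Open Scope ereal_scope.

Definition pos_row n (x : 'rV[R]_n) := [forall i, (0 < x ord0 i)%R].

Lemma pos_rowP n (x : 'rV[R]_n) : reflect (forall i, (0 < x ord0 i)%R) (pos_row x).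
Proof. exact: forallP. Qed.

Lemma measurable_pos_row n : measurable_fun setT (@pos_row n).
Proof.
apply: measurable_fun_forall_ord => i; apply: measurable_fun_ltr => //.
exact: measurable_coord.
Qed.

Lemma enorm_ge0 n (x : 'rV[R]_n) : (0 <= enorm x)%R.
Proof. exact: sqrtr_ge0. Qed.

Lemma enormZ n (r : R) (x : 'rV[R]_n) : (0 <= r)%R ->
  enorm (r *: x) = (r * enorm x)%R.
Proof.
move=> r0; rewrite /enorm; under eq_bigr do rewrite mxE exprMn.
by rewrite -mulr_sumr sqrtrM ?sqr_ge0// sqrtr_sqr ger0_norm.
Qed.

Lemma row_rcons_lt n (y : 'rV[R]_n) x (i : 'I_n) :
  row_rcons y x ord0 (widen_ord (leqnSn n) i) = y ord0 i.
Proof.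
by rewrite mxE /= (_ : insub _ = Some i)// -[RHS]valK.
Qed.

Lemma row_rcons_max n (y : 'rV[R]_n) x : row_rcons y x ord0 ord_max = x.
Proof. by rewrite mxE /= insubF//= ltnn. Qed.

Lemma pos_row_rcons n (y : 'rV[R]_n) x :
  pos_row (row_rcons y x) = pos_row y && (0 < x)%R.
Proof.
apply/pos_rowP/andP => [H|[/pos_rowP y0 x0] i].
  split; last by have := H ord_max; rewrite row_rcons_max.
  by apply/pos_rowP => i; have := H (widen_ord (leqnSn n) i); rewrite row_rcons_lt.
by rewrite mxE; case: insub => [k|]/=.
Qed.

Lemma row_rconsZ n (r : R) (y : 'rV[R]_n) x :
  r *: row_rcons y x = row_rcons (r *: y) (r * x)%R.
Proof. by apply/rowP => i; rewrite !mxE; case: insub => [k|]//=; rewrite mxE. Qed.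

Lemma pos_rowZ n (r : R) (x : 'rV[R]_n) : (0 < r)%R -> pos_row (r *: x) = pos_row x.
Proof.
by move=> r0; apply: eq_forallb => i; rewrite mxE pmulr_rgt0.
Qed.

(* With the last coordinate x replaced by r = |(y, x)| and then y by r y, the
   Jacobian is r^n / sqrt (1 - |y|^2), i.e. r^n times the density of the chart. *)
Lemma integral_orthant_spherical n (f : 'rV[R]_n.+1 -> \bar R) :
  measurable_fun setT f -> (forall x, 0 <= f x) ->
  \int[powm (lebR R) n.+1]_v (f v * (pos_row v)%:R%:E) =
  \int[lebR R]_r \int[sphere_measure R n.+1]_s
    (f (r *: s) * (r ^+ n * (pos_row s && (0 < r)%R)%:R)%:E).
Proof.
move=> mf f0.
have b0 (b : bool) : 0 <= (b%:R : R)%:E by rewrite lee_fin.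
have mposE d (T : measurableType d) p (u : T -> 'rV[R]_p) : measurable_fun setT u ->
    measurable_fun setT (fun z => (pos_row (u z))%:R%:E : \bar R).
  move=> mu; apply/measurable_EFinP; apply: measurable_natr.
  exact: (measurableT_comp (@measurable_pos_row p)).
have mfr d (T : measurableType d) (u : T -> 'rV[R]_n) (v : T -> R) :
    measurable_fun setT u -> measurable_fun setT v ->
    measurable_fun setT (fun z => f (row_rcons (u z) (v z))).
  by move=> mu mv; apply: (measurableT_comp mf); exact: measurable_fun_row_rcons.
rewrite integral_powm_rcons; last 2 first.
- apply: emeasurable_funM => //; exact: mposE.
- by move=> v; rewrite mule_ge0.
pose sig (r : R) (y : 'rV[R]_n) := Num.sqrt (r ^+ 2 - enorm y ^+ 2).
have msig d (T : measurableType d) (u : T -> 'rV[R]_n) (v : T -> R) :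
    measurable_fun setT u -> measurable_fun setT v ->
    measurable_fun setT (fun z => sig (v z) (u z)).
  move=> mu mv; apply: (measurableT_comp (@measurable_sqrtr R)).
  apply: measurable_funB; first exact: measurable_funX.
  by apply: measurable_funX; exact: (measurableT_comp (@measurable_enorm R n)).
pose Psi r y := f (row_rcons y (sig r y)) * (pos_row y)%:R%:E *
  (r / sig r y * (enorm y < r)%R%:R)%:E.
have Psi0 r y : 0 <= Psi r y.
  rewrite /Psi; case: ltP => [yr|_]; last by rewrite mulr0 mule0.
  rewrite mule_ge0 ?mule_ge0// lee_fin mulr1 divr_ge0 ?sqrtr_ge0//.
  by rewrite (le_trans (enorm_ge0 y))// ltW.
have mPsi d (T : measurableType d) (u : T -> 'rV[R]_n) (v : T -> R) :
    measurable_fun setT u -> measurable_fun setT v ->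
    measurable_fun setT (fun z => Psi (v z) (u z)).
  move=> mu mv; apply: emeasurable_funM.
    by apply: emeasurable_funM; [apply: mfr => //; exact: msig|exact: mposE].
  apply/measurable_EFinP; apply: measurable_funM.
    apply: measurable_funM => //; apply: (measurableT_comp (@measurable_invr R)).
    exact: msig.
  apply: measurable_natr; apply: measurable_fun_ltr => //.
  exact: (measurableT_comp (@measurable_enorm R n)).
transitivity (\int[powm (lebR R) n]_y \int[lebR R]_r Psi r y).
  apply: eq_integral => y _.
  under eq_integral do rewrite pos_row_rcons -mulnb natrM EFinM muleA.
  rewrite (half_line_to_radius (c := enorm y)
    (phi := fun x => f (row_rcons y x) * (pos_row y)%:R%:E))//.
  - exact: enorm_ge0.
  - apply: emeasurable_funM; last exact: measurable_cst.
    by apply: mfr => //; exact: measurable_cst.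
  - by move=> x; rewrite mule_ge0.
rewrite (@ge0_integral_swap _ _ _ _ _ (powm (lebR R) n) (lebR R)
  (fun p => Psi p.2 p.1)); [|exact: mPsi|by move=> p; exact: Psi0].
apply: eq_integral => r _ /=.
have [r0|r0] := ltP 0%R r; last first.
  rewrite [RHS]integral0_eq; last by move=> s _; rewrite andbF mulr0 mule0.
  apply: integral0_eq => y _; rewrite /Psi ltNge (le_trans r0 (enorm_ge0 y))/=.
  by rewrite mulr0 mule0.
(* Scaling y by r turns the condition |y| < r into |y| < 1, the domain of the chart. *)
rewrite (integral_powm_dilation r0)//; last by apply: mPsi => //; exact: measurable_cst.
have mrs : measurable_fun setT (fun s : 'rV[R]_n.+1 => f (r *: s)).
  apply: (measurableT_comp mf); apply/measurable_fun_rowP => i.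
  under eq_fun do rewrite mxE.
  by apply: measurable_funM => //; exact: measurable_coord.
rewrite integral_sphere; last 2 first.
- apply: emeasurable_funM => //; apply/measurable_EFinP; apply: measurable_funM => //.
  apply: measurable_natr; apply: measurable_and => //; first exact: measurable_pos_row.
- by move=> s; rewrite mule_ge0// lee_fin mulr_ge0// exprn_ge0// ltW.
apply: eq_integral => x _; rewrite /Psi enormZ ?ltW// gtr_pMr// /sphere_weight.
have [x1|_] := ltP (enorm x) 1%R; last first.
  by rewrite !(andbF, mul0r, mulr0, mule0, mul0e).
have s0 : (0 < 1 - enorm x ^+ 2)%R by rewrite subr_gt0 expr_lt1// sqrtr_ge0.
have -> : sig r (r *: x) = (r * Num.sqrt (1 - enorm x ^+ 2))%R.
  rewrite /sig enormZ ?ltW// exprMn -[X in (X - _)%R]mulr1 -mulrBr.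
  by rewrite sqrtrM ?sqr_ge0// sqrtr_sqr gtr0_norm.
rewrite sphere_chartE -row_rconsZ pos_rowZ// pos_row_rcons sqrtr_gt0 s0 !andbT.
rewrite -!muleA -!EFinM; congr (_ * _%:E).
have [/pos_rowP px|_] := boolP (pos_row x); last by rewrite !(mul0r, mulr0).
have -> : nonneg_row x by apply/nonneg_rowP => i; exact: ltW.
by field; rewrite !gt_eqF// sqrtr_gt0.
Qed.

(** The cut-off inside [pos_prod] already contains [pos_row], which can therefore be inserted to
    match the formula for the orthant. *)
Lemma pos_prod_row n (x : 'rV[R]_n) : (pos_prod x * (pos_row x)%:R)%R = pos_prod x.
Proof.
have [_|/forallPn[i xi]] := boolP (pos_row x); first by rewrite mulr1.
by rewrite mulr0 /pos_prod (bigD1 i)//= (negbTE xi) mulr0 mul0r.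
Qed.

Lemma pos_prodZ n (r : R) (x : 'rV[R]_n) : (0 < r)%R ->
  pos_prod (r *: x) = (r ^+ n * pos_prod x)%R.
Proof.
move=> r0; rewrite /pos_prod -[X in (r ^+ X)%R]card_ord -prodr_const -big_split/=.
by apply: eq_bigr => i _; rewrite mxE pmulr_rgt0// mulrA.
Qed.

(** The exponent 2 n + 1 is n from the spherical volume plus n + 1 from the homogeneity of
    [pos_prod]; it is 2 k - 1 for k = n + 1. *)
Lemma integral_powC_spherical n (h : 'rV[R[i]]_n.+1 -> \bar R) :
  measurable_fun setT h -> (forall z, 0 <= h z) ->
  \int[powm (lebC R) n.+1]_z h z =
  \int[lebR R]_r \int[sphere_measure R n.+1]_s
    ((\int[haar_torus R n.+1]_t h (torus_scale (r *: s) t)) *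
     (r ^+ (2 * n + 1) * pos_prod s * (0 < r)%R%:R)%:E).
Proof.
move=> mh h0; rewrite integral_powC_torus//.
have T0 (x : 'rV[R]_n.+1) : 0 <= \int[haar_torus R n.+1]_t h (torus_scale x t).
  exact: integral_ge0.
have p0 m (x : 'rV[R]_m) : 0 <= (pos_prod x)%:E by rewrite lee_fin pos_prod_ge0.
under eq_integral do rewrite -pos_prod_row EFinM muleA.
rewrite integral_orthant_spherical; last 2 first.
- apply: emeasurable_funM.
    apply: (@measurable_integral1 _ _ _ _ _ (haar_torus R n.+1)
      (fun z => h (torus_scale z.1 z.2))) => //.
    by apply: (measurableT_comp mh); exact: measurable_torus_scale.
  by apply/measurable_EFinP; exact: measurable_pos_prod.
- by move=> x; rewrite mule_ge0.
apply: eq_integral => r _; apply: eq_integral => s _.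
have [r0|_] := ltP 0%R r; last by rewrite andbF !mulr0 !mule0.
rewrite -muleA -EFinM pos_prodZ// -[in RHS]pos_prod_row andbT; congr (_ * _%:E).
by rewrite mulr1 addn1 mul2n -addnn !exprS exprD; ring.
Qed.

End spherical_coordinates.

(** * Gaussian moments *)

Section gamma_integrals.
Variable R : realType.
Local Open Scope ereal_scope.

(* - e^(-x) gamma_poly p x is a primitive of e^(-x) x^p. *)
Fixpoint gamma_poly (p : nat) (x : R) : R :=
  if p is p'.+1 then (x ^+ p + p%:R * gamma_poly p' x)%R else 1%R.

Lemma gamma_poly0 p : gamma_poly p 0 = (p`!)%:R%R.
Proof.
by elim: p => //= p ->; rewrite expr0n/= add0r factS natrM.
Qed.

Lemma is_derive_gamma_poly p (x : R) :
  is_derive x (1 : R)%R (gamma_poly p) (gamma_poly p x - x ^+ p)%R.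
Proof.
elim: p => [|p IH] /=.
  by rewrite expr0 subrr; exact: is_derive_cst.
rewrite addrAC subrr add0r.
have -> : (fun x => x ^+ p.+1 + p.+1%:R * gamma_poly p x)%R =
  (@id R ^+ p.+1 + cst p.+1%:R * gamma_poly p)%R.
  by apply/funext => y; rewrite !fctE.
apply: is_derive_eq.
rewrite /GRing.scale/= !(mulr1, mulr0, add0r, addr0) -mulr_natl; ring.
Qed.

Lemma continuous_expRN : continuous (fun x : R => expR (- x)).
Proof.
by move=> x; apply: continuous_comp; [exact: opp_continuous|exact: continuous_expR].
Qed.

(** e^x dominates x^(n+1) / (n+1)!, so for x > 0 the product is at most (n+1)! / x. *)
Lemma cvg_expRN_Xn n : (expR (- x) * x ^+ n)%R @[x --> +oo%R] --> (0 : R)%R.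
Proof.
apply/cvgrPdist_le => e e0; near=> x.
have x0 : (0 < x)%R by near: x; apply: nbhs_pinfty_gt; exact: num_real.
rewrite sub0r normrN ger0_norm; last by rewrite mulr_ge0 ?expR_ge0// exprn_ge0// ltW.
have xe : ((n.+1)`!%:R / e <= x)%R by near: x; apply: nbhs_pinfty_ge; exact: num_real.
have ex : (x ^+ n.+1 / n.+1`!%:R <= expR x)%R.
  by rewrite (le_trans _ (expR_ge1Dxn n (ltW x0)))// lerDr.
have f0 : (0 < n.+1`!%:R :> R)%R by rewrite ltr0n fact_gt0.
rewrite expRN mulrC ler_pdivrMr ?expR_gt0//.
rewrite ler_pdivrMr// in xe; rewrite ler_pdivrMr// in ex.
have h1 : (x ^+ n * n.+1`!%:R <= x ^+ n * (x * e))%R.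
  by rewrite ler_wpM2l// exprn_ge0// ltW.
have h2 : (e * x ^+ n.+1 <= e * (expR x * n.+1`!%:R))%R by rewrite ler_wpM2l// ltW.
rewrite -(ler_pM2r f0) (le_trans h1)// mulrA -exprSr mulrC (le_trans h2)//.
by rewrite mulrA.
Unshelve. all: by end_near. Qed.

Lemma cvg_expRN_gamma_poly p : (expR (- x) * gamma_poly p x)%R @[x --> +oo%R] --> (0 : R)%R.
Proof.
elim: p => [|p IH] /=.
  by under eq_fun do rewrite mulr1; exact: cvgr_expR.
have -> : (fun x => expR (- x) * (x ^+ p.+1 + p.+1%:R * gamma_poly p x))%R =
    (fun x => expR (- x) * x ^+ p.+1 + p.+1%:R * (expR (- x) * gamma_poly p x))%R.
  by apply/funext => x; ring.
have := cvgD (cvg_expRN_Xn p.+1) (cvgM (cvg_cst (p.+1%:R : R)%R) IH).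
by rewrite mulr0 addr0 => hl; exact: hl.
Qed.

Lemma is_derive_expRN_gamma_poly p (x : R) :
  is_derive x (1 : R)%R (fun x => - (expR (- x) * gamma_poly p x))%R
    (expR (- x) * x ^+ p)%R.
Proof.
have dp := is_derive_gamma_poly p x.
have de : is_derive x (1 : R)%R (fun x => expR (- x))%R (- expR (- x))%R.
  have := @is_derive1_comp R (@expR R) (-%R) x _ _ (is_derive_expR _) (is_deriveNid _ _).
  by move=> /is_derive_eq; apply; rewrite mulrN1.
have -> : (fun x => - (expR (- x) * gamma_poly p x))%R =
  (- ((fun x => expR (- x)) * gamma_poly p))%R by [].
apply: is_derive_eq; rewrite /GRing.scale/=; ring.
Qed.

Lemma integral_gamma_nat p :
  \int[lebR R]_x ((expR (- x) * x ^+ p)%:E * (0 < x)%R%:R%:E) = (p`!)%:R%:E.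
Proof.
pose f (x : R) : R := (expR (- x) * x ^+ p)%R.
pose F (x : R) : R := (- (expR (- x) * gamma_poly p x))%R.
have cf : continuous f.
  move=> x; apply: cvgM; last exact: exprn_continuous.
  exact: continuous_expRN.
have mf : measurable_fun setT f by exact: continuous_measurable_fun.
transitivity (\int[lebR R]_(x in `]0%R, +oo[) (f x)%:E).
  rewrite [RHS]integral_mkcond; apply: eq_integral => x _; rewrite patchE.
  have -> : (x \in `]0%R, +oo[%classic) = (0 < x)%R.
    by apply/idP/idP; rewrite inE/= in_itv/= andbT.
  by case: ltP; rewrite ?mule1 ?mule0.
have mfE D : measurable_fun D (EFin \o f).
  by apply/measurable_EFinP; exact: measurable_funTS.
rewrite integral_lebR_set//; last first.
  move=> x; rewrite inE/= in_itv/= andbT => x0.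
  by rewrite lee_fin mulr_ge0 ?expR_ge0// exprn_ge0// ltW.
rewrite integral_itv_obnd_cbnd//.
rewrite (@ge0_continuous_FTC2y _ f F 0 0).
- by rewrite /F oppr0 expR0 mul1r gamma_poly0 -EFinB sub0r opprK.
- by move=> x x0; rewrite mulr_ge0 ?expR_ge0// exprn_ge0.
- exact: continuous_subspaceT.
- by rewrite -[X in _ --> X]oppr0; apply: cvgN; exact: cvg_expRN_gamma_poly.
- by move=> x _; exact: (@ex_derive _ _ _ _ _ _ _ (is_derive_expRN_gamma_poly p x)).
- apply: cvg_at_right_filter; apply/differentiable_continuous/derivable1_diffP.
  exact: (@ex_derive _ _ _ _ _ _ _ (is_derive_expRN_gamma_poly p 0)).
- move=> x _; rewrite derive1E.
  exact: (@derive_val _ _ _ _ _ _ _ (is_derive_expRN_gamma_poly p x)).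
Qed.

(** With r = e^v, squaring r is doubling v, so the substitution becomes a dilation between two
    exponential parametrizations. *)
Lemma integral_half_line_sqr (h : R -> \bar R) :
  measurable_fun setT h -> (forall x, 0 <= h x) ->
  \int[lebR R]_x (h x * (0 < x)%R%:R%:E) =
  \int[lebR R]_r (h (r ^+ 2)%R * (2 * r * (0 < r)%R%:R)%:E).
Proof.
move=> mh h0.
have mh2 : measurable_fun setT (fun r : R => h (r ^+ 2)%R).
  by apply: (measurableT_comp mh); exact: measurable_funX.
pose phi (r : R) := h (r ^+ 2)%R * (2 * `|r|)%:E.
transitivity (\int[lebR R]_r (phi r * (0 < r)%R%:R%:E)); last first.
  apply: eq_integral => r _; rewrite /phi -muleA -EFinM; congr (_ * _%:E).
  by case: ltP => [r0|_]; rewrite ?mulr0// gtr0_norm.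
have mexp : measurable_fun setT (@expR R).
  by apply: continuous_measurable_fun; exact: continuous_expR.
rewrite !integral_half_line_exp//; last 2 first.
- apply: emeasurable_funM => //; apply/measurable_EFinP; apply: measurable_funM => //.
- by move=> r; rewrite mule_ge0.
have e0 (v : R) : 0 <= (expR v)%:E by rewrite lee_fin expR_ge0.
rewrite (@integral_lebR_dilation _ 2)//; last 2 first.
- apply: emeasurable_funM; first exact: (measurableT_comp mh).
  exact/measurable_EFinP.
- by move=> v; rewrite mule_ge0.
apply: eq_integral => v _; rewrite /phi -!muleA -!EFinM gtr0_norm ?expR_gt0//.
by rewrite -(expRM_natl 2 v); congr (_ * _%:E); rewrite (expRM_natl 2 v); ring.
Qed.

(** The substitution u = r^2 turns r^(2p+1) dr into u^p du / 2 and leaves the integral of the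
    factorial. *)
Lemma integral_gauss_odd p :
  \int[lebR R]_r ((expR (- r ^+ 2) * r ^+ (2 * p + 1) * (0 < r)%R%:R)%:E) =
  (p`!%:R / 2)%:E.
Proof.
pose h (x : R) : \bar R := (expR (- x) * `|x| ^+ p)%:E.
have mh : measurable_fun setT h.
  apply/measurable_EFinP; apply: measurable_funM.
    exact: continuous_measurable_fun continuous_expRN.
  by apply: measurable_funX; exact: normr_measurable.
have h0 x : 0 <= h x by rewrite lee_fin mulr_ge0 ?expR_ge0// exprn_ge0.
rewrite EFinM muleC -integral_gamma_nat.
transitivity (2^-1%:E * \int[lebR R]_x (h x * (0 < x)%R%:R%:E)).
  rewrite integral_half_line_sqr// -ge0_integralZl//.
  - apply: eq_integral => r _; rewrite -!EFinM; congr EFin.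
    case: ltP => [r0|_]; last by rewrite !mulr0.
    by rewrite ger0_norm ?sqr_ge0// -exprM exprD; field.
  - apply: emeasurable_funM.
      by apply: (measurableT_comp mh); exact: measurable_funX.
    apply/measurable_EFinP; apply: measurable_funM; first exact: measurable_funM.
    by apply: measurable_natr; exact: measurable_fun_ltr.
  - by move=> r _; rewrite mule_ge0// -mulrA lee_fin mulr_ge0// polar_weight_ge0.
congr (_ * _); apply: eq_integral => x _; rewrite /h.
by case: ltP => [x0|_]; rewrite ?mule0// gtr0_norm.
Qed.

End gamma_integrals.

(** * Polar coordinates in C^k *)

Section block_polar.
Variable R : realType.
Local Open Scope ereal_scope.

Lemma normc_expi (x : R) : Normc.normc (expi x) = 1%R.
Proof. by rewrite /Normc.normc /= cos2Dsin2 sqrtr1. Qed.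

(** [haar_torus] is carried by the torus: each coordinate comes from an interval through [expi],
    which has modulus 1. *)
Lemma eq_integral_haar k (f g : 'rV[R[i]]_k -> \bar R) :
  measurable_fun setT f -> (forall t, 0 <= f t) ->
  measurable_fun setT g -> (forall t, 0 <= g t) ->
  (forall t, torus t -> f t = g t) ->
  \int[haar_torus R k]_t f t = \int[haar_torus R k]_t g t.
Proof.
elim: k f g => [|k IH] f g mf f0 mg g0 fg.
  by rewrite /haar_torus [LHS]integral_powm0// [RHS]integral_powm0// fg// => -[].
have mc (h : 'rV[R[i]]_k.+1 -> \bar R) t : measurable_fun setT h ->
    measurable_fun setT (fun u => h (row_cons (t, u))).
  move=> mh; apply: (measurableT_comp mh).
  by apply: measurable_fun_row_cons; [exact: measurable_cst|exact: measurable_id].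
have mi (h : 'rV[R[i]]_k.+1 -> \bar R) : measurable_fun setT h ->
    (forall t, 0 <= h t) ->
    measurable_fun setT (fun t => \int[haar_torus R k]_u h (row_cons (t, u))).
  move=> mh h0; apply: (@measurable_integral1 _ _ _ _ _ (haar_torus R k)
    (fun p => h (row_cons (p.1, p.2)))) => //.
  by apply: (measurableT_comp mh); exact: measurable_fun_row_cons.
rewrite /haar_torus [LHS]integral_powmS; [|by []|by []].
rewrite [RHS]integral_powmS; [|by []|by []].
rewrite [LHS]integral_arc; [|exact: mi|by move=> t; exact: integral_ge0].
rewrite [RHS]integral_arc; [|exact: mi|by move=> t; exact: integral_ge0].
apply: eq_integral => x _; congr (_ * _); apply: IH => //; [exact: mc|exact: mc|].
move=> t tt; apply: fg => i; have [j ->|->] := unliftP ord0 i.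
  by rewrite row_consS.
by rewrite row_cons0 normc_expi.
Qed.

(** The chart takes values in [sphere_plus] wherever [sphere_weight] is not 0. *)
Lemma eq_integral_sphere n (f g : 'rV[R]_n.+1 -> \bar R) :
  measurable_fun setT f -> (forall s, 0 <= f s) ->
  measurable_fun setT g -> (forall s, 0 <= g s) ->
  (forall s, sphere_plus s -> f s = g s) ->
  \int[sphere_measure R n.+1]_s f s = \int[sphere_measure R n.+1]_s g s.
Proof.
move=> mf f0 mg g0 fg; rewrite !integral_sphere//; apply: eq_integral => x _.
rewrite /sphere_weight; case: (boolP (_ && _)) => [/andP[/nonneg_rowP x0 x1]|_].
  rewrite fg//; split.
    by move=> i; rewrite mxE; case: insub => [k|]//=; exact: sqrtr_ge0.
  rewrite /enorm big_ord_recr /= row_rcons_max.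
  under eq_bigr do rewrite row_rcons_lt.
  rewrite -enorm_sqr [X in (_ + X)%R]sqr_sqrtr; first by rewrite addrCA subrr addr0 sqrtr1.
  by rewrite subr_ge0 expr_le1// ?sqrtr_ge0// ltW.
by rewrite mul0r !mule0.
Qed.

Lemma normc_ge0 (z : R[i]) : (0 <= Normc.normc z)%R.
Proof. by case: z => a b; exact: sqrtr_ge0. Qed.

(* The values at the origin (for [sdir]) and at a vanishing coordinate (for
   [tdir]) are chosen so that [polar_block z (sdir z) (tdir z)] always holds. *)
Definition sdir k (z : 'rV[R[i]]_k) : 'rV[R]_k :=
  \row_i (if cnorm z == 0 then ((i : nat) == 0)%:R
          else Normc.normc (z ord0 i) / cnorm z)%R.

Definition tdir k (z : 'rV[R[i]]_k) : 'rV[R[i]]_k :=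
  \row_i (if Normc.normc (z ord0 i) == 0 then 1
          else z ord0 i * ((Normc.normc (z ord0 i))^-1)%:C)%R.

Lemma cnorm_ge0 k (z : 'rV[R[i]]_k) : (0 <= cnorm z)%R.
Proof. exact: sqrtr_ge0. Qed.

Lemma cnorm_sqr k (z : 'rV[R[i]]_k) :
  (cnorm z ^+ 2 = \sum_i Normc.normc (z ord0 i) ^+ 2)%R.
Proof. by rewrite enorm_sqr; apply: eq_bigr => i _; rewrite mxE. Qed.

Lemma normc_le_cnorm k (z : 'rV[R[i]]_k) i : (Normc.normc (z ord0 i) <= cnorm z)%R.
Proof.
rewrite -(@ler_pXn2r _ 2)// ?nnegrE ?normc_ge0 ?cnorm_ge0// cnorm_sqr.
by rewrite (bigD1 i)//= lerDl sumr_ge0// => l _; exact: sqr_ge0.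
Qed.

Lemma normc_sdir k (z : 'rV[R[i]]_k) i :
  Normc.normc (z ord0 i) = (cnorm z * sdir z ord0 i)%R.
Proof.
rewrite mxE; case: eqP => [z0|/eqP z0]; last by field.
rewrite z0 mul0r; apply/eqP; rewrite eq_le normc_ge0 andbT -z0.
exact: normc_le_cnorm.
Qed.

Lemma normc_real (x : R) : Normc.normc (x%:C) = `|x|%R.
Proof. by rewrite /Normc.normc /= expr0n addr0 sqrtr_sqr. Qed.

Lemma normc_torus_scale k (x : 'rV[R]_k) t i : torus t ->
  (forall i, (0 <= x ord0 i)%R) ->
  Normc.normc (torus_scale x t ord0 i) = x ord0 i.
Proof.
by move=> tt x0; rewrite mxE Normc.normcM tt mul1r normc_real ger0_norm.
Qed.

Lemma cnorm_torus_scale k (x : 'rV[R]_k) t : torus t ->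
  (forall i, (0 <= x ord0 i)%R) -> cnorm (torus_scale x t) = enorm x.
Proof.
move=> tt x0; congr enorm; apply/rowP => i.
by rewrite mxE normc_torus_scale.
Qed.

(** At a vanishing coordinate the angle is lost, so all coordinates are recovered only for positive
    entries of s; elsewhere on the sphere the Jacobian [pos_prod s] is 0. *)
Lemma torus_scale_polar k (r : R) (s : 'rV[R]_k) t : (0 < r)%R ->
  sphere_plus s -> torus t -> pos_row s ->
  [/\ cnorm (torus_scale (r *: s) t) = r, sdir (torus_scale (r *: s) t) = s &
      tdir (torus_scale (r *: s) t) = t].
Proof.
move=> r0 [s0 s1] tt /pos_rowP ps.
have rs0 i : (0 <= (r *: s) ord0 i)%R by rewrite mxE mulr_ge0// ltW.
have E1 : cnorm (torus_scale (r *: s) t) = r.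
  by rewrite cnorm_torus_scale// enormZ ?ltW// s1 mulr1.
split => //; apply/rowP => i; rewrite mxE normc_torus_scale//.
  by rewrite E1 gt_eqF// mxE mulrC mulrA mulVf ?mul1r// gt_eqF.
have rsi : (0 < (r *: s) ord0 i)%R by rewrite mxE mulr_gt0.
rewrite gt_eqF// mxE -mulrA -[X in (_ * X)%R]rmorphM divff ?gt_eqF//.
by rewrite rmorph1 mulr1.
Qed.

Lemma measurable_cnorm k : measurable_fun setT (@cnorm R k).
Proof.
apply: (measurableT_comp (@measurable_enorm R k)).
apply/measurable_fun_rowP => i; under eq_fun do rewrite mxE.
by apply: measurable_normc; exact: measurable_coord.
Qed.

Lemma measurable_sdir k : measurable_fun setT (@sdir k).
Proof.
apply/measurable_fun_rowP => i; under eq_fun do rewrite mxE.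
apply: measurable_fun_ifT; first by apply: measurable_fun_eqr => //; exact: measurable_cnorm.
  exact: measurable_cst.
apply: measurable_funM; first by apply: measurable_normc; exact: measurable_coord.
exact: (measurableT_comp (@measurable_invr R) (@measurable_cnorm k)).
Qed.

Lemma measurable_tdir k : measurable_fun setT (@tdir k).
Proof.
have mn (i : 'I_k) : measurable_fun setT (fun z : 'rV[R[i]]_k => Normc.normc (z ord0 i)).
  by apply: measurable_normc; exact: measurable_coord.
apply/measurable_fun_rowP => i; under eq_fun do rewrite mxE.
apply: measurable_fun_ifT; first exact: measurable_fun_eqr.
  exact: measurable_cst.
apply: measurable_complexM; first exact: measurable_coord.
by apply: measurable_real_complex; exact: (measurableT_comp (@measurable_invr R)).
Qed.

Lemma sphere_plus_sdir k (z : 'rV[R[i]]_k) : (0 < k)%N -> sphere_plus (sdir z).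
Proof.
case: k z => // k z _; split=> [i|].
  by rewrite mxE; case: eqP => _; rewrite ?divr_ge0 ?normc_ge0 ?cnorm_ge0.
rewrite /enorm; under eq_bigr do rewrite mxE.
case: eqP => [_|/eqP z0].
  by rewrite big_ord_recl /= big1 ?addr0 ?expr1n ?sqrtr1// => i _; rewrite expr0n.
under eq_bigr do rewrite expr_div_n.
by rewrite -mulr_suml -cnorm_sqr divff ?sqrtr1// expf_neq0.
Qed.

Lemma torus_tdir k (z : 'rV[R[i]]_k) : torus (tdir z).
Proof.
move=> i; rewrite mxE; case: eqP => [_|/eqP zi]; first exact: Normc.normc1.
by rewrite Normc.normcM normc_real ger0_norm ?invr_ge0 ?normc_ge0// divff.
Qed.

Lemma normc_tdir k (z : 'rV[R[i]]_k) i :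
  (z ord0 i = tdir z ord0 i * (Normc.normc (z ord0 i))%:C)%R.
Proof.
rewrite mxE; case: eqP => [zi|/eqP zi]; first by rewrite zi mulr0; exact: Normc.eq0_normc.
by rewrite -mulrA -[X in (_ * X)%R]rmorphM mulVf// rmorph1 mulr1.
Qed.

Definition block_polar k (z : 'rV[R[i]]_k) := (cnorm z, (sdir z, tdir z)).

Lemma measurable_block_polar k : measurable_fun setT (@block_polar k).
Proof.
apply: measurable_fun_pair; first exact: measurable_cnorm.
by apply: measurable_fun_pair; [exact: measurable_sdir|exact: measurable_tdir].
Qed.

(** Passes from the parametrization by (r, s, t) to functions of the coordinates of z. Where
    [torus_scale_polar] does not apply, the weight vanishes. *)
Lemma integral_powC_polar n (H : R * ('rV[R]_n.+1 * 'rV[R[i]]_n.+1) -> \bar R) :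
  measurable_fun setT H -> (forall p, 0 <= H p) ->
  \int[powm (lebC R) n.+1]_z H (block_polar z) =
  \int[lebR R]_r \int[sphere_measure R n.+1]_s \int[haar_torus R n.+1]_t
    (H (r, (s, t)) * (r ^+ (2 * n + 1) * pos_prod s * (0 < r)%R%:R)%:E).
Proof.
move=> mH H0; pose w (r : R) (s : 'rV[R]_n.+1) : R :=
  (r ^+ (2 * n + 1) * pos_prod s * (0 < r)%R%:R)%R.
have w0 r s : 0 <= (w r s)%:E.
  rewrite lee_fin /w; case: ltP => [r0|_]; last by rewrite mulr0.
  by rewrite mulr1 mulr_ge0 ?pos_prod_ge0// exprn_ge0// ltW.
have mw d (T : measurableType d) (u : T -> R) (v : T -> 'rV[R]_n.+1) :
    measurable_fun setT u -> measurable_fun setT v ->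
    measurable_fun setT (fun z => (w (u z) (v z))%:E).
  move=> mu mv; apply/measurable_EFinP; apply: measurable_funM.
    apply: measurable_funM; first exact: measurable_funX.
    exact: (measurableT_comp (@measurable_pos_prod R _)).
  by apply: measurable_natr; exact: measurable_fun_ltr.
have mHp d (T : measurableType d) (u : T -> R) (v : T -> 'rV[R]_n.+1)
    (t : T -> 'rV[R[i]]_n.+1) :
    measurable_fun setT u -> measurable_fun setT v -> measurable_fun setT t ->
    measurable_fun setT (fun z => H (u z, (v z, t z))).
  move=> mu mv mt; apply: (measurableT_comp mH).
  by apply: measurable_fun_pair => //; exact: measurable_fun_pair.
have mHb d (T : measurableType d) (u : T -> R) (v : T -> 'rV[R]_n.+1)
    (t : T -> 'rV[R[i]]_n.+1) :
    measurable_fun setT u -> measurable_fun setT v -> measurable_fun setT t ->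
    measurable_fun setT (fun z => H (block_polar (torus_scale (u z *: v z) (t z)))).
  move=> mu mv mt; apply: (measurableT_comp mH).
  apply: (measurableT_comp (@measurable_block_polar _)).
  apply: measurable_torus_scale => //.
  apply/measurable_fun_rowP => i; under eq_fun do rewrite mxE.
  apply: measurable_funM => //.
  exact: (measurableT_comp (measurable_coord i) mv).
rewrite integral_powC_spherical; last 2 first.
- by apply: (measurableT_comp mH); exact: measurable_block_polar.
- by [].
apply: eq_integral => r _; apply: eq_integral_sphere.
- apply: emeasurable_funM; last by apply: mw => //; exact: measurable_cst.
  apply: (@measurable_integral1 _ _ _ _ _ (haar_torus R n.+1)
    (fun p : 'rV[R]_n.+1 * 'rV[R[i]]_n.+1 =>
      H (block_polar (torus_scale (r *: p.1) p.2)))) => //.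
  by apply: mHb => //; exact: measurable_cst.
- by move=> s; rewrite mule_ge0//; [exact: integral_ge0|exact: w0].
- apply: (@measurable_integral1 _ _ _ _ _ (haar_torus R n.+1)
    (fun p => H (r, (p.1, p.2)) * (w r p.1)%:E)) => //.
    by apply: emeasurable_funM; [apply: mHp|apply: mw] => //; exact: measurable_cst.
  by move=> p; rewrite mule_ge0.
- by move=> s; apply: integral_ge0 => t _; rewrite mule_ge0//; exact: w0.
move=> s ss.
rewrite -ge0_integralZr//; [|by apply: mHb => //; exact: measurable_cst|exact: w0].
apply: eq_integral_haar.
- apply: emeasurable_funM; last exact: measurable_cst.
  by apply: mHb => //; exact: measurable_cst.
- by move=> t; rewrite mule_ge0//; exact: w0.
- apply: emeasurable_funM; last exact: measurable_cst.
  by apply: mHp => //; exact: measurable_cst.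
- by move=> t; rewrite mule_ge0//; exact: w0.
move=> t tt; have [r0|_] := ltP 0%R r; last by rewrite mulr0 !mule0.
rewrite -pos_prod_row; have [ps|_] := boolP (pos_row s); last first.
  by rewrite !(mulr0, mul0r, mule0).
by rewrite /block_polar; have [-> -> ->] := torus_scale_polar r0 ss tt ps.
Qed.

End block_polar.

Section radial_monomials.
Variable R : realType.
Local Open Scope ereal_scope.

Definition monomial_normsq k (z : 'rV[R[i]]_k) (al : 'rV[nat]_k) : R :=
  (\prod_i Normc.normc (z ord0 i) ^+ (2 * al ord0 i))%R.

Definition even_monomial k (s : 'rV[R]_k) (al : 'rV[nat]_k) : R :=
  (\prod_i s ord0 i ^+ (2 * al ord0 i))%R.

Lemma even_monomial_ge0 k (s : 'rV[R]_k) al : (0 <= even_monomial s al)%R.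
Proof. by apply: prodr_ge0 => i _; rewrite exprM exprn_ge0// sqr_ge0. Qed.

Lemma monomial_normsq_ge0 k (z : 'rV[R[i]]_k) al : (0 <= monomial_normsq z al)%R.
Proof. by apply: prodr_ge0 => i _; rewrite exprM exprn_ge0// sqr_ge0. Qed.

Lemma measurable_even_monomial k al : measurable_fun setT (@even_monomial k ^~ al).
Proof.
by apply: measurable_prod => i _; apply: measurable_funX; exact: measurable_coord.
Qed.

Lemma measurable_monomial_normsq k al :
  measurable_fun setT (@monomial_normsq k ^~ al).
Proof.
apply: measurable_prod => i _; apply: measurable_funX.
by apply: measurable_normc; exact: measurable_coord.
Qed.

Lemma monomial_normsq_polar k (z : 'rV[R[i]]_k) al :
  (monomial_normsq z al = cnorm z ^+ (2 * mi_abs al) * even_monomial (sdir z) al)%R.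
Proof.
rewrite /mi_abs big_distrr /= expr_sum -big_split/=.
by apply: eq_bigr => i _; rewrite normc_sdir exprMn.
Qed.

(** The integral of |zeta^al|^2 over the unit sphere of C^(n+1), in the coordinates zeta_i = t_i
    s_i; [pos_prod s] is the Jacobian. *)
Definition sphere_moment n (al : 'rV[nat]_n.+1) : \bar R :=
  \int[sphere_measure R n.+1]_s \int[haar_torus R n.+1]_t
    (even_monomial s al * pos_prod s)%:E.

(** |z^al|^2 is homogeneous of degree 2 |al|, so radius and direction separate. The profile [phi] is
    free: a Gaussian determines the moment, indicators and the Bergman weight are the later uses. *)
Lemma integral_radial_monomial n (al : 'rV[nat]_n.+1) (phi : R -> R) :
  measurable_fun setT phi -> (forall r, (0 <= phi r)%R) ->
  \int[powm (lebC R) n.+1]_z (phi (cnorm z) * monomial_normsq z al)%:E =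
  sphere_moment al * \int[lebR R]_r
    (phi r * (r ^+ (2 * (n + mi_abs al) + 1) * (0 < r)%R%:R))%:E.
Proof.
move=> mphi phi0; have e0 (s : 'rV[R]_n.+1) := even_monomial_ge0 s al.
have p0 (s : 'rV[R]_n.+1) := pos_prod_ge0 s.
have ep0 (s : 'rV[R]_n.+1) : 0 <= (even_monomial s al * pos_prod s)%:E.
  by rewrite lee_fin mulr_ge0.
have mep d (T : measurableType d) (u : T -> 'rV[R]_n.+1) : measurable_fun setT u ->
    measurable_fun setT (fun z => (even_monomial (u z) al * pos_prod (u z))%:E).
  move=> mu; apply/measurable_EFinP; apply: measurable_funM.
    exact: (measurableT_comp (@measurable_even_monomial _ al)).
  exact: (measurableT_comp (@measurable_pos_prod R _)).
(* The absolute value keeps [H] nonnegative for every r; the polar weight then retains only 0 <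
   r. *)
pose H (p : R * ('rV[R]_n.+1 * 'rV[R[i]]_n.+1)) : \bar R :=
  (phi p.1 * (`|p.1| ^+ (2 * mi_abs al) * even_monomial p.2.1 al))%:E.
transitivity (\int[powm (lebC R) n.+1]_z H (block_polar z)).
  apply: eq_integral => z _; congr (_ * _)%:E.
  by rewrite monomial_normsq_polar ger0_norm ?cnorm_ge0.
rewrite integral_powC_polar; last 2 first.
- apply/measurable_EFinP; apply: measurable_funM; first exact: (measurableT_comp mphi).
  apply: measurable_funM.
    by apply: measurable_funX; exact: (measurableT_comp (@normr_measurable R setT)).
  apply: (measurableT_comp (@measurable_even_monomial _ al)).
  exact: (measurableT_comp measurable_fst).
- by move=> p; rewrite lee_fin !mulr_ge0// exprn_ge0.
have K0 : 0 <= sphere_moment al.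
  by apply: integral_ge0 => s _; apply: integral_ge0 => t _; exact: ep0.
have w0 r : (0 <= phi r * (r ^+ (2 * (n + mi_abs al) + 1) * (0 < r)%R%:R))%R.
  case: ltP => [r0|_]; last by rewrite !mulr0.
  by rewrite mulr1 mulr_ge0// exprn_ge0// ltW.
rewrite muleC -ge0_integralZr//; last 2 first.
- apply/measurable_EFinP; apply: measurable_funM => //; apply: measurable_funM.
    exact: measurable_funX.
  by apply: measurable_natr; exact: measurable_fun_ltr.
- by move=> r _; rewrite lee_fin.
apply: eq_integral => r _; rewrite -ge0_integralZl//; last 3 first.
- apply: (@measurable_integral1 _ _ _ _ _ (haar_torus R n.+1)
    (fun p : 'rV[R]_n.+1 * 'rV[R[i]]_n.+1 => (even_monomial p.1 al * pos_prod p.1)%:E)).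
    exact: mep.
  by move=> p.
- by move=> s _; exact: integral_ge0.
- by rewrite lee_fin.
apply: eq_integral => s _; rewrite -ge0_integralZl//; last by rewrite lee_fin.
apply: eq_integral => t _; rewrite /H /= -!EFinM; congr EFin.
case: ltP => [r0|_]; last by rewrite !(mulr0, mul0r).
rewrite (gtr0_norm r0) !mulr1 mulnDr addnAC [(r ^+ (_ + _ + _))%R]exprD; ring.
Qed.

Lemma integral_circle :
  \int[lebR R]_x ((0 <= x < 2 * pi)%R%:R : R)%:E = (2 * pi : R)%:E.
Proof.
transitivity (\int[lebR R]_x (\1_(`[0%R, (2 * pi)%R[) x : R)%:E).
  by apply: eq_integral => x _; rewrite indicE mem_setE in_itv.
rewrite integral_indic// setIT -[LHS]/(lebesgue_measure `[0%R, (2 * pi)%R[%classic).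
by rewrite lebesgue_measure_itv/= lte_fin mulr_gt0 ?pi_gt0// oppr0 adde0.
Qed.

Lemma measurable_expRN_sqr d (T : measurableType d) (u : T -> R) :
  measurable_fun setT u -> measurable_fun setT (fun z => expR (- u z ^+ 2)).
Proof.
move=> mu; apply: (measurableT_comp (continuous_measurable_fun (@continuous_expRN R))).
exact: measurable_funX.
Qed.

(** The arc contributes 2 pi and the radius a! / 2. *)
Lemma integral_lebC_gauss (a : nat) :
  \int[lebC R]_z (expR (- Normc.normc z ^+ 2) * Normc.normc z ^+ (2 * a))%:E =
  (pi * a`!%:R)%:E.
Proof.
have mh : measurable_fun setT (fun z : R[i] =>
    (expR (- Normc.normc z ^+ 2) * Normc.normc z ^+ (2 * a))%:E).
  have mn : measurable_fun setT (fun z : R[i] => Normc.normc z).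
    by apply: measurable_normc; exact: measurable_id.
  apply/measurable_EFinP; apply: measurable_funM; first exact: measurable_expRN_sqr.
  exact: measurable_funX.
have h0 (z : R[i]) : 0 <= (expR (- Normc.normc z ^+ 2) * Normc.normc z ^+ (2 * a))%:E.
  by rewrite lee_fin mulr_ge0 ?expR_ge0// exprn_ge0// normc_ge0.
have w0 (r : R) : 0 <= (r * (0 < r)%R%:R)%:E by rewrite lee_fin polar_weight_ge0.
rewrite integral_lebC_polar// integral_arc; last 2 first.
- apply: (@measurable_integral1 _ _ _ _ _ (lebR R) (fun p : R[i] * R =>
    (expR (- Normc.normc (p.2%:C * p.1)%R ^+ 2) * Normc.normc (p.2%:C * p.1)%R ^+ (2 * a))%:E *
    (p.2 * (0 < p.2)%R%:R)%:E)).
    exact: (measurable_polar mh).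
  by move=> p; rewrite mule_ge0.
- by move=> t; apply: integral_ge0 => r _; rewrite mule_ge0.
transitivity (\int[lebR R]_x ((a`!%:R / 2)%:E * ((0 <= x < 2 * pi)%R%:R)%:E)).
  apply: eq_integral => x _; congr (_ * _); rewrite -integral_gauss_odd.
  apply: eq_integral => r _; rewrite Normc.normcM normc_real normc_expi mulr1.
  rewrite -EFinM; congr EFin; case: ltP => [r0|_]; last by rewrite !mulr0.
  by rewrite gtr0_norm// exprD expr1; ring.
rewrite ge0_integralZl//; last first.
  apply/measurable_EFinP; apply: measurable_natr.
  by apply: measurable_and; [exact: measurable_fun_ler|exact: measurable_fun_ltr].
by rewrite integral_circle -EFinM; congr EFin; field.
Qed.

Lemma prod_EFin n (F : 'I_n -> R) : \prod_i (F i)%:E = (\prod_i F i)%:E.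
Proof. by elim/big_rec2 : _ => // i x y _ ->; rewrite EFinM. Qed.

(* The Gaussian integral of |z^al|^2 is computed coordinatewise and radially. *)
Lemma sphere_momentE n (al : 'rV[nat]_n.+1) :
  sphere_moment al =
  (2 * pi ^+ n.+1 * (mi_fact al)%:R / ((n + mi_abs al)`!)%:R)%:E.
Proof.
have gauss : \int[powm (lebC R) n.+1]_z
    (expR (- cnorm z ^+ 2) * monomial_normsq z al)%:E =
    (pi ^+ n.+1 * (mi_fact al)%:R)%:E.
  transitivity (\int[powm (lebC R) n.+1]_z (\prod_i
      (expR (- Normc.normc (z ord0 i) ^+ 2) *
       Normc.normc (z ord0 i) ^+ (2 * al ord0 i)))%:E).
    apply: eq_integral => z _; rewrite big_split/=; congr (_ * _)%:E.
    by rewrite cnorm_sqr -sumrN expR_sum.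
  rewrite (integral_powm_prod (lebC R)
    (h := fun i z => expR (- Normc.normc z ^+ 2) * Normc.normc z ^+ (2 * al ord0 i))%R).
  - under eq_bigr do rewrite integral_lebC_gauss.
    by rewrite prod_EFin big_split/= prodr_const card_ord /mi_fact natr_prod.
  - move=> i; have mn : measurable_fun setT (fun z : R[i] => Normc.normc z).
      by apply: measurable_normc; exact: measurable_id.
    by apply: measurable_funM; [exact: measurable_expRN_sqr|exact: measurable_funX].
  - by move=> i z; rewrite mulr_ge0 ?expR_ge0// exprn_ge0// normc_ge0.
have mE : measurable_fun setT (fun r : R => expR (- r ^+ 2)).
  exact: (measurable_expRN_sqr (@measurable_id _ R setT)).
have := integral_radial_monomial al mE (fun r => expR_ge0 _); rewrite gauss.
under eq_integral do rewrite mulrA.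
rewrite integral_gauss_odd => E.
have f0 : (0 < (n + mi_abs al)`!%:R :> R)%R by rewrite ltr0n fact_gt0.
(* The moment is not yet known to be finite, so the finite nonzero factor is not cancelled but
   multiplied by its inverse. *)
have -> : sphere_moment al = sphere_moment al * ((n + mi_abs al)`!%:R / 2)%:E *
    (2 / (n + mi_abs al)`!%:R)%:E.
  rewrite -muleA -EFinM -[LHS]mule1; congr (_ * _%:E).
  by field; rewrite gt_eqF.
by rewrite -E -EFinM; congr EFin; field; rewrite gt_eqF.
Qed.

Lemma integral_radial_block k (al : 'rV[nat]_k) (phi : R -> R) : (0 < k)%N ->
  measurable_fun setT phi -> (forall r, (0 <= phi r)%R) ->
  \int[powm (lebC R) k]_z (phi (cnorm z) * monomial_normsq z al)%:E =
  (2 * pi ^+ k * (mi_fact al)%:R / ((k + mi_abs al - 1)`!)%:R)%:E *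
  \int[lebR R]_r
    (phi r * (r ^+ (2 * k + 2 * mi_abs al - 1) * (0 < r)%R%:R))%:E.
Proof.
case: k al => // n al _ mphi phi0.
have -> : (n.+1 + mi_abs al - 1 = n + mi_abs al)%N by rewrite addSn subn1.
have -> : (2 * n.+1 + 2 * mi_abs al - 1 = 2 * (n + mi_abs al) + 1)%N.
  by rewrite mulnS mulnDr -addnA addSn add1n subn1 addn1.
by rewrite integral_radial_monomial// sphere_momentE.
Qed.

End radial_monomials.

(** * All blocks simultaneously *)

Section row_boxes.
Context d1 d2 (T : measurableType d1) (Y : measurableType d2) (R : realType).
Variable n : nat.

(** Only the radii have to factor by coordinates; the directions of block j stay in one arbitrary
    measurable set [B]. *)
Definition row_box (A : 'I_n -> set T) (B : set Y) : set ('rV[T]_n * Y) :=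
  [set p : 'rV[T]_n * Y | (forall i, A i (p.1 ord0 i)) /\ B p.2].

Definition row_boxes : set (set ('rV[T]_n * Y)) :=
  [set S | exists A B, [/\ forall i, measurable (A i), measurable B & S = row_box A B]].

Lemma measurable_row_box A B : (forall i, measurable (A i)) -> measurable B ->
  measurable (row_box A B).
Proof.
move=> mA mB; rewrite (_ : row_box A B =
  (\bigcap_(i in [set: 'I_n]) ((fun p : 'rV[T]_n * Y => p.1 ord0 i) @^-1` A i)) `&`
  (snd @^-1` B)); last first.
  apply/seteqP; split=> p /=; first by move=> [pA pB]; split => // i _; exact: pA.
  by move=> [pA pB]; split => // i; exact: pA.
apply: measurableI.
  apply: fin_bigcap_measurable => // i _; rewrite -[X in measurable X]setTI.
  by apply: (measurableT_comp (measurable_coord i) measurable_fst).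
by rewrite -[X in measurable X]setTI; exact: measurable_snd.
Qed.

(** For the inclusion into the generated sigma-algebra it suffices that the identity is measurable
    from it, and this is tested on each coordinate and on the second component. *)
Lemma measurable_row_boxes : @measurable _ ('rV[T]_n * Y)%type = <<s row_boxes >>.
Proof.
apply/seteqP; split; last first.
  apply: smallest_sub; first exact: sigma_algebra_measurable.
  by move=> _ [A [B [mA mB ->]]]; exact: measurable_row_box.
pose TT := g_sigma_algebraType row_boxes.
have mcoord i : measurable_fun setT (fun p : TT => (p : 'rV[T]_n * Y).1 ord0 i).
  move=> _ A mA; rewrite setTI; apply: sub_sigma_algebra.
  exists (fun l => if l == i then A else setT), setT; split => //.
    by move=> l; case: ifP.
  apply/seteqP; split => p /=; last by move=> [/(_ i)]; rewrite eqxx.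
  by move=> pA; split => // l; case: eqP => // ->.
have msnd : measurable_fun setT (fun p : TT => (p : 'rV[T]_n * Y).2).
  move=> _ B mB; rewrite setTI; apply: sub_sigma_algebra.
  exists (fun=> setT), B; split => //.
  by apply/seteqP; split => p /=; [move=> pB; split|move=> []].
have mid : measurable_fun setT (fun p : TT => (p : 'rV[T]_n * Y)).
  apply/measurable_fun_pairP; split => //=.
  exact/measurable_fun_rowP.
by move=> S mS; have := mid measurableT S mS; rewrite setTI.
Qed.

(** Boxes are closed under intersection. The total mass may be infinite, hence the exhaustion by the
    boxes over [E]. *)
Lemma row_prod_measure_unique (m1 m2 : {measure set ('rV[T]_n * Y) -> \bar R})
    (E : nat -> set T) :
  (forall i, measurable (E i)) ->
  (forall i l, (i <= l)%N -> E i `<=` E l) -> \bigcup_i E i = setT ->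
  (forall A B, (forall i, measurable (A i)) -> measurable B ->
    m1 (row_box A B) = m2 (row_box A B)) ->
  (forall N, (m1 (row_box (fun=> E N) setT) < +oo)%E) ->
  forall S, measurable S -> m1 S = m2 S.
Proof.
move=> mE ndE UE m12 m1oo.
apply: (measure_unique row_boxes (fun N => row_box (fun=> E N) setT)) => //.
- exact: measurable_row_boxes.
- move=> _ _ [A [B [mA mB ->]]] [A' [B' [mA' mB' ->]]].
  exists (fun i => A i `&` A' i), (B `&` B'); split.
  + by move=> i; exact: measurableI.
  + exact: measurableI.
  + apply/seteqP; split => p /=.
      by move=> [[pA pB] [pA' pB']]; split.
    by move=> [pA [pB pB']]; split; split => // i; have [] := pA i.
- by move=> N; exists (fun=> E N), setT; split.
- apply/seteqP; split => // p _.
  have ex i : exists N, E N (p.1 ord0 i).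
    have : (\bigcup_i E i) (p.1 ord0 i) by rewrite UE.
    by move=> [N _ EN]; exists N.
  have [N EN] := choice ex.
  (* There are finitely many coordinates, so the largest index serves for all. *)
  exists (\max_i N i)%N => //; split => // i.
  by apply: ndE (EN i); exact: leq_bigmax.
- by move=> _ [A [B [mA mB ->]]]; exact: m12.
Qed.

End row_boxes.

(** Gives block [j] an integrand of its own. The function spaces depend on l, so a transport along j
    = l is needed; at l = j it is trivial because equality on [I] is decidable. *)
Lemma dependent_update (I : eqType) (T : I -> Type) (j : I) (d : forall l, T l)
    (b : T j) : exists f : forall l, T l, f j = b /\ forall l, l != j -> f l = d l.
Proof.
exists (fun l => match @eqP _ j l with
  | ReflectT e => eq_rect j T b l e | ReflectF _ => d l end).
split; first by case: eqP => // e; rewrite (eq_axiomK e).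
by move=> l lj; case: eqP => // jl; rewrite jl eqxx in lj.
Qed.

Section one_block.
Variable R : realType.
Local Open Scope ereal_scope.

(** The computation for block j, where the directions are tested by a set instead of being
    integrated against a monomial. *)
Lemma integral_block_box k (A : set R) (B : set ('rV[R]_k * 'rV[R[i]]_k)) :
  (0 < k)%N -> measurable A -> measurable B ->
  \int[powm (lebC R) k]_z (\1_A (cnorm z) * \1_B (sdir z, tdir z))%:E =
  \int[lebR R]_r (\1_A r * (r ^+ (2 * k - 1) * (0 < r)%R%:R))%:E *
  \int[sprod (sphere_measure R k) (haar_torus R k)]_p (\1_B p * pos_prod p.1)%:E.
Proof.
case: k B => // n B _ mA mB.
have -> : (2 * n.+1 - 1 = 2 * n + 1)%N by rewrite mulnS addnC addn2 subn1 addn1.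
have w0 (r : R) : 0 <= (\1_A r * (r ^+ (2 * n + 1) * (0 < r)%R%:R))%:E.
  rewrite lee_fin; case: ltP => [r0|_]; last by rewrite !mulr0.
  by rewrite mulr1 mulr_ge0// exprn_ge0// ltW.
have mindB : measurable_fun setT (fun p => \1_B p : R) by exact: measurable_indic.
have mindA : measurable_fun setT (fun p => \1_A p : R) by exact: measurable_indic.
have v0 (p : 'rV[R]_n.+1 * 'rV[R[i]]_n.+1) : 0 <= (\1_B p * pos_prod p.1)%:E.
  by rewrite lee_fin mulr_ge0 ?pos_prod_ge0.
have mv : measurable_fun setT (fun p : 'rV[R]_n.+1 * 'rV[R[i]]_n.+1 =>
    (\1_B p * pos_prod p.1)%:E).
  apply/measurable_EFinP; apply: measurable_funM => //.
  exact: (measurableT_comp (@measurable_pos_prod R _) measurable_fst).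
rewrite (@integral_powC_polar _ n (fun p => (\1_A p.1 * \1_B p.2)%:E)); last 2 first.
- apply/measurable_EFinP; apply: measurable_funM.
    exact: (measurableT_comp mindA measurable_fst).
  exact: (measurableT_comp mindB measurable_snd).
- by move=> p; rewrite lee_fin mulr_ge0.
rewrite ge0_integral_sprod// -ge0_integralZr//; last 2 first.
- apply/measurable_EFinP; apply: measurable_funM => //; apply: measurable_funM.
    exact: measurable_funX.
  by apply: measurable_natr; exact: measurable_fun_ltr.
- by apply: integral_ge0 => s _; exact: integral_ge0.
apply: eq_integral => r _; rewrite -ge0_integralZl//; last 2 first.
- exact: (@measurable_integral1 _ _ _ _ _ (haar_torus R n.+1) _ mv v0).
- by move=> s _; exact: integral_ge0.
apply: eq_integral => s _; rewrite -ge0_integralZl//.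
- by apply: eq_integral => t _; rewrite -!EFinM; congr EFin => /=; ring.
- apply: (measurableT_comp mv).
  by apply: measurable_fun_pair; [exact: measurable_cst|exact: measurable_id].
Qed.

(** The indicator of ]-N, N] is at most e^(N^2) e^(-r^2), and the odd Gaussian moments are
    finite. *)
Lemma integral_odd_power_bounded (N p : nat) :
  \int[lebR R]_r (\1_(`](- N%:R)%R, N%:R%R]) r * (r ^+ (2 * p + 1) * (0 < r)%R%:R))%:E < +oo.
Proof.
have w0 (r : R) : (0 <= r ^+ (2 * p + 1) * (0 < r)%R%:R)%R.
  case: ltP => [r0|_]; last by rewrite mulr0.
  by rewrite mulr1 exprn_ge0// ltW.
have mw : measurable_fun setT (fun r : R => r ^+ (2 * p + 1) * (0 < r)%R%:R)%R.
  apply: measurable_funM; first exact: measurable_funX.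
  by apply: measurable_natr; exact: measurable_fun_ltr.
have mE : measurable_fun setT (fun r : R => expR (- r ^+ 2)).
  exact: (measurable_expRN_sqr (@measurable_id _ R setT)).
apply: (@le_lt_trans _ _ ((expR (N%:R ^+ 2))%:E * \int[lebR R]_r
    (expR (- r ^+ 2) * r ^+ (2 * p + 1) * (0 < r)%R%:R)%:E)); last first.
  by rewrite integral_gauss_odd -EFinM ltry.
have me : measurable_fun setT (fun r : R =>
    (expR (- r ^+ 2) * r ^+ (2 * p + 1) * (0 < r)%R%:R)%:E).
  apply/measurable_EFinP.
  by under eq_fun do rewrite -mulrA; exact: measurable_funM.
have e0 (r : R) : 0 <= (expR (- r ^+ 2) * r ^+ (2 * p + 1) * (0 < r)%R%:R)%:E.
  by rewrite lee_fin -mulrA mulr_ge0 ?expR_ge0.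
rewrite -ge0_integralZl//.
apply: ge0_le_integral => //.
- by move=> r _; rewrite lee_fin mulr_ge0.
- apply/measurable_EFinP; apply: measurable_funM => //; exact: measurable_indic.
- by apply: emeasurable_funM => //; exact: measurable_cst.
move=> r _; rewrite -EFinM lee_fin -(mulrA (expR (- r ^+ 2))) [leRHS]mulrA ler_wpM2r// -expRD.
rewrite indicE; case: (boolP (r \in _)) => [|_]; last by rewrite expR_ge0.
rewrite inE/= in_itv/= => /andP[Nr rN].
have {}Nr : (- (N%:R : R) <= r)%R := ltW Nr.
rewrite -[X in (X <= _)%R]expR0 ler_expR subr_sqr mulr_ge0//; lra.
Qed.

End one_block.

Lemma mi_fact_gt0 p (al : 'rV[nat]_p) : (0 < mi_fact al)%N.
Proof. by apply: prodn_gt0 => i; exact: fact_gt0. Qed.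

Section all_blocks.
Variables (R : realType) (m : nat) (k : 'I_m -> nat) (j : 'I_m).
Variable al : forall l, 'rV[nat]_(k l).
Hypothesis k0 : forall l, (0 < k l)%N.
Local Open Scope ereal_scope.
Local Notation target := ('rV[R]_m * ('rV[R]_(k j) * 'rV[R[i]]_(k j)))%type.

(* In the block j only the Jacobian appears: the directions, hence the
   monomials, are not integrated out. *)
Definition radial_exponent l : nat :=
  (if l == j then 2 * k l - 1 else 2 * k l + 2 * mi_abs (al l) - 1)%N.

Definition radial_weight l (r : R) : R := (r ^+ radial_exponent l * (0 < r)%R%:R)%R.

(** The value of [sphere_moment] for block l, where k_l = n + 1. *)
Definition block_const l : R :=
  (2 * pi ^+ k l * (mi_fact (al l))%:R / ((k l + mi_abs (al l) - 1)`!)%:R)%R.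

Definition blocks_const : R := (\prod_(l | l != j) block_const l)%R.

Definition polar_density (p : target) : R :=
  (blocks_const * (\prod_l radial_weight l (p.1 ord0 l)) * pos_prod p.2.1)%R.

(** The factor of z^alpha times the conjugate of z^beta that depends on directions which
    [blocks_map] forgets. It acts as a density and is integrated out. *)
Definition blocks_weight (z : 'rV[R[i]]_(\sum_l k l)) : R :=
  (\prod_(l | l != j) monomial_normsq (submxrow z l) (al l))%R.

Definition blocks_map (z : 'rV[R[i]]_(\sum_l k l)) : target :=
  (block_norms z, (sdir (submxrow z j), tdir (submxrow z j))).

Lemma radial_weight_ge0 l r : (0 <= radial_weight l r)%R.
Proof.
rewrite /radial_weight; case: ltP => [r0|_]; last by rewrite mulr0.
by rewrite mulr1 exprn_ge0// ltW.
Qed.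

Lemma measurable_radial_weight l : measurable_fun setT (radial_weight l).
Proof.
apply: measurable_funM; first exact: measurable_funX.
by apply: measurable_natr; exact: measurable_fun_ltr.
Qed.

Lemma block_const_gt0 l : (0 < block_const l)%R.
Proof.
by rewrite divr_gt0 ?mulr_gt0 ?exprn_gt0 ?pi_gt0// ltr0n ?mi_fact_gt0 ?fact_gt0.
Qed.

Lemma blocks_const_gt0 : (0 < blocks_const)%R.
Proof. by apply: prodr_gt0 => l _; exact: block_const_gt0. Qed.

Lemma blocks_const_ge0 : (0 <= blocks_const)%R.
Proof. exact: ltW blocks_const_gt0. Qed.

Lemma polar_density_ge0 p : (0 <= polar_density p)%R.
Proof.
rewrite !mulr_ge0 ?blocks_const_ge0 ?pos_prod_ge0// prodr_ge0// => l _.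
exact: radial_weight_ge0.
Qed.

Lemma measurable_polar_density : measurable_fun setT polar_density.
Proof.
apply: measurable_funM; last first.
  apply: (measurableT_comp (@measurable_pos_prod R _)).
  exact: (measurableT_comp measurable_fst measurable_snd).
apply: measurable_funM => //; apply: measurable_prod => l _.
apply: (measurableT_comp (measurable_radial_weight l)).
exact: (measurableT_comp (measurable_coord l) measurable_fst).
Qed.

Lemma blocks_weight_ge0 z : (0 <= blocks_weight z)%R.
Proof. by apply: prodr_ge0 => l _; exact: monomial_normsq_ge0. Qed.

Lemma measurable_blocks_weight : measurable_fun setT blocks_weight.
Proof.
apply: (eq_measurable_fun (fun z =>
    \prod_l (if l != j then monomial_normsq (submxrow z l) (al l) else 1))%R).
  by move=> z _; rewrite /blocks_weight [RHS]big_mkcond.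
apply: measurable_prod => l _; case: (l != j); last exact: measurable_cst.
exact: (measurableT_comp (measurable_monomial_normsq (al l)) (@measurable_submxrow _ _ _ k l)).
Qed.

Lemma measurable_block_norms : measurable_fun setT (@block_norms R m k).
Proof.
apply/measurable_fun_rowP => l.
apply: eq_measurable_fun (measurableT_comp (@measurable_cnorm R _)
  (@measurable_submxrow _ R[i] _ k l)) => z _.
by rewrite /block_norms mxE.
Qed.

Lemma measurable_blocks_map : measurable_fun setT blocks_map.
Proof.
apply: measurable_fun_pair; first exact: measurable_block_norms.
have ms := @measurable_submxrow _ R[i] _ k j.
apply: measurable_fun_pair.
  exact: (measurableT_comp (@measurable_sdir R _) ms).
exact: (measurableT_comp (@measurable_tdir R _) ms).
Qed.

Definition radial_integral (A : 'I_m -> set R) l : \bar R :=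
  \int[lebR R]_r (\1_(A l) r * radial_weight l r)%:E.

Definition angular_integral (B : set ('rV[R]_(k j) * 'rV[R[i]]_(k j))) : \bar R :=
  \int[sprod (sphere_measure R (k j)) (haar_torus R (k j))]_p (\1_B p * pos_prod p.1)%:E.

Lemma row_box_indic A B (p : target) :
  \1_(row_box A B) p = ((\prod_l \1_(A l) (p.1 ord0 l)) * \1_B p.2 : R)%R.
Proof.
rewrite !indicE; have [pB|pB] := boolP (p.2 \in B); last first.
  rewrite mulr0 (_ : _ \in _ = false)//; apply/negbTE; move: pB.
  by rewrite !notin_setE => pB [].
rewrite mulr1; have [pA|pA] := boolP [forall l, p.1 ord0 l \in A l].
  rewrite big1 ?mem_set//=; last by move=> l _; rewrite indicE (forallP pA l).
  by split; [move=> l; apply/set_mem/(forallP pA)|exact: set_mem].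
have /forallPn[l lA] := pA.
rewrite (bigD1 l)//= indicE (negbTE lA) mul0r (_ : _ \in _ = false)//.
by apply/negbTE; move: lA; rewrite !notin_setE => lA [].
Qed.

(** On a box the integrand is a product over the blocks, with a special factor at [j], so
    [integral_powm_blocks] applies. The value is the one that [integral_polar_box] finds on the
    polar side. *)
Lemma integral_vol_box A B : (forall l, measurable (A l)) -> measurable B ->
  \int[vol R (\sum_l k l)]_z (\1_(row_box A B) (blocks_map z) * blocks_weight z)%:E =
  blocks_const%:E * (\prod_l radial_integral A l) * angular_integral B.
Proof.
move=> mA mB.
have mindA l : measurable_fun setT (fun p => \1_(A l) p : R) by exact: measurable_indic.
pose hj (z : 'rV[R[i]]_(k j)) : R := (\1_(A j) (cnorm z) * \1_B (sdir z, tdir z))%R.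
have [h [hjE hE]] := dependent_update (T := fun l => 'rV[R[i]]_(k l) -> R)
  (fun l z => \1_(A l) (cnorm z) * monomial_normsq z (al l))%R hj.
transitivity (\int[powm (lebC R) (\sum_l k l)]_z (\prod_l h l (submxrow z l))%:E).
  apply: eq_integral => z _; congr EFin; rewrite row_box_indic [in RHS](bigD1 j)//=.
  rewrite hjE /hj [in LHS](bigD1 j)//= mxE -!mulrA; congr (_ * _)%R.
  rewrite mulrC -mulrA; congr (_ * _)%R; rewrite mulrC -big_split/=.
  by apply: eq_bigr => l lj; rewrite hE// mxE.
rewrite (integral_powm_blocks (lebC R)); last 2 first.
- move=> l; have [->|lj] := eqVneq l j.
    rewrite hjE; apply: measurable_funM.
      exact: (measurableT_comp (mindA j) (@measurable_cnorm R _)).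
    have mindB : measurable_fun setT (fun p => \1_B p : R) by exact: measurable_indic.
    apply: (measurableT_comp mindB).
    by apply: measurable_fun_pair; [exact: measurable_sdir|exact: measurable_tdir].
  rewrite hE//; apply: measurable_funM.
    exact: (measurableT_comp (mindA l) (@measurable_cnorm R _)).
  exact: measurable_monomial_normsq.
- move=> l z; have [lj|lj] := eqVneq l j.
    by move: z; rewrite lj hjE => z; rewrite /hj mulr_ge0.
  by rewrite hE// mulr_ge0// monomial_normsq_ge0.
rewrite (bigD1 j)//= hjE integral_block_box//.
rewrite [X in _ = _ * X * _](bigD1 j)//=.
have -> : \int[lebR R]_r (\1_(A j) r * (r ^+ (2 * k j - 1) * (0 < r)%R%:R))%:E =
    radial_integral A j by rewrite /radial_integral /radial_weight /radial_exponent eqxx.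
have -> : \prod_(l | l != j) \int[powm (lebC R) (k l)]_z (h l z)%:E =
    blocks_const%:E * \prod_(l | l != j) radial_integral A l.
  rewrite /blocks_const (big_morph EFin (@EFinM R) erefl) -big_split/=.
  apply: eq_bigr => l lj; rewrite hE//.
  rewrite (integral_radial_block (al l) (k0 l) (mindA l)) ?/radial_integral//.
  by rewrite /radial_weight /radial_exponent (negbTE lj).
by rewrite muleAC muleCA.
Qed.

Lemma integral_polar_box A B : (forall l, measurable (A l)) -> measurable B ->
  \int[polar_measure R k j]_p (\1_(row_box A B) p * polar_density p)%:E =
  blocks_const%:E * (\prod_l radial_integral A l) * angular_integral B.
Proof.
move=> mA mB.
have mindA l : measurable_fun setT (fun p => \1_(A l) p : R) by exact: measurable_indic.
rewrite /polar_measure ge0_integral_sprod; last 2 first.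
- apply/measurable_EFinP; apply: measurable_funM; last exact: measurable_polar_density.
  by apply: measurable_indic; exact: measurable_row_box.
- by move=> p; rewrite lee_fin mulr_ge0// polar_density_ge0.
have v0 (p : 'rV[R]_(k j) * 'rV[R[i]]_(k j)) : 0 <= (\1_B p * pos_prod p.1)%:E.
  by rewrite lee_fin mulr_ge0// pos_prod_ge0.
have mv : measurable_fun setT (fun p : 'rV[R]_(k j) * 'rV[R[i]]_(k j) =>
    (\1_B p * pos_prod p.1)%:E).
  apply/measurable_EFinP; apply: measurable_funM; first exact: measurable_indic.
  exact: (measurableT_comp (@measurable_pos_prod R _) measurable_fst).
have h0 l r : (0 <= \1_(A l) r * radial_weight l r)%R.
  by rewrite mulr_ge0// radial_weight_ge0.
have mh l : measurable_fun setT (fun r => \1_(A l) r * radial_weight l r)%R.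
  by apply: measurable_funM => //; exact: measurable_radial_weight.
have mprod : measurable_fun setT (fun r : 'rV[R]_m =>
    (\prod_l (\1_(A l) (r ord0 l) * radial_weight l (r ord0 l)))%R).
  apply: measurable_prod => l _.
  exact: (measurableT_comp (mh l) (measurable_coord l)).
have prod0 (r : 'rV[R]_m) :
    (0 <= \prod_l (\1_(A l) (r ord0 l) * radial_weight l (r ord0 l)))%R.
  by apply: prodr_ge0 => l _; exact: h0.
have S0 : 0 <= angular_integral B by exact: integral_ge0.
transitivity (\int[powm (lebR R) m]_r (blocks_const%:E *
  (\prod_l (\1_(A l) (r ord0 l) * radial_weight l (r ord0 l)))%:E * angular_integral B)).
  apply: eq_integral => r _; rewrite -EFinM /angular_integral -ge0_integralZl//.
  - apply: eq_integral => p _; rewrite -EFinM; congr EFin.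
    rewrite row_box_indic /polar_density /= [in RHS]big_split/=.
    by move: (\prod_l radial_weight l _)%R => w; ring.
  - by rewrite lee_fin mulr_ge0// blocks_const_ge0.
rewrite ge0_integralZr//; last 2 first.
- by apply/measurable_EFinP; exact: measurable_funM.
- by move=> r _; rewrite lee_fin mulr_ge0// blocks_const_ge0.
rewrite ge0_integralZl//; last 3 first.
- exact/measurable_EFinP.
- by move=> r _; rewrite lee_fin.
- by rewrite lee_fin blocks_const_ge0.
by rewrite (integral_powm_prod (lebR R) mh h0).
Qed.

Lemma radial_integral_ge0 A l : 0 <= radial_integral A l.
Proof.
by apply: integral_ge0 => r _; rewrite lee_fin mulr_ge0// radial_weight_ge0.
Qed.

(** Both forms of [radial_exponent] are odd because k_l >= 1, so the Gaussian bound applies. *)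
Lemma radial_integral_bounded (N : nat) l :
  radial_integral (fun=> `](- N%:R)%R, N%:R%R]%classic) l < +oo.
Proof.
rewrite /radial_integral /radial_weight.
have [p ->] : exists p, radial_exponent l = (2 * p + 1)%N.
  rewrite /radial_exponent; move: (mi_abs (al l)) (k0 l) => q.
  case: (k l) => // n _; exists (if l == j then n else n + q)%N.
  by case: ifP => _; lia.
exact: integral_odd_power_bounded.
Qed.

(** This is the sphere moment of the zero multi-index, whose value is known. *)
Lemma angular_integral_setT : angular_integral setT < +oo.
Proof.
rewrite /angular_integral; move: (k0 j); case: (k j) => // n _.
rewrite ge0_integral_sprod; last 2 first.
- apply/measurable_EFinP; apply: measurable_funM; first exact: measurable_indic.
  exact: (measurableT_comp (@measurable_pos_prod R _) measurable_fst).
- by move=> p; rewrite lee_fin mulr_ge0// pos_prod_ge0.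
have := @sphere_momentE R n 0; rewrite /sphere_moment.
have E0 (s : 'rV[R]_n.+1) : even_monomial s 0 = 1%R.
  by rewrite /even_monomial big1// => i _; rewrite mxE muln0 expr0.
under eq_integral do under eq_integral do rewrite E0 mul1r.
move=> E; apply: (@le_lt_trans _ _ (\int[sphere_measure R n.+1]_s
  \int[haar_torus R n.+1]_t (pos_prod s)%:E)); last by rewrite E ltry.
under eq_integral do under eq_integral do rewrite indicT mul1r.
by [].
Qed.

(** Each side integrates [H] against a measure on the target; the two measures agree on boxes and
    are finite on bounded ones. A general [H] is required because the symbol mixes radii and
    directions. *)
Lemma integral_blocks_polar (H : target -> \bar R) :
  measurable_fun setT H -> (forall p, 0 <= H p) ->
  \int[vol R (\sum_l k l)]_z (H (blocks_map z) * (blocks_weight z)%:E) =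
  \int[polar_measure R k j]_p (H p * (polar_density p)%:E).
Proof.
move=> mH H0.
have [m1 m1E] := image_measure_exists (vol R (\sum_l k l)) blocks_weight_ge0
  measurable_blocks_weight measurable_blocks_map.
have [m2 m2E] := image_measure_exists (polar_measure R k j) polar_density_ge0
  measurable_polar_density (@measurable_id _ target setT).
suff m12 : forall S, measurable S -> m1 S = m2 S.
  transitivity (\int[m1]_p H p).
    apply/esym/ge0_integral_image => //; [exact: blocks_weight_ge0|
      exact: measurable_blocks_weight|exact: measurable_blocks_map].
  transitivity (\int[m2]_p H p); first by apply: eq_measure_integral => S mS _; exact: m12.
  apply: ge0_integral_image => //; [exact: polar_density_ge0|
    exact: measurable_polar_density].
apply: (@row_prod_measure_unique _ _ _ _ R m m1 m2 (fun N => `](- N%:R)%R, N%:R%R]%classic)).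
- by [].
- move=> N M NM x /=; rewrite !in_itv/= => /andP[Nx xN].
  have NM' : (N%:R <= M%:R :> R)%R by rewrite ler_nat.
  by rewrite (le_trans xN NM') andbT (le_lt_trans _ Nx)// lerN2.
- exact: bigcup_itvT.
- move=> A B mA mB; have mS := measurable_row_box mA mB.
  by rewrite m1E// m2E// !integral_indic_image integral_vol_box// integral_polar_box.
- move=> N; have mS : measurable (row_box (fun _ : 'I_m => `](- N%:R)%R, N%:R%R]%classic : set R)
    (@setT ('rV[R]_(k j) * 'rV[R[i]]_(k j)))) by exact: measurable_row_box.
  rewrite m1E// integral_indic_image integral_vol_box//.
  have [P0 Poo] : 0 <= \prod_l radial_integral (fun=> `](- N%:R)%R, N%:R%R]%classic) l /\
      \prod_l radial_integral (fun=> `](- N%:R)%R, N%:R%R]%classic) l < +oo.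
    elim/big_ind : _ => [|x y [x0 xoo] [y0 yoo]|l _]; first by rewrite lee01 ltry.
      by split; [exact: mule_ge0|apply: lte_mul_pinfty; rewrite ?ge0_fin_numE].
    by split; [exact: radial_integral_ge0|exact: radial_integral_bounded].
  rewrite lte_mul_pinfty ?angular_integral_setT//.
    by rewrite mule_ge0// lee_fin blocks_const_ge0.
  rewrite ge0_fin_numE; first by rewrite lte_mul_pinfty// lee_fin blocks_const_ge0.
  by rewrite mule_ge0// lee_fin blocks_const_ge0.
Qed.

End all_blocks.

(** * The weighted Bergman space *)

Section gamma_function.
Variable R : realType.
Local Open Scope ereal_scope.

Lemma Gamma_ge0 (x : R) : (0 <= Gamma x)%R.
Proof.
apply: fine_ge0; apply: integral_ge0 => t _.
by rewrite lee_fin mulr_ge0 ?powR_ge0// expR_ge0.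
Qed.

(** [Gamma] is the real value of an extended integral, so positivity includes convergence. From
    below, the integrand is at least e^(-2) on [1, 2]; from above, t^(x-1) <= 1 + t^N for a natural
    N >= x - 1. *)
Lemma Gamma_gt0 (x : R) : (1 <= x)%R -> (0 < Gamma x)%R.
Proof.
move=> x1; pose f (t : R) : R := (t `^ (x - 1) * expR (- t))%R.
have f0 t : 0 <= (f t)%:E by rewrite lee_fin mulr_ge0 ?powR_ge0// expR_ge0.
have mf : measurable_fun setT f.
  apply: measurable_funM; first exact: measurable_powR.
  exact: continuous_measurable_fun (@continuous_expRN R).
have mfE D : measurable_fun D (EFin \o f).
  by apply/measurable_EFinP; exact: measurable_funTS.
rewrite /Gamma /Rintegral fine_gt0//; apply/andP; split.
  apply: (@lt_le_trans _ _ (\int[lebesgue_measure]_(t in `[1%R, 2%R]) (expR (- 2))%:E)).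
    rewrite integral_cst// [X in _ * X]lebesgue_measure_itv/= lte_fin ltr1n.
    by rewrite -EFinB -EFinM lte_fin mulr_gt0 ?expR_gt0// subr_gt0 ltr1n.
  apply: (@le_trans _ _ (\int[lebesgue_measure]_(t in `[1%R, 2%R]) (f t)%:E)).
    apply: ge0_le_integral => //; first exact: mfE.
    move=> t /=; rewrite in_itv/= => /andP[t1 t2].
    have p1 : (t `^ 0 <= t `^ (x - 1))%R by apply: ler_powR; rewrite ?subr_ge0.
    by rewrite powRr0 in p1; rewrite lee_fin -[leLHS]mul1r ler_pM ?expR_ge0// ler_expR lerN2.
  apply: (@ge0_subset_integral _ _ R (@lebesgue_measure R)) => //; first exact: mfE.
  by move=> t /=; rewrite !in_itv/= andbT => /andP[t1 _]; exact: lt_le_trans ltr01 t1.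
have [N xN] : exists N : nat, (x - 1 <= N%:R)%R.
  by exists (Num.truncn (x - 1)).+1; rewrite ltW// truncnS_gt.
have E (n : nat) : measurable_fun setT (fun t : R => (expR (- t) * t ^+ n)%:E * (0 < t)%R%:R%:E) /\
    forall t : R, 0 <= (expR (- t) * t ^+ n)%:E * (0 < t)%R%:R%:E.
  split.
    apply: measurable_mul_nat; first exact: measurable_fun_ltr.
    apply/measurable_EFinP; apply: measurable_funM; last exact: measurable_funX.
    exact: continuous_measurable_fun (@continuous_expRN R).
  move=> t; rewrite -EFinM lee_fin; case: ltP => [t0|_]; last by rewrite mulr0.
  by rewrite mulr1 mulr_ge0 ?expR_ge0// exprn_ge0// ltW.
have [[m0 p0] [mN pN]] := (E 0%N, E N).
apply: (@le_lt_trans _ _ (\int[lebR R]_t ((expR (- t) * t ^+ 0)%:E * (0 < t)%R%:R%:E +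
   (expR (- t) * t ^+ N)%:E * (0 < t)%R%:R%:E))); last first.
  by rewrite ge0_integralD// !integral_gamma_nat -EFinD ltry.
rewrite -integral_lebR_set//; last by move=> t _; exact: f0.
rewrite integral_mkcond; apply: ge0_le_integral => //.
- by move=> t _; apply: erestrict_ge0 => s _; exact: f0.
- by apply/(measurable_restrictT _ _).1 => //; exact: mfE.
- exact: emeasurable_funD.
move=> t _; rewrite patchE; case: ifPn => [|_]; last by rewrite adde_ge0.
rewrite inE/= in_itv/= andbT => t0; rewrite t0 !mule1 -EFinD lee_fin.
rewrite expr0 mulr1 -[X in (_ <= X + _)%R]mulr1 -mulrDr mulrC ler_pM2l ?expR_gt0//.
have [t1|t1] := leP t 1%R.
  rewrite (@le_trans _ _ 1%R)// ?lerDl ?exprn_ge0// ?(ltW t0)//.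
  have : (t `^ (x - 1) <= 1 `^ (x - 1))%R by rewrite ge0_ler_powR ?subr_ge0// ?nnegrE// ltW.
  by rewrite powR1.
rewrite (@le_trans _ _ (t ^+ N)%R)// ?lerDr//.
by rewrite -powR_mulrn ?ler_powR// ltW.
Qed.

(** With x = 1 - r^2 the question is the integral of x^lam over (0, 1), and x = e^(-v / (lam + 1))
    turns it into that of e^(-v) / (lam + 1) over v > 0; lam > -1 makes this substitution
    meaningful. *)
Lemma integral_ball_profile_lty (lam : R) : (-1 < lam)%R ->
  \int[lebR R]_r ((1 - r ^+ 2) `^ lam * (r < 1)%R%:R * (r * (0 < r)%R%:R))%:E < +oo.
Proof.
move=> lam1; have l0 : (0 < lam + 1)%R by lra.
pose h (u : R) := ((1 - u) `^ lam * (u < 1)%R%:R)%:E.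
have h0 u : 0 <= h u by rewrite lee_fin mulr_ge0// powR_ge0.
have mh : measurable_fun setT h.
  apply/measurable_EFinP; apply: measurable_funM.
    by apply: (measurableT_comp (measurable_powR lam)); exact: measurable_funB.
  by apply: measurable_natr; exact: measurable_fun_ltr.
have hb u (b : bool) : 0 <= h u * (b%:R : R)%:E by rewrite mule_ge0// lee_fin.
have mexp (c : R) : measurable_fun setT (fun v : R => expR (c * v)%R).
  apply: (measurableT_comp (continuous_measurable_fun (@continuous_expR R))).
  exact: measurable_funM.
(* Only finiteness matters, so r is replaced by the larger 2 r, the derivative of r^2. *)
apply: (@le_lt_trans _ _ (\int[lebR R]_r (h (r ^+ 2)%R * (2 * r * (0 < r)%R%:R)%:E))).
  apply: ge0_le_integral => //.
  - move=> r _; rewrite lee_fin mulr_ge0 ?polar_weight_ge0//.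
    by rewrite mulr_ge0// powR_ge0.
  - apply/measurable_EFinP; apply: measurable_funM; last first.
      by apply: measurable_funM => //; apply: measurable_natr; exact: measurable_fun_ltr.
    apply: measurable_funM; last by apply: measurable_natr; exact: measurable_fun_ltr.
    by apply: (measurableT_comp (measurable_powR lam)); exact: measurable_funB.
  - apply: emeasurable_funM; first by apply: (measurableT_comp mh); exact: measurable_funX.
    apply/measurable_EFinP; apply: measurable_funM; first exact: measurable_funM.
    by apply: measurable_natr; exact: measurable_fun_ltr.
  move=> r _; rewrite /h -EFinM lee_fin; case: (ltP 0%R r) => [r0|_]; last by rewrite !mulr0.
  have r0w := ltW r0; rewrite !mulr1 expr_lt1// ler_wpM2l ?mulr_ge0 ?powR_ge0//.
  by rewrite mulr_natl mulr2n lerDl ltW.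
rewrite -integral_half_line_sqr//.
have -> : \int[lebR R]_x (h x * (0 < x)%R%:R%:E) =
    \int[lebR R]_x ((x `^ lam * (x < 1)%R%:R)%:E * (0 < x)%R%:R%:E).
  rewrite (integral_lebR_shift 1%R)//; last first.
    by apply: measurable_mul_nat => //; exact: measurable_fun_ltr.
  rewrite integral_lebRN.
  - apply: eq_integral => x _; rewrite /h (_ : 1 - (- x + 1) = x)%R; last by ring.
    have -> : (- x + 1 < 1)%R = (0 < x)%R by apply/idP/idP => ?; lra.
    have -> : (0 < - x + 1)%R = (x < 1)%R by apply/idP/idP => ?; lra.
    by rewrite -!EFinM; congr EFin; rewrite -!mulrA; congr (_ * _)%R; rewrite mulrC.
  - apply: emeasurable_funM.
      by apply: (measurableT_comp mh); exact: measurable_funD.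
    apply/measurable_EFinP; apply: measurable_natr; apply: measurable_fun_ltr => //.
    exact: measurable_funD.
  - by move=> x; exact: hb.
rewrite integral_half_line_exp; last 2 first.
- apply/measurable_EFinP; apply: measurable_funM; first exact: measurable_powR.
  by apply: measurable_natr; exact: measurable_fun_ltr.
- by move=> x; rewrite lee_fin mulr_ge0// powR_ge0.
rewrite integral_lebRN; last 2 first.
- apply: emeasurable_funM; apply/measurable_EFinP; last first.
    exact: continuous_measurable_fun (@continuous_expR R).
  apply: measurable_funM.
    apply: (measurableT_comp (measurable_powR lam)).
    exact: continuous_measurable_fun (@continuous_expR R).
  apply: measurable_natr; apply: measurable_fun_ltr => //.
- by move=> x; rewrite -EFinM lee_fin !mulr_ge0// ?powR_ge0// expR_ge0.
have mexpN : measurable_fun setT (fun v : R => expR (- v)).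
  exact: continuous_measurable_fun (@continuous_expRN R).
rewrite (@integral_lebR_dilation _ (lam + 1)^-1); last 3 first.
- by rewrite invr_gt0.
- apply: emeasurable_funM; apply/measurable_EFinP; last exact: mexpN.
  apply: measurable_funM; first exact: (measurableT_comp (measurable_powR lam)).
  by apply: measurable_natr; exact: measurable_fun_ltr.
- by move=> x; rewrite -EFinM lee_fin !mulr_ge0// ?powR_ge0// expR_ge0.
have -> : \int[lebR R]_v ((expR (- ((lam + 1)^-1 * v)) `^ lam *
      (expR (- ((lam + 1)^-1 * v)) < 1)%R%:R)%:E * (expR (- ((lam + 1)^-1 * v)))%:E *
      ((lam + 1)^-1)%:E) =
    \int[lebR R]_v (((lam + 1)^-1)%:E * ((expR (- v) * v ^+ 0)%:E * (0 < v)%R%:R%:E)).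
  apply: eq_integral => v _; rewrite -!EFinM; congr EFin.
  have -> : (expR (- ((lam + 1)^-1 * v)) < 1)%R = (0 < v)%R.
    by rewrite -[X in (_ < X)%R]expR0 ltr_expR oppr_lt0 pmulr_rgt0// invr_gt0.
  case: (ltP 0%R v) => [v0|_]; last by rewrite !(mulr0, mul0r).
  rewrite expr0 !mulr1 mulrC; congr (_ * _)%R.
  rewrite -expRM -expRD; congr expR; field; rewrite gt_eqF//.
rewrite ge0_integralZl//.
- by rewrite integral_gamma_nat -EFinM ltry.
- apply: measurable_mul_nat; first exact: measurable_fun_ltr.
  apply/measurable_EFinP; apply: measurable_funM; last exact: measurable_funX.
  exact: mexpN.
- by move=> v _; rewrite -EFinM lee_fin; case: ltP => [v0|_];
    rewrite ?mulr0// mulr1 mulr_ge0 ?expR_ge0// exprn_ge0// ltW.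
- by rewrite lee_fin invr_ge0 ltW.
Qed.

End gamma_function.

Section complex_on_sets.
Context d (T : measurableType d) (R : realType) (D : set T).
Hypothesis mD : measurable D.
Implicit Types f g : T -> R[i].

(** Extension by 0 outside [D] reduces measurability on [D] to the whole space; the next lemmas use
    the same device. *)
Lemma measurable_complexM_on f g : measurable_fun D f -> measurable_fun D g ->
  measurable_fun D (fun x => f x * g x).
Proof.
move=> mf mg; apply: (eq_measurable_fun (fun x => (f \_ D) x * (g \_ D) x)).
  by move=> x xD; rewrite !patchE xD.
apply: measurable_funTS; apply: measurable_complexM;
  exact/(measurable_restrictT _ mD).1.
Qed.

Lemma measurable_conjc_on f : measurable_fun D f ->
  measurable_fun D (fun x => conjc (f x)).
Proof.
move=> mf; apply: (eq_measurable_fun (fun x => conjc ((f \_ D) x))).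
  by move=> x xD; rewrite !patchE xD.
apply: measurable_funTS; apply: measurable_conjc; exact/(measurable_restrictT _ mD).1.
Qed.

Lemma measurable_Re_on f : measurable_fun D f ->
  measurable_fun D (fun x => complex.Re (f x)).
Proof.
move=> mf; apply: (eq_measurable_fun (fun x => complex.Re ((f \_ D) x))).
  by move=> x xD; rewrite !patchE xD.
apply: measurable_funTS; apply: measurable_Re; exact/(measurable_restrictT _ mD).1.
Qed.

Lemma measurable_Im_on f : measurable_fun D f ->
  measurable_fun D (fun x => complex.Im (f x)).
Proof.
move=> mf; apply: (eq_measurable_fun (fun x => complex.Im ((f \_ D) x))).
  by move=> x xD; rewrite !patchE xD.
apply: measurable_funTS; apply: measurable_Im; exact/(measurable_restrictT _ mD).1.
Qed.

Lemma measurable_normc_on f : measurable_fun D f ->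
  measurable_fun D (fun x => Normc.normc (f x)).
Proof.
move=> mf; apply: (eq_measurable_fun (fun x => Normc.normc ((f \_ D) x))).
  by move=> x xD; rewrite !patchE xD.
apply: measurable_funTS; apply: measurable_normc; exact/(measurable_restrictT _ mD).1.
Qed.

End complex_on_sets.

(** * Square integrability, holomorphy and the projection *)

Section bergman_space.
Variables (R : realType) (n : nat) (lam : R).
Local Notation C := R[i].
Local Notation ball := (@cball R n).

Lemma measurable_cball : measurable ball.
Proof.
rewrite (_ : ball = (@cnorm R n) @^-1` `]-oo, 1[).
  by rewrite -[X in measurable X]setTI; exact: measurable_cnorm.
by apply/seteqP; split => z /=; rewrite in_itv.
Qed.

Lemma c_lam_ge0 : 0 <= c_lam n lam.
Proof.
by rewrite divr_ge0 ?Gamma_ge0// mulr_ge0 ?Gamma_ge0// exprn_ge0// pi_ge0.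
Qed.

Lemma weight_ge0 (z : 'rV[C]_n) : 0 <= weight lam z.
Proof. by rewrite mulr_ge0 ?c_lam_ge0// powR_ge0. Qed.

Lemma measurable_weight : measurable_fun setT (@weight R n lam).
Proof.
apply: measurable_funM => //; apply: (measurableT_comp (measurable_powR lam)).
by apply: measurable_funB => //; apply: measurable_funX; exact: measurable_cnorm.
Qed.

(** The weight is radial, so the block formula with the zero multi-index leaves one radial integral,
    and r^(2n-1) <= r on (0, 1) reduces it to [integral_ball_profile_lty]. *)
Lemma integral_weight_lty : (0 < n)%N -> -1 < lam ->
  (\int[vol R n]_(z in ball) (weight lam z)%:E < +oo)%E.
Proof.
move=> n0 lam1.
pose phi (r : R) : R := c_lam n lam * ((1 - r ^+ 2) `^ lam * (r < 1)%R%:R).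
have phi0 r : 0 <= phi r.
  by rewrite mulr_ge0 ?c_lam_ge0 ?mulr_ge0 ?powR_ge0 ?ler0n.
have mphi0 : measurable_fun setT (fun r : R => (1 - r ^+ 2) `^ lam * (r < 1)%R%:R).
  apply: measurable_funM; last by apply: measurable_natr; exact: measurable_fun_ltr.
  by apply: (measurableT_comp (measurable_powR lam)); exact: measurable_funB.
have mphi : measurable_fun setT phi by exact: measurable_funM.
have -> : (\int[vol R n]_(z in ball) (weight lam z)%:E =
    \int[powm (lebC R) n]_z (phi (cnorm z) * monomial_normsq z 0)%:E)%E.
  rewrite integral_mkcond; apply: eq_integral => z _; rewrite patchE.
  have -> : (z \in ball) = (cnorm z < 1) by apply/idP/idP; rewrite inE.
  rewrite /monomial_normsq big1 ?mulr1; last by move=> i _; rewrite mxE muln0 expr0.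
  by rewrite /phi /weight; case: ifP => _; rewrite ?mulr1// !mulr0.
rewrite integral_radial_block//; apply: lte_mul_pinfty; rewrite ?lee_fin//.
  by rewrite !(divr_ge0, mulr_ge0, exprn_ge0)// pi_ge0.
apply: (@le_lt_trans _ _ ((c_lam n lam)%:E * \int[lebR R]_r
  ((1 - r ^+ 2) `^ lam * (r < 1)%R%:R * (r * (0 < r)%R%:R))%:E)%E); last first.
  apply: lte_mul_pinfty; rewrite ?lee_fin ?c_lam_ge0//; exact: integral_ball_profile_lty.
have w0 (r : R) : 0 <= (1 - r ^+ 2) `^ lam * (r < 1)%R%:R * (r * (0 < r)%R%:R).
  by rewrite mulr_ge0 ?polar_weight_ge0// mulr_ge0 ?powR_ge0.
have mpos p : measurable_fun setT (fun r : R => r ^+ p * (0 < r)%R%:R).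
  apply: measurable_funM; first exact: measurable_funX.
  by apply: measurable_natr; exact: measurable_fun_ltr.
rewrite -ge0_integralZl//; last 3 first.
- by apply/measurable_EFinP; apply: measurable_funM => //; exact: (mpos 1%N).
- by move=> r _; rewrite lee_fin.
- by rewrite lee_fin c_lam_ge0.
apply: ge0_le_integral => //.
- move=> r _; rewrite lee_fin mulr_ge0//; case: ltP => [r0|_]; last by rewrite mulr0.
  by rewrite mulr1 exprn_ge0// ltW.
- by apply/measurable_EFinP; exact: measurable_funM.
- apply: emeasurable_funM => //; apply/measurable_EFinP.
  by apply: measurable_funM => //; exact: (mpos 1%N).
move=> r _; rewrite -EFinM lee_fin /phi.
rewrite -[leLHS]mulrA -[X in _ * X <= _]mulrA -[X in _ <= _ * X]mulrA.
apply: ler_wpM2l; first exact: c_lam_ge0.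
rewrite ler_wpM2l ?powR_ge0//; case: (ltP r 1) => [r1|_]; last by rewrite !mul0r.
case: (ltP 0 r) => [r0|_]; last by rewrite !mulr0.
rewrite !mul1r !mulr1 -[leRHS]expr1 ler_wiXn2l ?ltW//.
by rewrite /mi_abs; lia.
Qed.

Lemma normc_ge_Re (z : C) : `|complex.Re z| <= Normc.normc z.
Proof.
case: z => a b; rewrite /Normc.normc /= -sqrtr_sqr ler_wsqrtr// lerDl sqr_ge0 //.
Qed.

Lemma normc_ge_Im (z : C) : `|complex.Im z| <= Normc.normc z.
Proof.
case: z => a b; rewrite /Normc.normc /= -sqrtr_sqr ler_wsqrtr// lerDr sqr_ge0 //.
Qed.

Lemma normc_conj (z : C) : Normc.normc (conjc z) = Normc.normc z.
Proof. by case: z => a b; rewrite /Normc.normc /= sqrrN. Qed.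

(** [P] stands for the real or the imaginary part. The bound is |f| |h| <= |f|^2 + |h|^2, multiplied
    by the weight. *)
Lemma inner_integrable (f h : 'rV[C]_n -> C) (P : C -> R) :
  (forall z, `|P z| <= Normc.normc z) ->
  (forall g : 'rV[C]_n -> C, measurable_fun ball g ->
     measurable_fun ball (fun z => P (g z))) ->
  L2_lam lam f -> L2_lam lam h ->
  (vol R n).-integrable ball
    (EFin \o (fun z => P (f z * conjc (h z) * (weight lam z)%:C))).
Proof.
move=> Ple mP [mf f2] [mh h2]; have mB := measurable_cball.
have mw D : measurable_fun D (@weight R n lam) by apply: measurable_funTS; exact: measurable_weight.
pose b (g : 'rV[C]_n -> C) z := (Normc.normc (g z) ^+ 2 * weight lam z)%:E.
have mb g : measurable_fun ball g -> measurable_fun ball (b g).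
  move=> mg; apply/measurable_EFinP; apply: measurable_funM => //.
  by apply: measurable_funX; exact: measurable_normc_on.
have b0 g z : (0 <= b g z)%E by rewrite lee_fin mulr_ge0 ?sqr_ge0// weight_ge0.
have ib g : measurable_fun ball g -> (\int[vol R n]_(z in ball) b g z < +oo)%E ->
    (vol R n).-integrable ball (b g).
  move=> mg g2; apply/integrableP; split; first exact: mb.
  by under eq_integral do rewrite gee0_abs//.
apply: (@le_integrable _ _ _ _ _ mB _ (fun z => b f z + b h z)%E).
- apply/measurable_EFinP; apply: mP; apply: measurable_complexM_on => //.
    by apply: measurable_complexM_on => //; exact: measurable_conjc_on.
  by apply: measurable_funTS; apply: measurable_real_complex; exact: measurable_weight.
- move=> z _ /=; rewrite lee_fin [leRHS]ger0_norm; last first.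
    by rewrite addr_ge0// mulr_ge0 ?sqr_ge0 ?weight_ge0.
  apply: (le_trans (Ple _)).
  rewrite !Normc.normcM normc_conj normc_real ger0_norm ?weight_ge0//.
  rewrite -mulrDl ler_wpM2r ?weight_ge0//.
  by have := normc_ge0 (f z); have := normc_ge0 (h z); nra.
- by apply: integrableD => //; exact: ib.
Qed.

(** Square integrability makes each term integrable, which additivity of the real-valued integral
    requires. *)
Lemma inner_subl (f1 f2 h : 'rV[C]_n -> C) :
  L2_lam lam f1 -> L2_lam lam f2 -> L2_lam lam h ->
  inner lam (fun z => f1 z - f2 z) h = inner lam f1 h - inner lam f2 h.
Proof.
move=> l1 l2 lh; have mB := measurable_cball; rewrite /inner /Cintegral.
have iR f : L2_lam lam f -> _ := fun lf => inner_integrable normc_ge_Re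
  (@measurable_Re_on _ _ R _ mB) lf lh.
have iI f : L2_lam lam f -> _ := fun lf => inner_integrable normc_ge_Im
  (@measurable_Im_on _ _ R _ mB) lf lh.
have cB (p q r s : R) : (p +i* q) - (r +i* s) = (p - r) +i* (q - s) by [].
rewrite cB; congr (_ +i* _).
  rewrite -(RintegralB mB (iR _ l1) (iR _ l2)); congr Rintegral; apply/funext => z.
  by rewrite !mulrBl; case: (f1 z * _ * _) => a b; case: (f2 z * _ * _).
rewrite -(RintegralB mB (iI _ l1) (iI _ l2)); congr Rintegral; apply/funext => z.
by rewrite !mulrBl; case: (f1 z * _ * _) => a b; case: (f2 z * _ * _).
Qed.

Lemma measurable_monomial (al : 'rV[nat]_n) :
  measurable_fun setT (fun z : 'rV[C]_n => monomial z al).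
Proof.
apply: measurable_complex_prod => i; apply: measurable_complexX.
exact: measurable_coord.
Qed.

Lemma measurable_ebasis (al : 'rV[nat]_n) : measurable_fun setT (@ebasis R n lam al).
Proof.
by apply: measurable_complexM; [exact: measurable_cst|exact: measurable_monomial].
Qed.

Lemma normc_prod I (s : seq I) (F : I -> C) :
  Normc.normc (\prod_(i <- s) F i) = \prod_(i <- s) Normc.normc (F i).
Proof.
elim: s => [|i s IH]; first by rewrite !big_nil Normc.normc1.
by rewrite !big_cons Normc.normcM IH.
Qed.

Lemma normcX (z : C) p : Normc.normc (z ^+ p) = Normc.normc z ^+ p.
Proof.
by elim: p => [|p IH]; rewrite ?expr0 ?Normc.normc1// !exprS Normc.normcM IH.
Qed.

Lemma normc_monomial_le1 (z : 'rV[C]_n) al : ball z -> Normc.normc (monomial z al) <= 1.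
Proof.
move=> z1; rewrite normc_prod; apply: prodr_ile1 => i _; rewrite normcX.
rewrite exprn_ge0 ?normc_ge0//= exprn_ile1 ?normc_ge0//.
exact: le_trans (normc_le_cnorm z i) (ltW z1).
Qed.

(** Monomials have modulus at most 1 on the ball, so a e_al is bounded almost everywhere there, and
    the weight has finite mass. *)
Lemma L2_bounded_ebasis (a : 'rV[C]_n -> C) (al : 'rV[nat]_n) :
  (0 < n)%N -> -1 < lam -> Linfty (vol R n) ball a ->
  L2_lam lam (fun z => a z * ebasis lam al z).
Proof.
move=> n0 lam1 [ma [M aM]]; have mB := measurable_cball.
have me D : measurable_fun D (@ebasis R n lam al).
  by apply: measurable_funTS; exact: measurable_ebasis.
split; first exact: measurable_complexM_on.
rewrite /ebasis; set s := Num.sqrt _.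
have mw D : measurable_fun D (@weight R n lam) by apply: measurable_funTS; exact: measurable_weight.
apply: (@le_lt_trans _ _ (\int[vol R n]_(z in ball) (((M * s) ^+ 2)%:E * (weight lam z)%:E))%E).
  apply: ae_ge0_le_integral => //.
  - by move=> z _; rewrite lee_fin mulr_ge0 ?sqr_ge0// weight_ge0.
  - apply/measurable_EFinP; apply: measurable_funM => //; apply: measurable_funX.
    by apply: measurable_normc_on => //; exact: measurable_complexM_on.
  - by move=> z _; rewrite -EFinM lee_fin mulr_ge0 ?sqr_ge0// weight_ge0.
  - by apply: emeasurable_funM => //; exact/measurable_EFinP.
  apply: filterS aM => z aM zB; rewrite -EFinM lee_fin ler_wpM2r ?weight_ge0//.
  rewrite !Normc.normcM normc_real ger0_norm ?sqrtr_ge0//.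
  have h1 := normc_monomial_le1 al zB; have h2 := aM zB.
  have s0 : 0 <= s := sqrtr_ge0 _.
  have a0 := normc_ge0 (a z); have m0 := normc_ge0 (monomial z al).
  have sm : s * Normc.normc (monomial z al) <= s.
    by rewrite -[leRHS]mulr1 ler_wpM2l.
  by rewrite lerXn2r ?nnegrE ?ler_pM ?mulr_ge0// (le_trans a0).
rewrite (@ge0_integralZl _ _ _ (vol R n) _ mB (fun z => (weight lam z)%:E))//.
- apply: lte_mul_pinfty; [by rewrite lee_fin sqr_ge0|by []|exact: integral_weight_lty].
- exact/measurable_EFinP.
- by move=> z _; rewrite lee_fin weight_ge0.
- by rewrite lee_fin sqr_ge0.
Qed.

Lemma holomorphic_ebasis (al : 'rV[nat]_n) : holomorphic (@ebasis R n lam al).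
Proof.
move=> z _; set K : numFieldType := C.
suff D s : differentiable ((fun z => \prod_(i <- s) z ord0 i ^+ al ord0 i) :
    'rV[K]_n -> K^o) z.
  apply: differentiableM; [exact: differentiable_cst|exact: D].
elim: s => [|i s IH].
  have -> : ((fun z => \prod_(i <- [::]) z ord0 i ^+ al ord0 i) : 'rV[K]_n -> K^o)
      = cst 1 by apply/funext => w; rewrite big_nil.
  exact: differentiable_cst.
have -> : ((fun z => \prod_(l <- i :: s) z ord0 l ^+ al ord0 l) : 'rV[K]_n -> K^o)
    = (fun w => (w ord0 i : K^o) ^+ al ord0 i) * (fun w => \prod_(l <- s) w ord0 l ^+ al ord0 l).
  by apply/funext => w; rewrite big_cons.
apply: differentiableM => //; case: (al ord0 i) => [|p].
  have -> : (fun w : 'rV[K]_n => (w ord0 i : K^o) ^+ 0) = cst 1 by [].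
  exact: differentiable_cst.
have -> : (fun w : 'rV[K]_n => (w ord0 i : K^o) ^+ p.+1) =
    (fun w : 'rV[K]_n => w ord0 i : K^o) ^+ p.+1.
  by apply/funext => w; rewrite exprfctE.
apply: differentiableX; exact: differentiable_coord.
Qed.

Lemma bergman_ebasis (al : 'rV[nat]_n) : (0 < n)%N -> -1 < lam ->
  bergman lam (@ebasis R n lam al).
Proof.
move=> n0 lam1; split; last exact: holomorphic_ebasis.
have L : Linfty (vol R n) ball (cst (1 : C)).
  split; first exact: measurable_cst.
  by exists 1; apply: aeW => z _; rewrite /cst Normc.normc1.
have := L2_bounded_ebasis al n0 lam1 L.
by under [X in L2_lam _ X]eq_fun do rewrite mul1r.
Qed.

(** Orthogonality is known for h - B h, where h = a e_al; it splits because both h and B h are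
    square integrable. *)
Lemma inner_toeplitz (B : ('rV[C]_n -> C) -> ('rV[C]_n -> C)) (a : 'rV[C]_n -> C) al be :
  (0 < n)%N -> -1 < lam -> bergman_projection lam B -> Linfty (vol R n) ball a ->
  inner lam (toeplitz B a (ebasis lam al)) (ebasis lam be) =
  inner lam (fun z => a z * ebasis lam al z) (ebasis lam be).
Proof.
move=> n0 lam1 pB aL; have La := L2_bounded_ebasis al n0 lam1 aL.
have bb := bergman_ebasis be n0 lam1; have [[LB _] /(_ _ bb)] := pB _ La.
by rewrite inner_subl//; [move/subr0_eq => <-|case: bb].
Qed.

End bergman_space.

(** * The coefficient formula *)

Section complex_integrals.
Context d (T : measurableType d) (R : realType) (mu : {measure set T -> \bar R}).
Implicit Types (D : set T) (f g : T -> R[i]).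

Lemma Cintegral_mkcond D f : Cintegral mu D f = Cintegral mu setT (f \_ D).
Proof.
congr (_ +i* _); rewrite Rintegral_mkcond; apply: eq_Rintegral => x _;
by rewrite !patchE; case: ifP.
Qed.

Lemma ae_eq_Cintegral D f g : measurable D ->
  measurable_fun D f -> measurable_fun D g ->
  {ae mu, forall x, D x -> f x = g x} -> Cintegral mu D f = Cintegral mu D g.
Proof.
move=> mD mf mg fg; congr (_ +i* _); congr fine; apply: ae_eq_integral => //.
- by apply/measurable_EFinP; exact: measurable_Re_on.
- by apply/measurable_EFinP; exact: measurable_Re_on.
- by apply: filterS fg => x fg /fg ->.
- by apply/measurable_EFinP; exact: measurable_Im_on.
- by apply/measurable_EFinP; exact: measurable_Im_on.
- by apply: filterS fg => x fg /fg ->.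
Qed.

Lemma complex_real_mulE (c : R) (z : R[i]) :
  c%:C * z = (c * complex.Re z) +i* (c * complex.Im z).
Proof. by case: z => x y; rewrite complex_mulE /= !mul0r subr0 addr0. Qed.

(* No integrability is assumed: if one of the two parts of the integral is
   infinite, both sides are the junk value 0. *)
Lemma Rintegral_scale (c : R) (f : T -> R) : 0 <= c -> measurable_fun setT f ->
  \int[mu]_x (c * f x) = c * \int[mu]_x f x.
Proof.
rewrite le_eqVlt => /orP[/eqP <- _|c0 mf].
  by rewrite mul0r /Rintegral; under eq_integral do rewrite mul0r; rewrite integral0.
have mE : measurable_fun setT (EFin \o f) by exact/measurable_EFinP.
have maxM (x : R) : (maxe (c * x)%R%:E 0 = c%:E * maxe x%:E 0)%E.
  by rewrite -!EFin_max -EFinM maxr_pMr ?mulr0 ?ltW.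
have maxMN (x : R) : (maxe (- (c * x)%R%:E) 0 = c%:E * maxe (- x%:E) 0)%E.
  by rewrite -!EFinN -mulrN maxM.
rewrite /Rintegral integralE [X in c * fine X]integralE.
under eq_integral do rewrite funeposE /= maxM -[maxe _ _](funeposE (EFin \o f)).
under [X in (_ - X)%E]eq_integral do rewrite funenegE /= maxMN -[maxe _ _](funenegE (EFin \o f)).
rewrite (@ge0_integralZl _ _ _ mu _ measurableT (EFin \o f)^\+%E) ?lee_fin ?ltW//; last first.
  exact: measurable_funepos.
rewrite (@ge0_integralZl _ _ _ mu _ measurableT (EFin \o f)^\-%E) ?lee_fin ?ltW//; last first.
  exact: measurable_funeneg.
move: (integral _ _ _) (integral _ _ _) => [p| |] [q| |] //=;
  rewrite ?mulr0 ?(gt0_muley, gt0_muleNy) ?lte_fin//= ?mulr0//.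
by rewrite mulrBr.
Qed.

Lemma Cintegral_scale (c : R) f : 0 <= c -> measurable_fun setT f ->
  Cintegral mu setT (fun x => c%:C * f x) = c%:C * Cintegral mu setT f.
Proof.
move=> c0 mf; rewrite complex_real_mulE /Cintegral /=.
rewrite -!Rintegral_scale//; [|exact: measurable_Im|exact: measurable_Re].
by congr (_ +i* _); apply: eq_Rintegral => x _; rewrite complex_real_mulE.
Qed.

End complex_integrals.

Section transfer.
Variables (R : realType) (m : nat) (k : 'I_m -> nat) (j : 'I_m).
Variable al : forall l, 'rV[nat]_(k l).
Hypothesis k0 : forall l, (0 < k l)%N.
Local Notation target := ('rV[R]_m * ('rV[R]_(k j) * 'rV[R[i]]_(k j)))%type.

(** The weights are nonnegative, so they pass through positive and negative parts. The extended
    integrals agree before [fine] is taken, hence also when they are infinite. *)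
Lemma Rintegral_blocks_polar (H : target -> R) : measurable_fun setT H ->
  \int[vol R (\sum_l k l)]_z (H (blocks_map j z) * blocks_weight j al z) =
  \int[polar_measure R k j]_p (H p * polar_density al p).
Proof.
move=> mH.
have mpos : measurable_fun setT (EFin \o H)^\+%E.
  by apply: measurable_funepos; exact/measurable_EFinP.
have mneg : measurable_fun setT (EFin \o H)^\-%E.
  by apply: measurable_funeneg; exact/measurable_EFinP.
have posM (x w : R) : 0 <= w -> (maxe (x * w)%:E 0 = maxe x%:E 0 * w%:E)%E.
  by move=> w0; rewrite -!EFin_max -EFinM maxr_pMl ?mul0r.
have negM (x w : R) : 0 <= w -> (maxe (- (x * w)%:E) 0 = maxe (- x%:E) 0 * w%:E)%E.
  by move=> w0; rewrite -!EFinN -mulNr posM.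
rewrite /Rintegral; congr fine; rewrite integralE [RHS]integralE.
congr (_ - _)%E.
  under eq_integral do rewrite funeposE /= posM ?blocks_weight_ge0//.
  under [RHS]eq_integral do rewrite funeposE /= posM ?polar_density_ge0//.
  under eq_integral do rewrite -[maxe _ _](funeposE (EFin \o H)).
  under [RHS]eq_integral do rewrite -[maxe _ _](funeposE (EFin \o H)).
  exact: (integral_blocks_polar _ k0 mpos).
under eq_integral do rewrite funenegE /= negM ?blocks_weight_ge0//.
under [RHS]eq_integral do rewrite funenegE /= negM ?polar_density_ge0//.
under eq_integral do rewrite -[maxe _ _](funenegE (EFin \o H)).
under [RHS]eq_integral do rewrite -[maxe _ _](funenegE (EFin \o H)).
exact: (integral_blocks_polar _ k0 mneg).
Qed.

Lemma Cintegral_blocks_polar (G : target -> R[i]) : measurable_fun setT G ->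
  Cintegral (vol R (\sum_l k l)) setT
    (fun z => (blocks_weight j al z)%:C * G (blocks_map j z)) =
  Cintegral (polar_measure R k j) setT (fun p => (polar_density al p)%:C * G p).
Proof.
move=> mG; congr (_ +i* _).
  under eq_Rintegral do rewrite complex_real_mulE /= mulrC.
  under [RHS]eq_Rintegral do rewrite complex_real_mulE /= mulrC.
  by apply: (@Rintegral_blocks_polar (fun p => complex.Re (G p))); exact: measurable_Re.
under eq_Rintegral do rewrite complex_real_mulE /= mulrC.
under [RHS]eq_Rintegral do rewrite complex_real_mulE /= mulrC.
by apply: (@Rintegral_blocks_polar (fun p => complex.Im (G p))); exact: measurable_Im.
Qed.

End transfer.

(** * Monomials split into blocks and written in polar coordinates *)

Section block_monomials.
Variables (m : nat) (k : 'I_m -> nat).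

Lemma big_blocks (V : Type) (idx : V) (op : Monoid.com_law idx)
    (F : 'I_(\sum_l k l) -> V) :
  \big[op/idx]_i F i = \big[op/idx]_l \big[op/idx]_(i < k l) F (tagnat.Rank l i).
Proof.
rewrite (reindex _ (@tagnat.rank_bij_on _ k)) /= sig_big_dep /=.
by apply: eq_bigr => p _; rewrite tagnat.rankE.
Qed.

Lemma submxrowE (A : Type) (z : 'rV[A]_(\sum_l k l)) l i :
  submxrow z l ord0 i = z ord0 (tagnat.Rank l i).
Proof. by rewrite mxE. Qed.

Lemma monomial_blocks (A : comNzRingType) (z : 'rV[A]_(\sum_l k l)) al :
  monomial z al = \prod_l monomial (submxrow z l) (submxrow al l).
Proof.
rewrite /monomial big_blocks.
by apply: eq_bigr => l _; apply: eq_bigr => i _; rewrite !submxrowE.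
Qed.

Lemma mi_abs_blocks (al : 'rV[nat]_(\sum_l k l)) :
  mi_abs al = (\sum_l mi_abs (submxrow al l))%N.
Proof.
rewrite /mi_abs big_blocks.
by apply: eq_bigr => l _; apply: eq_bigr => i _; rewrite submxrowE.
Qed.

Lemma mi_fact_blocks (al : 'rV[nat]_(\sum_l k l)) :
  mi_fact al = (\prod_l mi_fact (submxrow al l))%N.
Proof.
rewrite /mi_fact big_blocks.
by apply: eq_bigr => l _; apply: eq_bigr => i _; rewrite submxrowE.
Qed.

Lemma enorm_block_norms (R : realType) (z : 'rV[R[i]]_(\sum_l k l)) :
  enorm (block_norms z) = cnorm z.
Proof.
congr Num.sqrt; rewrite big_blocks.
apply: eq_bigr => l _; rewrite mxE cnorm_sqr; apply: eq_bigr => i _.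
by rewrite submxrowE mxE.
Qed.

End block_monomials.

Section monomials.
Variable R : realType.
Local Notation C := R[i].

Lemma monomial_real n (s : 'rV[R]_n) al :
  (monomial s al)%:C = \prod_i (s ord0 i)%:C ^+ al ord0 i :> C.
Proof.
by rewrite /monomial rmorph_prod; apply: eq_bigr => i _; rewrite rmorphXn.
Qed.

Lemma monomialD (A : comNzRingType) n (x : 'rV[A]_n) al be :
  monomial x (al + be) = monomial x al * monomial x be.
Proof. by rewrite -big_split; apply: eq_bigr => i _; rewrite mxE exprD. Qed.

(** The powers of |z| add up to |al|. The identity holds at every z thanks to the default values of
    [sdir] and [tdir]. *)
Lemma monomial_polar n (z : 'rV[C]_n) al : monomial z al =
  (cnorm z ^+ mi_abs al * monomial (sdir z) al)%:C * monomial (tdir z) al.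
Proof.
rewrite rmorphM /= monomial_real rmorphXn /= -prodrXr -!big_split.
apply: eq_bigr => i _ /=; rewrite -!exprMn; congr (_ ^+ _).
by rewrite normc_tdir normc_sdir rmorphM mulrC.
Qed.

Lemma mul_conjc (z : C) : z * conjc z = (Normc.normc z ^+ 2)%:C.
Proof.
case: z => x y; rewrite complex_mulE /= sqr_sqrtr ?addr_ge0 ?sqr_ge0//.
by congr (_ +i* _); rewrite ?mulrN ?opprK -?expr2// mulrC addNr.
Qed.

Lemma monomial_mul_conjc n (z : 'rV[C]_n) al :
  monomial z al * conjc (monomial z al) = (monomial_normsq z al)%:C.
Proof.
rewrite mul_conjc normc_prod -prodrXl; congr (_%:C); apply: eq_bigr => i _.
by rewrite normcX -exprM mulnC.
Qed.

(** On the torus the inverse is the conjugate, so negative powers become powers of conjugates. *)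
Lemma zmonomial_torus n (t : 'rV[C]_n) al be : torus t ->
  zmonomial t (map_mx Posz al - map_mx Posz be) =
  monomial t al * conjc (monomial t be).
Proof.
move=> tt; rewrite /monomial rmorph_prod -big_split; apply: eq_bigr => i _ /=.
have t0 : t ord0 i != 0.
  by apply/eqP => ti; have /eqP := tt i; rewrite ti Normc.normc0 eq_sym oner_eq0.
have tV : (t ord0 i)^-1 = conjc (t ord0 i).
  by apply: (mulfI t0); rewrite mulfV// mul_conjc tt expr1n.
by rewrite !mxE expfzDr// -invr_expz -[X in _ * X^-1]/(t ord0 i ^+ be ord0 i) -exprVn tV rmorphXn.
Qed.

End monomials.

Section quasi_radial_integrand.
Variables (R : realType) (m : nat) (k : 'I_m -> nat) (j : 'I_m) (lam : R).
Variables (kappa : 'I_m -> nat) (alpha beta : 'rV[nat]_(\sum_l k l)).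
Hypothesis k0 : forall l, (0 < k l)%N.
Hypothesis alphaE : forall l, mi_abs (submxrow alpha l) = kappa l.
Hypothesis betaE : forall l, mi_abs (submxrow beta l) = kappa l.
Hypothesis alpha_beta : forall l, l != j -> submxrow alpha l = submxrow beta l.
Local Notation C := R[i].
Local Notation n := (\sum_l k l)%N.
Local Notation target := ('rV[R]_m * ('rV[R]_(k j) * 'rV[C]_(k j)))%type.

Definition ebasis_const (al : 'rV[nat]_n) : R :=
  Num.sqrt (Gamma (n%:R + lam + (mi_abs al)%:R + 1) /
            ((mi_fact al)%:R * Gamma (n%:R + lam + 1))).

(* On the torus, t^(alpha_j - beta_j) = t^alpha_j (t^beta_j)^*. *)
Definition polar_factor (p : target) : C :=
  (p.1 ord0 j ^+ (2 * kappa j))%:C *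
  (monomial p.2.1 (submxrow alpha j + submxrow beta j))%:C *
  (monomial p.2.2 (submxrow alpha j) * conjc (monomial p.2.2 (submxrow beta j))) *
  ((1 - enorm p.1 ^+ 2) `^ lam)%:C.

Lemma measurable_monomial_real p (al : 'rV[nat]_p) :
  measurable_fun setT (fun s : 'rV[R]_p => monomial s al).
Proof.
apply: measurable_prod => i _; apply: measurable_funX; exact: measurable_coord.
Qed.

Lemma measurable_polar_factor : measurable_fun setT polar_factor.
Proof.
have m1 : measurable_fun setT (fun p : target => p.1) := measurable_fst.
have m2 : measurable_fun setT (fun p : target => p.2) := measurable_snd.
have ms : measurable_fun setT (fun p : target => p.2.1).
  exact: (measurableT_comp measurable_fst m2).
have mt : measurable_fun setT (fun p : target => p.2.2).
  exact: (measurableT_comp measurable_snd m2).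
have mmt al : measurable_fun setT (fun p : target => monomial p.2.2 al).
  exact: (measurableT_comp (measurable_monomial al) mt).
apply: measurable_complexM; first apply: measurable_complexM.
- apply: measurable_complexM; apply: measurable_real_complex.
    apply: measurable_funX; exact: (measurableT_comp (measurable_coord j) m1).
  exact: (measurableT_comp (measurable_monomial_real _) ms).
- by apply: measurable_complexM; [exact: mmt|apply: measurable_conjc; exact: mmt].
apply: measurable_real_complex; apply: (measurableT_comp (measurable_powR lam)).
apply: measurable_funB => //; apply: measurable_funX.
exact: (measurableT_comp (@measurable_enorm R m) m1).
Qed.

Lemma conjcM (x y : C) : conjc (x * y) = conjc x * conjc y.
Proof. exact: rmorphM. Qed.

(** For l != j the two monomials have the same exponent and pair to a squared modulus; in block j
    the equal degrees give the radius the exponent 2 kappa_j. *)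
Lemma monomial_pair (z : 'rV[C]_n) :
  monomial z alpha * conjc (monomial z beta) =
  (blocks_weight j (submxrow alpha) z)%:C *
  ((cnorm (submxrow z j) ^+ (2 * kappa j))%:C *
   (monomial (sdir (submxrow z j)) (submxrow alpha j + submxrow beta j))%:C *
   (monomial (tdir (submxrow z j)) (submxrow alpha j) *
    conjc (monomial (tdir (submxrow z j)) (submxrow beta j)))).
Proof.
have W : (blocks_weight j (submxrow alpha) z)%:C =
    (\prod_(l | l != j) monomial (submxrow z l) (submxrow alpha l)) *
    conjc (\prod_(l | l != j) monomial (submxrow z l) (submxrow beta l)).
  rewrite /blocks_weight !rmorph_prod -big_split; apply: eq_bigr => l lj /=.
  by rewrite -alpha_beta// monomial_mul_conjc.
rewrite W !monomial_blocks (bigD1 j)//= [X in _ * conjc X](bigD1 j)//=.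
rewrite (monomial_polar (submxrow z j) (submxrow alpha j)).
rewrite (monomial_polar (submxrow z j) (submxrow beta j)) alphaE betaE.
rewrite mul2n -addnn exprD monomialD !conjcM conjc_real.
by rewrite !rmorphM /=; ring.
Qed.

(** Besides [monomial_pair], this uses that the weight depends on |z| alone, which is the norm of
    [block_norms z]. *)
Lemma ebasis_pair (z : 'rV[C]_n) :
  ebasis lam alpha z * conjc (ebasis lam beta z) * (weight lam z)%:C =
  (c_lam n lam * ebasis_const alpha * ebasis_const beta)%:C *
  ((blocks_weight j (submxrow alpha) z)%:C * polar_factor (blocks_map j z)).
Proof.
rewrite /polar_factor /= mxE enorm_block_norms.
rewrite /ebasis -/(ebasis_const alpha) -/(ebasis_const beta) conjcM conjc_real.
rewrite mulrACA monomial_pair /weight !rmorphM /=; ring.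
Qed.

Lemma polar_density_factor (p : target) : polar_dom R k j p ->
  (polar_density (submxrow alpha) p)%:C * polar_factor p =
  (blocks_const R j (submxrow alpha))%:C *
  ((monomial p.2.1 (submxrow alpha j + submxrow beta j + const_mx 1%N))%:C *
   zmonomial p.2.2
     (map_mx Posz (submxrow alpha j) - map_mx Posz (submxrow beta j)) *
   ((1 - enorm p.1 ^+ 2) `^ lam *
    \prod_l p.1 ord0 l ^+ (2 * k l + 2 * kappa l - 1))%:C).
Proof.
case: p => r [s t] [[/= r0 r1] [[s0 s1] tt]]; rewrite /polar_factor /=.
(* A positive power vanishes at 0 by itself. *)
have posX (x : R) e : 0 <= x -> (0 < e)%N -> x ^+ e * (0 < x)%R%:R = x ^+ e.
  rewrite le_eqVlt => /orP[/eqP <-|->] e0; last by rewrite mulr1.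
  by rewrite ltxx mulr0 expr0n gtn_eqF.
(* In block j, r_j^(2 k_j - 1) is the Jacobian and r_j^(2 kappa_j) comes from the monomials. *)
have E1 : \prod_l r ord0 l ^+ (2 * k l + 2 * kappa l - 1) =
    (\prod_l radial_weight j (submxrow alpha) l (r ord0 l)) *
    r ord0 j ^+ (2 * kappa j).
  rewrite (bigD1 j)//= [in RHS](bigD1 j)//= mulrAC; congr (_ * _).
    rewrite /radial_weight /radial_exponent eqxx posX// ?subn_gt0.
      by rewrite -exprD addnBAC// muln_gt0 k0.
    by have := k0 j; lia.
  apply: eq_bigr => l lj; rewrite /radial_weight /radial_exponent (negbTE lj).
  by rewrite alphaE posX//; have := k0 l; lia.
(* The exponent 1 added to every coordinate is the Jacobian [pos_prod s]. *)
have E2 : monomial s (submxrow alpha j + submxrow beta j + const_mx 1%N) =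
    monomial s (submxrow alpha j + submxrow beta j) * pos_prod s.
  rewrite monomialD; congr (_ * _); apply: eq_bigr => i _.
  by rewrite mxE -[X in X * _]expr1 posX.
rewrite zmonomial_torus// E1 E2 /polar_density /= !rmorphM /=; ring.
Qed.

End quasi_radial_integrand.

Section polar_domain.
Variables (R : realType) (m : nat) (k : 'I_m -> nat) (j : 'I_m).
Local Notation C := R[i].

Lemma measurable_row_forall d (T : measurableType d) n (A : set T) : measurable A ->
  measurable [set x : 'rV[T]_n | forall i, A (x ord0 i)].
Proof.
move=> mA; rewrite (_ : mkset _ = \bigcap_(i in [set: 'I_n])
    ((fun x : 'rV[T]_n => x ord0 i) @^-1` A)); last first.
  by apply/seteqP; split => x /= xA; [move=> i _; exact: xA|move=> i; exact: (xA i I)].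
apply: fin_bigcap_measurable => // i _; rewrite -[X in measurable X]setTI.
exact: measurable_coord.
Qed.

Lemma measurable_nonneg_rows n : measurable [set x : 'rV[R]_n | forall i, 0 <= x ord0 i].
Proof.
rewrite (_ : mkset _ = [set x : 'rV[R]_n | forall i, `[0, +oo[%classic (x ord0 i)]).
  by apply: measurable_row_forall; exact: measurable_itv.
by apply/seteqP; split => x /= x0 i; have := x0 i; rewrite in_itv/= andbT.
Qed.

Lemma measurable_polar_dom : measurable (polar_dom R k j).
Proof.
have mN n (A : set R) : measurable A -> measurable (@enorm R n @^-1` A).
  by move=> mA; rewrite -[X in measurable X]setTI; exact: measurable_enorm.
apply: measurableX; last apply: measurableX.
- rewrite (_ : @tau_ball R m = [set x : 'rV[R]_m | forall i, 0 <= x ord0 i] `&`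
    @enorm R m @^-1` `]-oo, 1[).
    by apply: measurableI; [exact: measurable_nonneg_rows|apply: mN].
  by apply/seteqP; split => x /= []; rewrite in_itv.
- rewrite (_ : @sphere_plus R (k j) = [set x : 'rV[R]_(k j) | forall i, 0 <= x ord0 i] `&`
    @enorm R (k j) @^-1` [set 1]).
    by apply: measurableI; [exact: measurable_nonneg_rows|apply: mN].
  by apply/seteqP; split => x /= [].
apply: (@measurable_row_forall _ C _ (@Normc.normc R @^-1` [set 1])).
rewrite -[X in measurable X]setTI.
by apply: (measurable_normc (@measurable_id _ _ _)) => //; exact: measurable_set1.
Qed.

Lemma polar_dom_blocks_map z : (0 < k j)%N ->
  polar_dom R k j (blocks_map j z) <-> cball z.
Proof.
move=> kj; rewrite /polar_dom /blocks_map /tau_ball /= enorm_block_norms.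
split => [[[]]//|z1]; split; last first.
  by split; [exact: sphere_plus_sdir|exact: torus_tdir].
by split => // l; rewrite mxE cnorm_ge0.
Qed.

(** Makes [polar_symbol] usable with one measurable choice of the directions. *)
Lemma polar_block_dir (z : 'rV[C]_(\sum_l k l)) : (0 < k j)%N ->
  @polar_block R m k j z (sdir (submxrow z j)) (tdir (submxrow z j)).
Proof.
move=> kj; split; [exact: sphere_plus_sdir|exact: torus_tdir|move=> i].
by rewrite {1}normc_tdir normc_sdir rmorphM mulrCA.
Qed.

End polar_domain.

(** The factors common to both roots come out; [A] and [B], the factorials of block j for alpha and
    beta, stay inside. [P] is the product of the factorials of the other blocks. *)
Lemma sqrt_ratio (R : rcfType) (G G0 P A B : R) :
  0 <= G -> 0 < G0 -> 0 < P -> 0 < A -> 0 < B ->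
  Num.sqrt (G / (A * P * G0)) * Num.sqrt (G / (B * P * G0)) =
  G / G0 / (P * Num.sqrt (A * B)).
Proof.
move=> G_ge0 G0_gt0 P0 A0 B0.
have GP : 0 <= G / G0 / P by rewrite !divr_ge0// ltW.
rewrite -sqrtrM; last by rewrite divr_ge0// !mulr_ge0// ltW.
rewrite [X in Num.sqrt X = _](_ : _ = (G / G0 / P) ^+ 2 / (A * B)); last first.
  by field; rewrite !gt_eqF.
rewrite sqrtrM ?sqr_ge0// sqrtr_sqr ger0_norm// sqrtrV ?invfM ?mulrA//.
by rewrite mulr_ge0 ?ltW.
Qed.

(** * The constant in front of the integral *)

Section constant.
Variables (R : realType) (m : nat) (k : 'I_m -> nat) (j : 'I_m) (lam : R).
Variables (kappa : 'I_m -> nat) (alpha beta : 'rV[nat]_(\sum_l k l)).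
Hypothesis k0 : forall l, (0 < k l)%N.
Hypothesis lam1 : -1 < lam.
Hypothesis alphaE : forall l, mi_abs (submxrow alpha l) = kappa l.
Hypothesis betaE : forall l, mi_abs (submxrow beta l) = kappa l.
Hypothesis alpha_beta : forall l, l != j -> submxrow alpha l = submxrow beta l.
Local Notation n := (\sum_l k l)%N.

Lemma sum_blocks_gt0 : (0 < n)%N.
Proof. by rewrite (bigD1 j)//= addn_gt0 k0. Qed.

(** One 2 for each block l != j gives 2^(m-1); pi^n loses the pi^k_l of these blocks; their
    factorials and Gamma (n + lam + 1) cancel. *)
Lemma coefficient_const :
  c_lam n lam * ebasis_const lam alpha * ebasis_const lam beta *
    blocks_const R j (submxrow alpha) =
  2 ^+ m.-1 * Gamma (n%:R + lam + (\sum_l kappa l)%:R + 1) /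
   (pi ^+ k j * Gamma (lam + 1) *
    Num.sqrt ((mi_fact (submxrow alpha j))%:R *
              (mi_fact (submxrow beta j))%:R) *
    \prod_(l | l != j) (k l + kappa l - 1)`!%:R).
Proof.
have absE (al : 'rV[nat]_n) : (forall l, mi_abs (submxrow al l) = kappa l) ->
    mi_abs al = (\sum_l kappa l)%N.
  by move=> alE; rewrite mi_abs_blocks; apply: eq_bigr.
rewrite /ebasis_const /c_lam !absE//.
set G := Gamma (_ + _ + _ + 1); set G0 := Gamma (n%:R + lam + 1).
have G00 : 0 < G0.
  (* n + lam + 1 >= 1, because n >= 1 and lam > -1. *)
  apply: Gamma_gt0; rewrite lerDr -lerBlDr sub0r.
  by apply: (@le_trans _ _ 1); [rewrite lerNl ltW|rewrite ler1n sum_blocks_gt0].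
have Gge : 0 <= G by exact: Gamma_ge0.
pose P : R := \prod_(l | l != j) (mi_fact (submxrow alpha l))%:R.
pose Q : R := \prod_(l | l != j) ((k l + kappa l - 1)`!)%:R.
have P0 : 0 < P by apply: prodr_gt0 => l _; rewrite ltr0n mi_fact_gt0.
have aE : (mi_fact alpha)%:R = (mi_fact (submxrow alpha j))%:R * P.
  by rewrite mi_fact_blocks (bigD1 j)//= natrM natr_prod.
have bE : (mi_fact beta)%:R = (mi_fact (submxrow beta j))%:R * P.
  rewrite mi_fact_blocks (bigD1 j)//= natrM natr_prod; congr (_ * _).
  by apply: eq_bigr => l lj; rewrite alpha_beta.
have BE : blocks_const R j (submxrow alpha) =
    2 ^+ m.-1 * (\prod_(l | l != j) pi ^+ k l) * P / Q.
  rewrite /blocks_const /block_const /Q !big_split /= prodfV; congr (_ * _ * _ / _).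
    rewrite prodr_const; congr (_ ^+ _).
    by have := cardC1 j; rewrite card_ord => <-; apply: eq_card.
  by apply: eq_bigr => l _; rewrite alphaE.
have piE : pi ^+ n = pi ^+ k j * \prod_(l | l != j) pi ^+ k l :> R.
  by rewrite prodrXr (bigD1 j)//= exprD.
set p := \prod_(l | l != j) pi ^+ k l in BE piE.
have p0 : 0 < p by apply: prodr_gt0 => l _; rewrite exprn_gt0 ?pi_gt0.
set A : R := (mi_fact (submxrow alpha j))%:R.
set B : R := (mi_fact (submxrow beta j))%:R.
have A0 : 0 < A by rewrite ltr0n mi_fact_gt0.
have B0 : 0 < B by rewrite ltr0n mi_fact_gt0.
rewrite -(mulrA (G0 / _)) aE bE sqrt_ratio// BE piE !invfM -/Q.
have q0 : 0 < Num.sqrt (A * B) by rewrite sqrtr_gt0 mulr_gt0.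
clear -G00 P0 p0 q0.
(* Quantities that occur only as inverses become variables, so [field] asks for nonzero values of
   the remaining denominators alone. *)
move: (Gamma (lam + 1))^-1 Q^-1 (pi ^- k j) (Num.sqrt (A * B)) q0 => gl iQ ip q q0.
by field; rewrite !gt_eqF.
Qed.

End constant.

Theorem corollary7p7 (R : realType) (m : nat) (k : 'I_m -> nat) (j : 'I_m)
    (lam : R) (a : 'rV[R[i]]_(\sum_l k l) -> R[i])
    (g : 'rV[R]_m -> 'rV[R]_(k j) -> 'rV[R[i]]_(k j) -> R[i])
    (B : ('rV[R[i]]_(\sum_l k l) -> R[i]) -> ('rV[R[i]]_(\sum_l k l) -> R[i])) :
  (2 <= m)%N ->
  (forall l, (0 < k l)%N) ->
  -1 < lam ->
  Linfty (vol R (\sum_l k l)) cball a ->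
  quasi_radial_quasi_homogeneous j a ->
  Linfty (polar_measure R k j) (polar_dom R k j)
    (fun p => g p.1 p.2.1 p.2.2) ->
  (forall r s t (eta : R[i]), tau_ball r -> sphere_plus s -> torus t ->
     Normc.normc eta = 1 -> g r s (eta *: t) = g r s t) ->
  polar_symbol a g ->
  bergman_projection lam B ->
  forall (kappa : 'I_m -> nat) (alpha beta : 'rV[nat]_(\sum_l k l)),
  (forall l, mi_abs (submxrow alpha l) = kappa l) ->
  (forall l, mi_abs (submxrow beta l) = kappa l) ->
  (forall l, l != j -> submxrow alpha l = submxrow beta l) ->
  inner lam (toeplitz B a (ebasis lam alpha)) (ebasis lam beta) =
  (2 ^+ m.-1 *
   Gamma ((\sum_l k l)%:R + lam + (\sum_l kappa l)%:R + 1) /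
   (pi ^+ k j * Gamma (lam + 1) *
    Num.sqrt ((mi_fact (submxrow alpha j))%:R *
              (mi_fact (submxrow beta j))%:R) *
    \prod_(l | l != j) (k l + kappa l - 1)`!%:R))%:C *
  Cintegral (polar_measure R k j) (polar_dom R k j)
    (fun p : 'rV[R]_m * ('rV[R]_(k j) * 'rV[R[i]]_(k j)) =>
       let: (r, (s, t)) := p in
       g r s t *
       (monomial s
          (submxrow alpha j + submxrow beta j + const_mx 1%N))%:C *
       zmonomial t
         (map_mx Posz (submxrow alpha j) - map_mx Posz (submxrow beta j)) *
       ((1 - enorm r ^+ 2) `^ lam *
        \prod_l r ord0 l ^+ (2 * k l + 2 * kappa l - 1))%:C).
Proof.
move=> m2 k0 lam1 La _ Lg _ sym pB kappa alpha beta alphaE betaE ab.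
have n0 : (0 < \sum_l k l)%N := sum_blocks_gt0 j k0.
have mB := @measurable_cball R (\sum_l k l).
have mD := @measurable_polar_dom R m k j.
rewrite (inner_toeplitz _ _ n0 lam1 pB La) -(coefficient_const k0 lam1 alphaE betaE ab).
pose c0 := c_lam (\sum_l k l) lam * ebasis_const lam alpha * ebasis_const lam beta.
have c00 : 0 <= c0 by rewrite mulr_ge0 ?sqrtr_ge0// mulr_ge0 ?sqrtr_ge0 ?c_lam_ge0.
pose bc := blocks_const R j (submxrow alpha).
have bc0 : 0 < bc by exact: blocks_const_gt0.
rewrite -/c0 -/bc.
(* [g] is controlled on [polar_dom] only. Its extension by 0 is measurable everywhere and also
   encodes the ball, since z is in the ball exactly when [blocks_map j z] is in [polar_dom]. *)
pose gD := (fun p : 'rV[R]_m * ('rV[R]_(k j) * 'rV[R[i]]_(k j)) =>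
  g p.1 p.2.1 p.2.2) \_ (polar_dom R k j).
have mgD : measurable_fun setT gD.
  by have [mg _] := Lg; exact: (measurable_restrictT _ mD).1 mg.
pose G p := gD p * polar_factor lam kappa alpha beta p.
have mG : measurable_fun setT G.
  by apply: measurable_complexM => //; exact: measurable_polar_factor.
pose F z := (blocks_weight j (submxrow alpha) z)%:C * G (blocks_map j z).
have mF : measurable_fun setT F.
  apply: measurable_complexM.
    by apply: measurable_real_complex; exact: measurable_blocks_weight.
  exact: (measurableT_comp mG (@measurable_blocks_map R m k j)).
(* Replacing the symbol by [g] along the chosen directions is valid almost everywhere; the rest of
   the integrand is rewritten at every point. *)
transitivity (Cintegral (vol R (\sum_l k l)) cball (fun z => c0%:C * F z)).
  apply: ae_eq_Cintegral => //.
  - have me al : measurable_fun cball (@ebasis R (\sum_l k l) lam al).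
      by apply: measurable_funTS; exact: measurable_ebasis.
    apply: measurable_complexM_on => //; last first.
      by apply: measurable_funTS; apply: measurable_real_complex; exact: measurable_weight.
    apply: measurable_complexM_on => //; last exact: measurable_conjc_on.
    by apply: measurable_complexM_on => //; case: La.
  - by apply: measurable_funTS; apply: measurable_complexM.
  apply: filterS sym => z sym zB.
  have az := sym zB _ _ (polar_block_dir z (k0 j)).
  rewrite -!(mulrA (a z)) (ebasis_pair lam alphaE betaE ab) /F /G /gD patchE.
  rewrite mem_set; last exact/polar_dom_blocks_map.
  by rewrite -az mulrCA; congr (_ * _); rewrite mulrCA.
(* Off the ball [gD] is 0, so the integral extends to the whole space, where the transfer formula is
   stated. *)
rewrite Cintegral_mkcond (_ : _ \_ _ = fun z => c0%:C * F z); last first.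
  apply/funext => z; rewrite patchE; case: ifPn => //.
  rewrite notin_setE => zB; rewrite /F /G /gD patchE memNset ?mul0r ?mulr0//.
  by move/polar_dom_blocks_map => /(_ (k0 j)).
rewrite Cintegral_scale// Cintegral_blocks_polar//.
pose K p := (polar_density (submxrow alpha) p)%:C * G p.
have mK : measurable_fun setT K.
  apply: measurable_complexM => //; apply: measurable_real_complex.
  exact: measurable_polar_density.
(* The constant [bc] of the integrated blocks sits inside [polar_density]; it is brought out by
   scaling with its inverse. *)
have cbc : (c0 * bc)%:C = c0%:C * bc%:C by exact: rmorphM.
rewrite [in RHS]cbc -[RHS]mulrA; congr (_ * _); rewrite [in RHS]Cintegral_mkcond.
rewrite (_ : _ \_ _ = fun p => (bc^-1)%:C * K p).
  rewrite Cintegral_scale ?invr_ge0 1?ltW// mulrA -[X in X * _]rmorphM.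
  by rewrite divff ?gt_eqF// rmorph1 mul1r.
apply/funext => p; rewrite patchE; case: ifPn => [|pD]; last first.
  by rewrite /K /G /gD patchE (negbTE pD) mul0r !mulr0.
rewrite inE => pD; rewrite /K /G /gD patchE mem_set// [X in _ = _ * X]mulrCA.
rewrite (polar_density_factor lam beta k0 alphaE pD) -/bc [RHS]mulrCA.
rewrite mulrA -[X in X * _](mulrC _ (g _ _ _)).
case: p pD => r [s t] _ /=.
have bcV : (bc^-1)%:C * bc%:C = 1 :> R[i].
  by rewrite -[LHS]rmorphM mulVf ?gt_eqF// rmorph1.
by rewrite [RHS]mulrACA bcV mul1r !mulrA.
Qed.
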